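(* Let $\alpha:\{0\}^*\to\{0,1\}^*$ be a length-preserving function and $c>0$ a constant. If $\alpha(0^n)\notin\text{i.o.-EXP}/(n-c\log n)$, then for every $A\in\mathrm{EXP}$: if $A\in\mathrm P/\alpha(0^{n^d})$ for some $d>0$, then $A\in\mathrm{BPP}/O(n\log n)$.
   Context: Advice computation: a machine gets input $(x,\gamma(|x|))$ for an advice function $\gamma$, has random access to its input, and its running time is measured in $|x|$. ''$\alpha(0^n)\notin\text{i.o.-EXP}/f(n)$'' means: there is no pair of a machine $N$ running in time $2^{n^{O(1)}}$ on inputs $(0^n,\beta)$ and an advice function $\beta$ with $|\beta(n)|\le f(n)$ such that $N(0^n,\beta(n))=\alpha(0^n)$ for infinitely many $n$. ''$A\in\mathrm P/\alpha(0^{n^d})$'' means there is a Turing machine $M$ such that for every $x$, $M(x,\alpha(0^{|x|^d}))$ runs in time polynomial in $|x|$ and accepts iff $x\in A$. $\mathrm{BPP}/O(n\log n)$ is the class of languages decided by bounded-error (error at most $1/3$) probabilistic polynomial-time machines that receive an advice string of length $O(n\log n)$ depending only on the input length $n$. *)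

(* Defs.v *)
From Stdlib Require Import Reals List Arith.
Import ListNotations.

(** Head moves. Moving left at cell 0 stays at 0. *)
Inductive Move := MoveL | MoveS | MoveR.
Definition move (m : Move) (p : nat) : nat :=
  match m with MoveL => pred p | MoveS => p | MoveR => S p end.

(** A Turing machine with: read-only input tape, read-only advice tape,
    read-only random tape, and one read/write work tape (which also serves
    as output tape).  Tape symbols are [option bool] ([None] = blank).
    States are [0 .. tm_nstates + 2]; state 0 is the start state,
    state 1 is halt-accept, state 2 is halt-reject.  The transition function
    receives (state, input sym, advice sym, random sym, work sym) and returns
    (new state, written work symbol, moves of input/advice/random/work heads).
    New states are reduced modulo the number of states, so only a finite
    table of [tm_delta] matters. *)
Record TM := mkTM {
  tm_nstates : nat;
  tm_delta : nat -> option bool -> option bool -> option bool -> option bool ->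
             nat * option bool * Move * Move * Move * Move }.

Record Config := mkConfig {
  c_state : nat; c_in : nat; c_adv : nat; c_rnd : nat; c_work : nat;
  c_tape : nat -> option bool }.

Definition init_config : Config := mkConfig 0 0 0 0 0 (fun _ => None).

Definition halted (q : nat) : bool := (q =? 1) || (q =? 2).

Definition step (M : TM) (x a r : list bool) (c : Config) : Config :=
  if halted (c_state c) then c else
  match tm_delta M (c_state c) (nth_error x (c_in c)) (nth_error a (c_adv c))
                   (nth_error r (c_rnd c)) (c_tape c (c_work c)) with
  | (q', w, mi, ma, mr, mw) =>
      mkConfig (q' mod (tm_nstates M + 3)) (move mi (c_in c)) (move ma (c_adv c))
               (move mr (c_rnd c)) (move mw (c_work c))
               (fun i => if i =? c_work c then w else c_tape c i)
  end.

Definition run (M : TM) (x a r : list bool) (t : nat) : Config :=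
  Nat.iter t (step M x a r) init_config.

Definition halts_within (M : TM) (x a r : list bool) (t : nat) : Prop :=
  halted (c_state (run M x a r t)) = true.

Definition accepts_b (M : TM) (x a r : list bool) (t : nat) : bool :=
  c_state (run M x a r t) =? 1.

Fixpoint read_out (f : nat -> option bool) (i k : nat) : list bool :=
  match k with
  | 0 => []
  | S k' => match f i with Some b => b :: read_out f (S i) k' | None => [] end
  end.

Definition output (M : TM) (x a r : list bool) (t : nat) : list bool :=
  read_out (c_tape (run M x a r t)) 0 t.

Definition poly_bound (k n : nat) : nat := k + (S n) ^ k.
Definition exp_bound (k n : nat) : nat := k + 2 ^ ((S n) ^ k).

Definition zeros (n : nat) : list bool := repeat false n.

Definition language := list bool -> Prop.

Fixpoint all_strings (m : nat) : list (list bool) :=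
  match m with
  | 0 => [[]]
  | S m' => map (cons false) (all_strings m') ++ map (cons true) (all_strings m')
  end.

Definition In_EXP (A : language) : Prop :=
  exists (M : TM) (k : nat), forall x,
    halts_within M x [] [] (exp_bound k (length x)) /\
    (accepts_b M x [] [] (exp_bound k (length x)) = true <-> A x).

(** A \in P/alpha(0^{n^d}); [alpha n] stands for alpha(0^n). *)
Definition In_P_adv_alpha (alpha : nat -> list bool) (d : nat) (A : language) : Prop :=
  exists (M : TM) (k : nat), forall x,
    halts_within M x (alpha (length x ^ d)) [] (poly_bound k (length x)) /\
    (accepts_b M x (alpha (length x ^ d)) [] (poly_bound k (length x)) = true <-> A x).

Definition In_BPP_nlogn (A : language) : Prop :=
  exists (M : TM) (k C n0 : nat) (gamma : nat -> list bool),
    (forall n, n0 <= n -> length (gamma n) <= C * n * Nat.log2 n) /\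
    forall x,
      let t := poly_bound k (length x) in
      let a := gamma (length x) in
      (forall r, length r = t -> halts_within M x a r t) /\
      (A x -> 3 * length (filter (fun r => accepts_b M x a r t) (all_strings t))
                >= 2 * 2 ^ t) /\
      (~ A x -> 3 * length (filter (fun r => negb (accepts_b M x a r t)) (all_strings t))
                >= 2 * 2 ^ t).

Definition log2R (y : R) : R := (ln y / ln 2)%R.

Definition io_EXP_adv (alpha : nat -> list bool) (f : nat -> R) : Prop :=
  exists (N : TM) (k : nat) (beta : nat -> list bool) (n0 : nat),
    (forall n, halts_within N (zeros n) (beta n) [] (exp_bound k n)) /\
    (forall n, n0 <= n -> (INR (length (beta n)) <= f n)%R) /\
    (forall m, exists n, m <= n /\
       output N (zeros n) (beta n) [] (exp_bound k n) = alpha n).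

(* Main.v *)
(** If [A] is in EXP and in P/[alpha], call a string [w] of length [n^d] good when it can replace
    the advice on all inputs of length [n].  An EXP machine can list the good strings, so
    [alpha] at [n^d] is described by [n] and an index; hardness of [alpha] therefore forces the good
    strings to have density at least 1/poly(n).  Greedily collect labelled examples on which more
    than a quarter of the strings consistent with the previous examples err: each shrinks the set of
    consistent strings by 3/4 and all good strings survive, so O(log n) examples, that is O(n log n)
    bits of advice, suffice to make at least 3/4 of the consistent strings right on every input.
    A consistent string is found by rejection sampling in polynomial time.

    Both machines are written in a small language of stack programs, which is compiled to Turing
    machines with polynomial overhead. *)

Require Import Defs.
From Stdlib Require Import Reals List Arith.
From Stdlib Require Import ZArith Lia Lra Bool FinFun FunctionalExtensionality.
From Stdlib Require Import Classical ClassicalEpsilon.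
Import ListNotations.

(** * Stack programs and their compilation to Turing machines *)

(* Registers 0, 1 and 2 are the unread parts of the input, advice and random tapes and can only be
   popped; the other registers are stacks kept on the work tape. *)
Definition store := nat -> list bool.
Definition upd (s : store) (r : nat) (v : list bool) : store :=
  fun i => if i =? r then v else s i.

Definition nreg : nat := 40.

Inductive instr :=
| IGoto (l : nat)
| IPush (r : nat) (b : bool) (l : nat)
| IPop (r l0 lF lT : nat)
| IHalt (b : bool)
| ICompact.

Definition sel {A : Type} (o : option bool) (a0 aF aT : A) : A :=
  match o with None => a0 | Some false => aF | Some true => aT end.

Inductive frun (code : list instr) : nat -> store -> nat -> nat -> store -> Prop :=
| frun_refl pc s : frun code pc s 0 pc s
| frun_goto pc s l t pc' s' :
    nth_error code pc = Some (IGoto l) ->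
    frun code l s t pc' s' -> frun code pc s (S t) pc' s'
| frun_push pc (s : store) r b l t pc' s' :
    nth_error code pc = Some (IPush r b l) -> 3 <= r < nreg ->
    frun code l (upd s r (b :: s r)) t pc' s' -> frun code pc s (S t) pc' s'
| frun_pop pc (s : store) r l0 lF lT t pc' s' :
    nth_error code pc = Some (IPop r l0 lF lT) -> r < nreg ->
    frun code (sel (hd_error (s r)) l0 lF lT) (upd s r (tl (s r))) t pc' s' ->
    frun code pc s (S t) pc' s'.

Lemma frun_trans code pc s t pc1 s1 t' pc2 s2 :
  frun code pc s t pc1 s1 -> frun code pc1 s1 t' pc2 s2 ->
  frun code pc s (t + t') pc2 s2.
Proof.
  induction 1; intros; simpl; auto.
  - eapply frun_goto; eauto.
  - eapply frun_push; eauto.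
  - eapply frun_pop; eauto.
Qed.

Inductive cmd :=
| Skip
| Push (r : nat) (b : bool)
| Pop (r : nat) (c0 cF cT : cmd)
| Seq (c1 c2 : cmd)
| While (r : nat) (cF cT : cmd).

Inductive exec : cmd -> store -> nat -> store -> Prop :=
| exec_skip (s : store) : exec Skip s 1 s
| exec_push r b (s : store) : 3 <= r < nreg -> exec (Push r b) s 1 (upd s r (b :: s r))
| exec_pop r c0 cF cT (s : store) t s' : r < nreg ->
    exec (sel (hd_error (s r)) c0 cF cT) (upd s r (tl (s r))) t s' ->
    exec (Pop r c0 cF cT) s (S t) s'
| exec_seq c1 c2 s t1 s1 t2 s2 :
    exec c1 s t1 s1 -> exec c2 s1 t2 s2 -> exec (Seq c1 c2) s (t1 + t2) s2
| exec_while_end r cF cT (s : store) : r < nreg -> s r = [] -> exec (While r cF cT) s 1 s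
| exec_while_step r cF cT (s : store) b l t1 s1 t2 s2 : r < nreg -> s r = b :: l ->
    exec (if b then cT else cF) (upd s r l) t1 s1 ->
    exec (While r cF cT) s1 t2 s2 -> exec (While r cF cT) s (S (t1 + t2)) s2.

Fixpoint csize (c : cmd) : nat :=
  match c with
  | Skip | Push _ _ => 1
  | Pop _ c0 cF cT => S (csize c0 + csize cF + csize cT)
  | Seq c1 c2 => csize c1 + csize c2
  | While _ cF cT => S (csize cF + csize cT)
  end.

Fixpoint comp (c : cmd) (pc nxt : nat) : list instr :=
  match c with
  | Skip => [IGoto nxt]
  | Push r b => [IPush r b nxt]
  | Pop r c0 cF cT =>
      let p0 := S pc in let pF := p0 + csize c0 in let pT := pF + csize cF in
      IPop r p0 pF pT :: comp c0 p0 nxt ++ comp cF pF nxt ++ comp cT pT nxt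
  | Seq c1 c2 => comp c1 pc (pc + csize c1) ++ comp c2 (pc + csize c1) nxt
  | While r cF cT =>
      let pF := S pc in let pT := pF + csize cF in
      IPop r nxt pF pT :: comp cF pF pc ++ comp cT pT pc
  end.

Lemma comp_length c : forall pc nxt, length (comp c pc nxt) = csize c.
Proof.
  induction c; intros; simpl; repeat rewrite length_app;
    repeat match goal with H : forall pc nxt, _ = _ |- _ => rewrite H; clear H end; lia.
Qed.

Definition code_at (code : list instr) (pc : nat) (l : list instr) : Prop :=
  exists p q, code = p ++ l ++ q /\ length p = pc.

Lemma code_at_app code pc l1 l2 :
  code_at code pc (l1 ++ l2) -> code_at code pc l1 /\ code_at code (pc + length l1) l2.
Proof.
  intros (p & q & -> & <-). split.
  - exists p, (l2 ++ q). now rewrite <- (app_assoc l1).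
  - exists (p ++ l1), q. rewrite length_app, !app_assoc. auto.
Qed.

Lemma code_at_cons code pc i l :
  code_at code pc (i :: l) -> nth_error code pc = Some i /\ code_at code (S pc) l.
Proof.
  intros H. split.
  - destruct H as (p & q & -> & <-). rewrite nth_error_app2, Nat.sub_diag; auto.
  - apply (code_at_app _ _ [i] l) in H. simpl in H. rewrite Nat.add_1_r in H. apply H.
Qed.

Lemma comp_correct c s t s' : exec c s t s' ->
  forall code pc nxt, code_at code pc (comp c pc nxt) -> frun code pc s t nxt s'.
Proof.
  induction 1; intros code pc nxt Hc; simpl in Hc.
  - apply code_at_cons in Hc as [Hc _]. eapply frun_goto; eauto. constructor.
  - apply code_at_cons in Hc as [Hc _]. eapply frun_push; eauto. constructor.
  - apply code_at_cons in Hc as [Hc H1].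
    apply code_at_app in H1 as [H1 H2]. rewrite comp_length in H2.
    apply code_at_app in H2 as [H2 H3]. rewrite comp_length in H3.
    eapply frun_pop; eauto. apply IHexec.
    destruct (hd_error (s r)) as [[|]|]; simpl; auto.
  - apply code_at_app in Hc as [H1 H2]. rewrite comp_length in H2.
    eapply frun_trans; eauto.
  - apply code_at_cons in Hc as [Hc _]. eapply frun_pop; eauto.
    rewrite H0; simpl.
    replace (upd s r []) with s; [constructor|].
    apply functional_extensionality; intro i; unfold upd.
    destruct (Nat.eqb_spec i r); subst; auto.
  - assert (Hc0 := Hc). apply code_at_cons in Hc as [Hc H3].
    apply code_at_app in H3 as [H3 H4]. rewrite comp_length in H4.
    eapply frun_pop; eauto. rewrite H0; simpl.
    eapply frun_trans; [|eapply IHexec2; exact Hc0].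
    apply IHexec1. destruct b; auto.
Qed.

(* [QSeek] walks to the top of a stack in strides of [nreg] cells, remembering the last symbol seen;
   [QBack] returns to that symbol when it is popped; [QRet] returns to cell 0; [QScan], [QData],
   [QCarry] and [QWrite] implement [ICompact]. *)
Inductive Q :=
| QStart | QAcc | QRej
| QIn (pc : nat)
| QSeek (pc : nat) (last : option bool) (i : nat)
| QBack (pc : nat) (b : bool) (i : nat)
| QRet (pc i : nat)
| QScan (first : bool) | QData (first : bool) | QCarry (first b : bool) | QWrite (b : bool).

Lemma Q_eq_dec (p q : Q) : {p = q} + {p <> q}.
Proof. decide equality; try apply Nat.eq_dec; repeat decide equality. Defined.

Fixpoint index (q : Q) (l : list Q) : nat :=
  match l with [] => 0 | a :: l => if Q_eq_dec q a then 0 else S (index q l) end.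

Lemma nth_index q l d : In q l -> nth (index q l) l d = q.
Proof.
  induction l; simpl; [easy|]. intros H. destruct (Q_eq_dec q a); auto.
  apply IHl. destruct H; congruence.
Qed.

Lemma index_lt q l : In q l -> index q l < length l.
Proof.
  induction l; simpl; [easy|]. intros H. destruct (Q_eq_dec q a); [lia|].
  apply -> Nat.succ_lt_mono. apply IHl. destruct H; congruence.
Qed.

Definition bump (o : option bool) : Move := match o with None => MoveS | _ => MoveR end.

Section Machine.
Variable code : list instr.

Definition delta (q : Q) (xi xa xr xw : option bool) :
    Q * option bool * Move * Move * Move * Move :=
  let go q' w m := (q', w, MoveS, MoveS, MoveS, m) in
  match q with
  | QStart => go (QIn 0) (Some true) MoveS
  | QAcc | QRej => go q xw MoveS
  | QIn pc =>
      match nth_error code pc with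
      | None => go QRej xw MoveS
      | Some (IGoto l) => go (QIn l) xw MoveS
      | Some (IPush r _ _) => go (QSeek pc None r) xw MoveS
      | Some (IPop r l0 lF lT) =>
          match r with
          | 0 => (QIn (sel xi l0 lF lT), xw, bump xi, MoveS, MoveS, MoveS)
          | 1 => (QIn (sel xa l0 lF lT), xw, MoveS, bump xa, MoveS, MoveS)
          | 2 => (QIn (sel xr l0 lF lT), xw, MoveS, MoveS, bump xr, MoveS)
          | _ => go (QSeek pc None r) xw MoveS
          end
      | Some (IHalt b) => go (if b then QAcc else QRej) xw MoveS
      | Some ICompact => go (QScan true) xw MoveR
      end
  | QSeek pc last (S i) => go (QSeek pc last i) xw MoveR
  | QSeek pc last 0 =>
      match xw with
      | Some b => go (QSeek pc (Some b) (nreg - 1)) xw MoveR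
      | None =>
          match nth_error code pc with
          | Some (IPush r b l) => go (QRet l r) (Some b) MoveS
          | Some (IPop r l0 lF lT) =>
              match last with
              | None => go (QRet l0 r) None MoveS
              | Some b => go (QBack pc b (nreg - 1)) None MoveL
              end
          | _ => go QRej xw MoveS
          end
      end
  | QBack pc b (S i) => go (QBack pc b i) xw MoveL
  | QBack pc b 0 =>
      match nth_error code pc with
      | Some (IPop r l0 lF lT) => go (QRet (if b then lT else lF) r) None MoveS
      | _ => go QRej xw MoveS
      end
  | QRet l (S i) => go (QRet l i) xw MoveL
  | QRet l 0 =>
      match xw with
      | Some _ => go (QIn l) xw MoveS
      | None => go (QRet l (nreg - 1)) xw MoveL
      end
  | QScan f =>
      match xw with
      | None => go (QScan f) xw MoveR
      | Some true => go (QData f) None MoveR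
      | Some false => go QAcc None MoveS
      end
  | QData f =>
      match xw with
      | None => go (QData f) xw MoveR
      | Some b => go (QCarry f b) None MoveL
      end
  | QCarry f b =>
      match xw with
      | None => go (QCarry f b) xw MoveL
      | Some _ => if f then go (QScan false) (Some b) MoveR else go (QWrite b) xw MoveR
      end
  | QWrite b => go (QScan false) (Some b) MoveR
  end.

Definition states : list Q :=
  [QStart; QAcc; QRej] ++
  flat_map (fun pc => QIn pc ::
     flat_map (fun i => [QSeek pc None i; QSeek pc (Some true) i; QSeek pc (Some false) i;
                         QBack pc true i; QBack pc false i; QRet pc i]) (seq 0 nreg))
    (seq 0 (length code)) ++
  flat_map (fun f => [QScan f; QData f; QCarry f true; QCarry f false; QWrite f]) [true; false].

Definition enc (q : Q) : nat := index q states.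

Definition machine : TM :=
  mkTM (length states - 3) (fun n xi xa xr xw =>
    let '(q, w, mi, ma, mr, mw) := delta (nth n states QRej) xi xa xr xw in
    (enc q, w, mi, ma, mr, mw)).

Lemma in_states_pc pc q : pc < length code ->
  In q (QIn pc ::
     flat_map (fun i => [QSeek pc None i; QSeek pc (Some true) i; QSeek pc (Some false) i;
                         QBack pc true i; QBack pc false i; QRet pc i]) (seq 0 nreg)) ->
  In q states.
Proof.
  intros. unfold states. rewrite !in_app_iff. right; left.
  apply in_flat_map. exists pc. rewrite in_seq. split; [lia|auto].
Qed.

Lemma in_QIn pc : pc < length code -> In (QIn pc) states.
Proof. intros. eapply in_states_pc; eauto. now left. Qed.

Lemma in_QSeek pc o i : pc < length code -> i < nreg -> In (QSeek pc o i) states.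
Proof.
  intros. eapply in_states_pc; eauto. right. apply in_flat_map. exists i.
  rewrite in_seq. split; [lia|]. destruct o as [[|]|]; simpl; tauto.
Qed.

Lemma in_QBack pc b i : pc < length code -> i < nreg -> In (QBack pc b i) states.
Proof.
  intros. eapply in_states_pc; eauto. right. apply in_flat_map. exists i.
  rewrite in_seq. split; [lia|]. destruct b; simpl; tauto.
Qed.

Lemma in_QRet pc i : pc < length code -> i < nreg -> In (QRet pc i) states.
Proof.
  intros. eapply in_states_pc; eauto. right. apply in_flat_map. exists i.
  rewrite in_seq. split; [lia|]. simpl; tauto.
Qed.

Lemma in_compact q :
  match q with QScan _ | QData _ | QCarry _ _ | QWrite _ | QStart | QAcc | QRej => In q states | _ => True end.
Proof.
  destruct q; auto; unfold states; rewrite !in_app_iff; try (left; simpl; tauto);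
  right; right; apply in_flat_map.
  - exists first; destruct first; simpl; tauto.
  - exists first; destruct first; simpl; tauto.
  - exists first; destruct first, b; simpl; tauto.
  - exists b; destruct b; simpl; tauto.
Qed.

Variables x a r : list bool.

Definition reach (t : nat) (c c' : Config) : Prop := Nat.iter t (step machine x a r) c = c'.

Lemma reach_trans t1 t2 c1 c2 c3 : reach t1 c1 c2 -> reach t2 c2 c3 -> reach (t1 + t2) c1 c3.
Proof. unfold reach. intros <- <-. rewrite Nat.add_comm, Nat.iter_add. reflexivity. Qed.

Definition cfg (q : Q) hi ha hr hw f : Config := mkConfig (enc q) hi ha hr hw f.

Lemma step_machine q hi ha hr hw f q' w mi ma mr mw :
  In q states -> In q' states -> q <> QAcc -> q <> QRej ->
  delta q (nth_error x hi) (nth_error a ha) (nth_error r hr) (f hw) = (q', w, mi, ma, mr, mw) ->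
  reach 1 (cfg q hi ha hr hw f)
    (cfg q' (move mi hi) (move ma ha) (move mr hr) (move mw hw)
         (fun i => if i =? hw then w else f i)).
Proof.
  intros Hq Hq' HA HR Hd. unfold reach.
  change (step machine x a r (cfg q hi ha hr hw f) = cfg q' (move mi hi) (move ma ha)
    (move mr hr) (move mw hw) (fun i => if i =? hw then w else f i)).
  unfold cfg, step. cbn [c_state c_in c_adv c_rnd c_work c_tape].
  assert (Hh : halted (enc q) = false).
  { unfold halted. apply orb_false_iff. split; apply Nat.eqb_neq; intro He.
    - apply HA. rewrite <- (nth_index q states QRej Hq). fold (enc q). rewrite He. reflexivity.
    - apply HR. rewrite <- (nth_index q states QRej Hq). fold (enc q). rewrite He. reflexivity. }
  assert (Hn : nth (enc q) states QRej = q) by now apply nth_index.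
  rewrite Hh. cbn [machine tm_delta tm_nstates]. rewrite Hn, Hd.
  f_equal. apply Nat.mod_small.
  assert (L := index_lt q' states Hq'). unfold enc. simpl in L |- *. lia.
Qed.

Lemma tape_same (f : nat -> option bool) p w :
  f p = w -> (fun i => if i =? p then w else f i) = f.
Proof.
  intros. apply functional_extensionality; intro i.
  destruct (Nat.eqb_spec i p); subst; auto.
Qed.

Lemma step_same q hi ha hr hw f q' mi ma mr mw :
  In q states -> In q' states -> q <> QAcc -> q <> QRej ->
  delta q (nth_error x hi) (nth_error a ha) (nth_error r hr) (f hw) = (q', f hw, mi, ma, mr, mw) ->
  reach 1 (cfg q hi ha hr hw f)
    (cfg q' (move mi hi) (move ma ha) (move mr hr) (move mw hw) f).
Proof.
  intros. rewrite <- (tape_same f hw (f hw)) at 2 by auto.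
  apply step_machine; auto.
Qed.
End Machine.

(* Cell [nreg * j + i] holds the [j]-th symbol of register [i], counted from the bottom of the stack.
   Cell 0 is marked, because the machine cannot feel the left end of its tape. *)
Definition tapeof (s : store) (p : nat) : option bool :=
  if p mod nreg =? 0 then (if p / nreg =? 0 then Some true else None)
  else if p mod nreg <? 3 then None
  else nth_error (rev (s (p mod nreg))) (p / nreg).

Lemma nreg_gt : 3 < nreg.
Proof. unfold nreg; lia. Qed.

Opaque nreg.

Lemma addr_mod j i : i < nreg -> (nreg * j + i) mod nreg = i.
Proof.
  intros. rewrite Nat.add_comm, Nat.mul_comm, Nat.Div0.mod_add. now apply Nat.mod_small.
Qed.

Lemma addr_div j i : i < nreg -> (nreg * j + i) / nreg = j.
Proof.
  intros. rewrite Nat.add_comm, Nat.mul_comm, Nat.div_add by lia. now rewrite Nat.div_small.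
Qed.

Lemma tapeof_at s j i : 3 <= i < nreg -> tapeof s (nreg * j + i) = nth_error (rev (s i)) j.
Proof.
  intros. unfold tapeof. rewrite addr_mod, addr_div by lia.
  destruct (Nat.eqb_spec i 0); [lia|]. destruct (Nat.ltb_spec i 3); [lia|auto].
Qed.

Lemma tapeof_home s j : tapeof s (nreg * j) = if j =? 0 then Some true else None.
Proof.
  assert (H := nreg_gt). unfold tapeof.
  replace (nreg * j) with (nreg * j + 0) by lia. rewrite addr_mod, addr_div by lia. auto.
Qed.

Lemma tapeof_write s r j v o :
  3 <= r < nreg ->
  (forall k, nth_error (rev v) k = if k =? j then o else nth_error (rev (s r)) k) ->
  (fun p => if p =? nreg * j + r then o else tapeof s p) = tapeof (upd s r v).
Proof.
  intros Hr H. assert (Hg := nreg_gt). apply functional_extensionality; intro p.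
  destruct (Nat.eqb_spec p (nreg * j + r)) as [->|Hp].
  - rewrite tapeof_at by auto. unfold upd. rewrite Nat.eqb_refl, H, Nat.eqb_refl. auto.
  - unfold tapeof. destruct (p mod nreg =? 0) eqn:E0; auto.
    destruct (p mod nreg <? 3) eqn:E3; auto. unfold upd.
    destruct (Nat.eqb_spec (p mod nreg) r) as [<-|Hn]; auto.
    rewrite H. destruct (Nat.eqb_spec (p / nreg) j); auto.
    exfalso. apply Hp. subst j. rewrite <- (Nat.div_mod_eq p nreg). auto.
Qed.

Section Phases.
Variable code : list instr.
Variables x a r : list bool.
Notation reach := (reach code x a r).
Notation cfg := (cfg code).

Lemma seek_moves pc last hi ha hr f i : forall hw, pc < length code -> i < nreg ->
  reach i (cfg (QSeek pc last i) hi ha hr hw f) (cfg (QSeek pc last 0) hi ha hr (hw + i) f).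
Proof.
  induction i; intros.
  - rewrite Nat.add_0_r. reflexivity.
  - eapply (reach_trans _ _ _ _ 1).
    + eapply step_same with (q' := QSeek pc last i); try congruence;
        try (apply in_QSeek; auto; lia). reflexivity.
    + simpl. replace (hw + S i) with (S hw + i) by lia. apply IHi; auto; lia.
Qed.

Lemma back_moves pc b hi ha hr f i : forall hw, pc < length code -> i < nreg ->
  reach i (cfg (QBack pc b i) hi ha hr (hw + i) f) (cfg (QBack pc b 0) hi ha hr hw f).
Proof.
  induction i; intros.
  - rewrite Nat.add_0_r. reflexivity.
  - eapply (reach_trans _ _ _ _ 1).
    + eapply step_same with (q' := QBack pc b i); try congruence;
        try (apply in_QBack; auto; lia). reflexivity.
    + simpl. replace (pred (hw + S i)) with (hw + i) by lia. apply IHi; auto; lia.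
Qed.

Lemma ret_moves l hi ha hr f i : forall hw, l < length code -> i < nreg ->
  reach i (cfg (QRet l i) hi ha hr (hw + i) f) (cfg (QRet l 0) hi ha hr hw f).
Proof.
  induction i; intros.
  - rewrite Nat.add_0_r. reflexivity.
  - eapply (reach_trans _ _ _ _ 1).
    + eapply step_same with (q' := QRet l i); try congruence;
        try (apply in_QRet; auto; lia). reflexivity.
    + simpl. replace (pred (hw + S i)) with (hw + i) by lia. apply IHi; auto; lia.
Qed.

Lemma ret_home l hi ha hr s j : l < length code ->
  reach (nreg * j + 1) (cfg (QRet l 0) hi ha hr (nreg * j) (tapeof s))
    (cfg (QIn l) hi ha hr 0 (tapeof s)).
Proof.
  intros Hl. assert (Hg := nreg_gt). induction j.
  - rewrite Nat.mul_0_r. change (0 + 1) with 1.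
    eapply step_same with (q' := QIn l) (mi := MoveS) (ma := MoveS) (mr := MoveS) (mw := MoveS);
      try congruence.
    + apply in_QRet; auto; lia.
    + apply in_QIn; auto.
    + simpl. assert (H := tapeof_home s 0). rewrite Nat.mul_0_r in H. rewrite H. reflexivity.
  - replace (nreg * S j + 1) with (1 + ((nreg - 1) + (nreg * j + 1))) by nia.
    eapply reach_trans.
    + eapply step_same with (q' := QRet l (nreg - 1)); try congruence;
        try (apply in_QRet; auto; lia).
      simpl. rewrite tapeof_home. reflexivity.
    + eapply reach_trans; [|exact IHj]. simpl.
      replace (pred (nreg * S j)) with (nreg * j + (nreg - 1)) by nia.
      apply ret_moves; auto; lia.
Qed.

Lemma ret_all l hi ha hr s j i : l < length code -> i < nreg ->
  reach (nreg * j + i + 1) (cfg (QRet l i) hi ha hr (nreg * j + i) (tapeof s))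
    (cfg (QIn l) hi ha hr 0 (tapeof s)).
Proof.
  intros. replace (nreg * j + i + 1) with (i + (nreg * j + 1)) by lia.
  eapply reach_trans; [apply ret_moves; auto | apply ret_home; auto].
Qed.

Definition top_below (l : list bool) (j : nat) : option bool :=
  match j with 0 => None | S j => nth_error (rev l) j end.

Lemma top_below_length l : top_below l (length l) = hd_error l.
Proof.
  destruct l; auto. simpl. rewrite nth_error_app2; rewrite length_rev; auto.
  now rewrite Nat.sub_diag.
Qed.

Lemma seek_end pc hi ha hr s i : 3 <= i < nreg -> pc < length code ->
  forall k j, j + k = length (s i) ->
  reach (nreg * k) (cfg (QSeek pc (top_below (s i) j) 0) hi ha hr (nreg * j + i) (tapeof s))
    (cfg (QSeek pc (hd_error (s i)) 0) hi ha hr (nreg * length (s i) + i) (tapeof s)).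
Proof.
  intros Hi Hp. assert (Hg := nreg_gt). induction k; intros j Hj.
  - rewrite Nat.mul_0_r. replace j with (length (s i)) by lia. rewrite top_below_length.
    reflexivity.
  - destruct (nth_error (rev (s i)) j) as [b|] eqn:E.
    2:{ apply nth_error_None in E. rewrite length_rev in E. lia. }
    replace (nreg * S k) with (1 + ((nreg - 1) + nreg * k)) by nia.
    eapply reach_trans.
    + eapply step_same with (q' := QSeek pc (Some b) (nreg - 1)); try congruence;
        try (apply in_QSeek; auto; lia).
      simpl. rewrite tapeof_at, E by auto. reflexivity.
    + eapply reach_trans; [apply seek_moves; auto; lia|].
      specialize (IHk (S j) ltac:(lia)). unfold top_below in IHk at 1. rewrite E in IHk.
      simpl move. replace (S (nreg * j + i) + (nreg - 1)) with (nreg * S j + i) by nia.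
      exact IHk.
Qed.

Lemma seek_all pc hi ha hr s i : 3 <= i < nreg -> pc < length code ->
  reach (nreg * length (s i) + i) (cfg (QSeek pc None i) hi ha hr 0 (tapeof s))
    (cfg (QSeek pc (hd_error (s i)) 0) hi ha hr (nreg * length (s i) + i) (tapeof s)).
Proof.
  intros. rewrite Nat.add_comm. eapply reach_trans; [apply seek_moves; auto; lia|].
  rewrite (Nat.add_comm i). 
  assert (H1 := seek_end pc hi ha hr s i H H0 (length (s i)) 0 eq_refl).
  rewrite Nat.mul_0_r in H1. exact H1.
Qed.

Lemma push_correct pc hi ha hr s i b l :
  nth_error code pc = Some (IPush i b l) -> 3 <= i < nreg -> l < length code ->
  reach (2 * (nreg * length (s i) + i) + 3) (cfg (QIn pc) hi ha hr 0 (tapeof s))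
    (cfg (QIn l) hi ha hr 0 (tapeof (upd s i (b :: s i)))).
Proof.
  intros Hc Hi Hl. assert (Hp : pc < length code) by (apply nth_error_Some; congruence).
  set (n := nreg * length (s i) + i).
  replace (2 * n + 3) with (1 + (n + (1 + (n + 1)))) by lia.
  eapply reach_trans.
  { eapply step_same with (q' := QSeek pc None i); try congruence.
    - now apply in_QIn.
    - apply in_QSeek; auto; lia.
    - simpl. rewrite Hc. reflexivity. }
  eapply reach_trans; [apply seek_all; auto|]. fold n.
  eapply reach_trans.
  { eapply step_machine with (q' := QRet l i) (w := Some b); try congruence.
    - apply in_QSeek; auto; lia.
    - apply in_QRet; auto; lia.
    - simpl. unfold n. rewrite tapeof_at by auto.
      replace (nth_error (rev (s i)) (length (s i))) with (@None bool).
      2:{ symmetry. apply nth_error_None. rewrite length_rev. auto. }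
      rewrite Hc. reflexivity. }
  simpl move. unfold n. rewrite tapeof_write with (v := b :: s i); auto.
  - apply ret_all; auto; lia.
  - intros k. simpl. destruct (Nat.eqb_spec k (length (s i))) as [->|Hk].
    + rewrite nth_error_app2; rewrite length_rev; auto. now rewrite Nat.sub_diag.
    + destruct (Nat.lt_ge_cases k (length (s i))).
      * now rewrite nth_error_app1 by now rewrite length_rev.
      * transitivity (@None bool); [|symmetry]; apply nth_error_None;
          rewrite ?length_app, length_rev; simpl; lia.
Qed.

Lemma pop_correct pc hi ha hr s i l0 lF lT :
  nth_error code pc = Some (IPop i l0 lF lT) -> 3 <= i < nreg ->
  sel (hd_error (s i)) l0 lF lT < length code ->
  exists t, t <= 2 * (nreg * length (s i) + i) + 5 /\
  reach t (cfg (QIn pc) hi ha hr 0 (tapeof s))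
    (cfg (QIn (sel (hd_error (s i)) l0 lF lT)) hi ha hr 0 (tapeof (upd s i (tl (s i))))).
Proof.
  intros Hc Hi Hl. assert (Hp : pc < length code) by (apply nth_error_Some; congruence).
  assert (Hg := nreg_gt).
  set (n := nreg * length (s i) + i).
  assert (H1 : reach (1 + n) (cfg (QIn pc) hi ha hr 0 (tapeof s))
     (cfg (QSeek pc (hd_error (s i)) 0) hi ha hr n (tapeof s))).
  { eapply reach_trans; [|apply seek_all; auto].
    eapply step_same with (q' := QSeek pc None i) (mi := MoveS) (ma := MoveS) (mr := MoveS)
      (mw := MoveS); try congruence.
    - now apply in_QIn.
    - apply in_QSeek; auto; lia.
    - simpl. rewrite Hc. destruct i as [|[|[|]]]; try lia. reflexivity. }
  assert (Hnone : tapeof s n = None).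
  { unfold n. rewrite tapeof_at by auto. apply nth_error_None. rewrite length_rev. auto. }
  destruct (s i) as [|b v] eqn:Es; simpl sel in *; simpl tl; simpl hd_error in H1.
  - exists ((1 + n) + (1 + (n + 1))). split; [lia|]. eapply reach_trans; [exact H1|].
    eapply reach_trans.
    { eapply step_machine with (q' := QRet l0 i) (w := None); try congruence.
      - apply in_QSeek; auto; lia.
      - apply in_QRet; auto; lia.
      - simpl. rewrite Hnone, Hc. reflexivity. }
    simpl move. rewrite tape_same by auto.
    replace (upd s i []) with s.
    2:{ apply functional_extensionality; intro z; unfold upd.
        destruct (Nat.eqb_spec z i); subst; auto. }
    apply ret_all; auto; lia.
  - simpl length in *. set (n' := nreg * length v + i).
    assert (Hn : n = n' + nreg) by (unfold n, n'; nia).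
    exists ((1 + n) + (1 + ((nreg - 1) + (1 + (n' + 1))))). split; [lia|].
    eapply reach_trans; [exact H1|].
    eapply reach_trans.
    { eapply step_machine with (q' := QBack pc b (nreg - 1)) (w := None); try congruence.
      - apply in_QSeek; auto; lia.
      - apply in_QBack; auto; lia.
      - simpl. rewrite Hnone, Hc. reflexivity. }
    simpl move. rewrite tape_same by auto.
    eapply reach_trans.
    { replace (pred n) with (n' + (nreg - 1)) by lia. apply back_moves; auto; lia. }
    eapply reach_trans.
    { eapply step_machine with (q' := QRet (if b then lT else lF) i) (w := None); try congruence.
      - apply in_QBack; auto; lia.
      - apply in_QRet; [destruct b; auto|lia].
      - simpl. rewrite Hc. reflexivity. }
    simpl move. unfold n'. rewrite tapeof_write with (v := v); auto.
    + replace (sel (Some b) l0 lF lT) with (if b then lT else lF) in * by now destruct b.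
      apply ret_all; auto; lia.
    + intros k. rewrite Es. simpl. destruct (Nat.eqb_spec k (length v)) as [->|Hk].
      * apply nth_error_None. rewrite length_rev; auto.
      * destruct (Nat.lt_ge_cases k (length v)).
        { now rewrite nth_error_app1 by now rewrite length_rev. }
        { transitivity (@None bool); [|symmetry]; apply nth_error_None;
            rewrite ?length_app, length_rev; simpl; lia. }
Qed.

Lemma hd_error_skipn {A} (l : list A) n : hd_error (skipn n l) = nth_error l n.
Proof. revert l; induction n; destruct l; simpl; auto. Qed.

Lemma tl_skipn_bump (l : list bool) n :
  tl (skipn n l) = skipn (move (bump (nth_error l n)) n) l.
Proof.
  revert n; induction l; intros [|n]; simpl; auto.
  rewrite IHl. destruct (nth_error l n); reflexivity.
Qed.

Definition srep (s : store) (hi ha hr : nat) : Prop :=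
  s 0 = skipn hi x /\ s 1 = skipn ha a /\ s 2 = skipn hr r.

Lemma tapeof_upd_low s i v : i < 3 -> tapeof (upd s i v) = tapeof s.
Proof.
  intros. apply functional_extensionality; intro p. unfold tapeof.
  destruct (_ =? 0); auto. destruct (Nat.ltb_spec (p mod nreg) 3); auto.
  unfold upd. destruct (Nat.eqb_spec (p mod nreg) i); auto; lia.
Qed.

Lemma pop_input pc hi ha hr s i l0 lF lT :
  nth_error code pc = Some (IPop i l0 lF lT) -> i < 3 -> srep s hi ha hr ->
  sel (hd_error (s i)) l0 lF lT < length code ->
  exists hi' ha' hr', srep (upd s i (tl (s i))) hi' ha' hr' /\
  reach 1 (cfg (QIn pc) hi ha hr 0 (tapeof s))
    (cfg (QIn (sel (hd_error (s i)) l0 lF lT)) hi' ha' hr' 0 (tapeof (upd s i (tl (s i))))).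
Proof.
  intros Hc Hi (Hx & Ha & Hr) Hl.
  assert (Hp : pc < length code) by (apply nth_error_Some; congruence).
  rewrite tapeof_upd_low by auto.
  destruct i as [|[|[|]]]; [| | |lia].
  - exists (move (bump (nth_error x hi)) hi), ha, hr. split.
    { unfold srep, upd; simpl. rewrite Hx. auto using tl_skipn_bump. }
    rewrite Hx, hd_error_skipn in *.
    eapply step_same with (mi := bump (nth_error x hi)) (ma := MoveS) (mr := MoveS) (mw := MoveS);
      try congruence; try (apply in_QIn; auto). simpl. rewrite Hc. reflexivity.
  - exists hi, (move (bump (nth_error a ha)) ha), hr. split.
    { unfold srep, upd; simpl. rewrite Ha. auto using tl_skipn_bump. }
    rewrite Ha, hd_error_skipn in *.
    eapply step_same with (mi := MoveS) (ma := bump (nth_error a ha)) (mr := MoveS) (mw := MoveS);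
      try congruence; try (apply in_QIn; auto). simpl. rewrite Hc. reflexivity.
  - exists hi, ha, (move (bump (nth_error r hr)) hr). split.
    { unfold srep, upd; simpl. rewrite Hr. auto using tl_skipn_bump. }
    rewrite Hr, hd_error_skipn in *.
    eapply step_same with (mi := MoveS) (ma := MoveS) (mr := bump (nth_error r hr)) (mw := MoveS);
      try congruence; try (apply in_QIn; auto). simpl. rewrite Hc. reflexivity.
Qed.

Lemma frun_correct pc s t pc' s' : frun code pc s t pc' s' ->
  forall hi ha hr Z, pc' < length code -> srep s hi ha hr ->
  (forall i, 3 <= i -> length (s i) <= Z) ->
  exists hi' ha' hr' T, T <= t * (2 * nreg * (Z + t + 2)) /\ srep s' hi' ha' hr' /\
  reach T (cfg (QIn pc) hi ha hr 0 (tapeof s)) (cfg (QIn pc') hi' ha' hr' 0 (tapeof s')).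
Proof.
  assert (Hg := nreg_gt).
  assert (Hlt : forall pc s t pc' s', frun code pc s t pc' s' -> pc' < length code -> pc < length code).
  { induction 1; auto; intros; apply nth_error_Some; congruence. }
  induction 1; intros hi ha hr Z Hpc Hs HZ.
  - exists hi, ha, hr, 0. split; [lia|]. split; [auto|]. reflexivity.
  - destruct (IHfrun hi ha hr Z Hpc Hs HZ) as (hi' & ha' & hr' & T & HT & Hs' & HR).
    exists hi', ha', hr', (1 + T). split; [nia|]. split; auto.
    eapply reach_trans; [|exact HR].
    eapply step_same with (q' := QIn l) (mi := MoveS) (ma := MoveS) (mr := MoveS) (mw := MoveS);
      try congruence; try (apply in_QIn; eauto; apply nth_error_Some; congruence).
    simpl. rewrite H. reflexivity.
  - destruct (IHfrun hi ha hr (S Z) Hpc) as (hi' & ha' & hr' & T & HT & Hs' & HR).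
    { destruct Hs as (? & ? & ?). unfold srep, upd.
      destruct r0 as [|[|[|]]]; try lia; auto. }
    { intros i Hi. unfold upd. destruct (Nat.eqb_spec i r0); subst; simpl;
        specialize (HZ _ Hi); lia. }
    exists hi', ha', hr', ((2 * (nreg * length (s r0) + r0) + 3) + T).
    split; [specialize (HZ r0 ltac:(lia)); nia|]. split; auto.
    eapply reach_trans; [|exact HR]. apply push_correct; eauto.
  - destruct (Nat.lt_ge_cases r0 3) as [Hr|Hr].
    + destruct (pop_input pc hi ha hr s r0 l0 lF lT H Hr Hs) as (h1 & h2 & h3 & Hs1 & HR1).
      { eauto. }
      destruct (IHfrun h1 h2 h3 Z Hpc Hs1) as (hi' & ha' & hr' & T & HT & Hs' & HR).
      { intros i Hi. unfold upd. destruct (Nat.eqb_spec i r0); subst; simpl; auto; lia. }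
      exists hi', ha', hr', (1 + T). split; [nia|]. split; auto.
      eapply reach_trans; eauto.
    + destruct (pop_correct pc hi ha hr s r0 l0 lF lT H ltac:(lia)) as (T1 & HT1 & HR1).
      { eauto. }
      destruct (IHfrun hi ha hr Z Hpc) as (hi' & ha' & hr' & T & HT & Hs' & HR).
      { destruct Hs as (? & ? & ?). unfold srep, upd.
        destruct r0 as [|[|[|]]]; try lia; auto. }
      { intros i Hi. unfold upd. destruct (Nat.eqb_spec i r0); subst; simpl; auto.
        specialize (HZ _ Hi). destruct (s r0); simpl in *; lia. }
      exists hi', ha', hr', (T1 + T). split; [specialize (HZ r0 Hr); nia|]. split; auto.
      eapply reach_trans; eauto.
Qed.

End Phases.

Fixpoint sparse (Z : nat) (f : nat -> option bool) (p : nat) (l : list bool) : Prop :=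
  match l with
  | [] => forall q, p <= q -> f q = None
  | b :: l => exists q, p <= q < Z /\ (forall k, p <= k < q -> f k = None) /\
                        f q = Some b /\ sparse Z f (S q) l
  end.

Lemma sparse_ext Z f g l : forall p,
  (forall k, p <= k -> f k = g k) -> sparse Z f p l -> sparse Z g p l.
Proof.
  induction l as [|b l IH]; simpl; intros p Hfg.
  - intros H q Hq. rewrite <- Hfg; auto.
  - intros (q & Hq & Hn & Hb & Hl). exists q. repeat split; try lia.
    + intros. rewrite <- Hfg by lia. auto.
    + rewrite <- Hfg by lia; auto.
    + eapply IH; [|exact Hl]. intros. apply Hfg; lia.
Qed.

Lemma sparse_down Z f l p p' :
  p' <= p -> (forall k, p' <= k < p -> f k = None) -> sparse Z f p l -> sparse Z f p' l.
Proof.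
  destruct l as [|b l]; simpl; intros Hp Hn.
  - intros H q Hq. destruct (Nat.lt_ge_cases q p); [apply Hn; lia|auto].
  - intros (q & Hq & Hk & Hb & Hl). exists q. repeat split; auto; try lia.
    intros. destruct (Nat.lt_ge_cases k p); [apply Hn|apply Hk]; lia.
Qed.

(* Output format of a register: [true] announces a bit, a final [false] the end of the output. *)
Definition flagged (l : list bool) : list bool := flat_map (fun b => [true; b]) l.

Section Compact.
Variable code : list instr.
Variables x a r : list bool.
Notation reach := (reach code x a r).
Notation cfg := (cfg code).

Lemma scan_moves b hi ha hr f d : forall p, (forall k, p <= k < p + d -> f k = None) ->
  reach d (cfg (QScan b) hi ha hr p f) (cfg (QScan b) hi ha hr (p + d) f).
Proof.
  induction d; intros p H.
  - rewrite Nat.add_0_r. reflexivity.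
  - eapply (reach_trans _ _ _ _ 1).
    + eapply step_same with (q' := QScan b); try congruence;
        try apply (in_compact _ (QScan b)). simpl. rewrite H by lia. reflexivity.
    + simpl. replace (p + S d) with (S p + d) by lia. apply IHd. intros; apply H; lia.
Qed.

Lemma data_moves b hi ha hr f d : forall p, (forall k, p <= k < p + d -> f k = None) ->
  reach d (cfg (QData b) hi ha hr p f) (cfg (QData b) hi ha hr (p + d) f).
Proof.
  induction d; intros p H.
  - rewrite Nat.add_0_r. reflexivity.
  - eapply (reach_trans _ _ _ _ 1).
    + eapply step_same with (q' := QData b); try congruence;
        try apply (in_compact _ (QData b)). simpl. rewrite H by lia. reflexivity.
    + simpl. replace (p + S d) with (S p + d) by lia. apply IHd. intros; apply H; lia.
Qed.

Lemma carry_moves b v hi ha hr f d : forall p, (forall k, p < k <= p + d -> f k = None) ->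
  reach d (cfg (QCarry b v) hi ha hr (p + d) f) (cfg (QCarry b v) hi ha hr p f).
Proof.
  induction d; intros p H.
  - rewrite Nat.add_0_r. reflexivity.
  - eapply (reach_trans _ _ _ _ 1).
    + eapply step_same with (q' := QCarry b v); try congruence;
        try apply (in_compact _ (QCarry b v)). simpl. rewrite H by lia. reflexivity.
    + simpl. replace (pred (p + S d)) with (p + d) by lia. apply IHd. intros; apply H; lia.
Qed.

Lemma fetch Z f0 hi ha hr f p h b l y :
  1 <= h <= p -> f (h - 1) = Some y -> (forall k, h <= k < p -> f k = None) ->
  sparse Z f p (true :: b :: l) ->
  exists T q g, T <= 3 * Z + 3 /\ p < q < Z /\
    reach T (cfg (QScan f0) hi ha hr p f) (cfg (QCarry f0 b) hi ha hr (h - 1) g) /\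
    (forall k, k < h -> g k = f k) /\ (forall k, h <= k <= q -> g k = None) /\
    sparse Z g (S q) l.
Proof.
  intros Hh Hy Hn (q1 & Hq1 & Hn1 & Hb1 & q2 & Hq2 & Hn2 & Hb2 & Hl).
  set (f1 := fun i => if i =? q1 then None else f i).
  set (f2 := fun i => if i =? q2 then None else f1 i).
  assert (E1 : forall k, k <> q1 -> f1 k = f k).
  { intros. unfold f1. destruct (Nat.eqb_spec k q1); congruence. }
  assert (E2 : forall k, k <> q2 -> f2 k = f1 k).
  { intros. unfold f2. destruct (Nat.eqb_spec k q2); congruence. }
  assert (N : forall k, h <= k <= q2 -> f2 k = None).
  { intros k Hk. unfold f2, f1. destruct (Nat.eqb_spec k q2); auto.
    destruct (Nat.eqb_spec k q1); auto.
    destruct (Nat.lt_ge_cases k p); [apply Hn; lia|].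
    destruct (Nat.lt_ge_cases k q1); [apply Hn1 | apply Hn2]; lia. }
  exists ((q1 - p) + (1 + ((q2 - S q1) + (1 + (pred q2 - (h - 1)))))), q2, f2.
  split; [lia|]. split; [lia|]. split; [|split; [|split; [exact N|]]].
  - eapply reach_trans.
    { apply scan_moves. intros. apply Hn1; lia. }
    replace (p + (q1 - p)) with q1 by lia.
    eapply reach_trans.
    { eapply step_machine with (q' := QData f0) (w := None); try congruence.
      - apply (in_compact _ (QScan f0)).
      - apply (in_compact _ (QData f0)).
      - simpl. rewrite Hb1. reflexivity. }
    fold f1. simpl move.
    eapply reach_trans.
    { apply data_moves. intros. rewrite E1 by lia. apply Hn2; lia. }
    replace (S q1 + (q2 - S q1)) with q2 by lia.
    eapply reach_trans.
    { eapply step_machine with (q' := QCarry f0 b) (w := None); try congruence.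
      - apply (in_compact _ (QData f0)).
      - apply (in_compact _ (QCarry f0 b)).
      - simpl. rewrite E1, Hb2 by lia. reflexivity. }
    fold f2. simpl move.
    replace (pred q2) with ((h - 1) + (pred q2 - (h - 1))) at 2 by lia.
    apply carry_moves. intros. apply N; lia.
  - intros k Hk. rewrite E2, E1 by lia. auto.
  - eapply sparse_ext; [|exact Hl]. intros. rewrite E2, E1 by lia. auto.
Qed.

Lemma compact_loop Z hi ha hr : forall out2 out1 p f,
  out1 <> [] -> length out1 <= p ->
  (forall k, k < p -> f k = nth_error out1 k) ->
  sparse Z f p (flagged out2 ++ [false]) ->
  exists T p' f', T <= (length out2 + 1) * (3 * Z + 6) /\
    reach T (cfg (QScan false) hi ha hr p f) (cfg QAcc hi ha hr p' f') /\
    forall k, f' k = nth_error (out1 ++ out2) k.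
Proof.
  induction out2 as [|b out2 IH]; intros out1 p f Hne Hp Hk Hs.
  - simpl in Hs. destruct Hs as (q & Hq & Hn & Hb & Hl).
    exists ((q - p) + 1), q, (fun i => if i =? q then None else f i).
    split; [simpl; lia|]. split.
    + eapply reach_trans.
      { apply scan_moves. intros. apply Hn; lia. }
      replace (p + (q - p)) with q by lia.
      eapply step_machine with (q' := QAcc) (w := None) (mi := MoveS) (ma := MoveS)
        (mr := MoveS) (mw := MoveS); try congruence.
      * apply (in_compact _ (QScan false)).
      * apply (in_compact _ QAcc).
      * simpl. rewrite Hb. reflexivity.
    + intros k. rewrite app_nil_r.
      assert (H0 : length out1 <= k -> nth_error out1 k = None) by apply nth_error_None.
      destruct (Nat.eqb_spec k q); [rewrite H0; auto; lia|].
      destruct (Nat.lt_ge_cases k p); auto. rewrite H0 by lia.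
      destruct (Nat.lt_ge_cases k q); [apply Hn; lia|apply Hl; lia].
  - simpl in Hs. set (h := length out1).
    assert (Hh : 1 <= h) by (unfold h; destruct out1; simpl; [easy|lia]).
    destruct (nth_error out1 (h - 1)) as [y|] eqn:Ey.
    2:{ apply nth_error_None in Ey. fold h in Ey. lia. }
    destruct (fetch Z false hi ha hr f p h b (flagged out2 ++ [false]) y)
      as (T & q & g & HT & Hq & HR & Hg1 & Hg2 & Hg3); auto.
    { rewrite Hk; auto. lia. }
    { intros. rewrite Hk by lia. apply nth_error_None. fold h. lia. }
    set (g' := fun i => if i =? h then Some b else g i).
    destruct (IH (out1 ++ [b]) (S h) g') as (T' & p' & f' & HT' & HR' & Hf').
    { destruct out1; discriminate. }
    { rewrite length_app. simpl. fold h. lia. }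
    { intros k Hkk. unfold g'. destruct (Nat.eqb_spec k h) as [->|].
      - rewrite nth_error_app2 by (fold h; lia). fold h. rewrite Nat.sub_diag. auto.
      - rewrite nth_error_app1 by (fold h; lia). rewrite Hg1 by lia. apply Hk. lia. }
    { apply sparse_down with (S q); [lia| |].
      - intros. unfold g'. destruct (Nat.eqb_spec k h); [lia|]. apply Hg2; lia.
      - eapply sparse_ext; [|exact Hg3]. intros. unfold g'.
        destruct (Nat.eqb_spec k h); [lia|auto]. }
    exists (T + (1 + (1 + T'))), p', f'. split; [simpl length; nia|]. split.
    + eapply reach_trans; [exact HR|].
      eapply reach_trans.
      { eapply step_same with (q' := QWrite b); try congruence.
        - apply (in_compact _ (QCarry false b)).
        - apply (in_compact _ (QWrite b)).
        - simpl. rewrite Hg1, Hk, Ey by lia. reflexivity. }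
      eapply reach_trans; [|exact HR'].
      simpl move. replace (S (h - 1)) with h by lia. fold g'.
      eapply step_machine with (q' := QScan false) (w := Some b) (mi := MoveS) (ma := MoveS)
        (mr := MoveS) (mw := MoveR); try congruence.
      * apply (in_compact _ (QWrite b)).
      * apply (in_compact _ (QScan false)).
      * reflexivity.
    + intros. rewrite Hf', <- app_assoc. reflexivity.
Qed.

Lemma compact_correct Z hi ha hr pc f out :
  nth_error code pc = Some ICompact ->
  f 0 = Some true -> sparse Z f 1 (flagged out ++ [false]) ->
  exists T p' f', T <= (length out + 1) * (3 * Z + 6) + 1 /\
    reach T (cfg (QIn pc) hi ha hr 0 f) (cfg QAcc hi ha hr p' f') /\
    (out <> [] -> forall k, f' k = nth_error out k).
Proof.
  intros Hc H0 Hs.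
  assert (HR1 : reach 1 (cfg (QIn pc) hi ha hr 0 f) (cfg (QScan true) hi ha hr 1 f)).
  { eapply step_same with (q' := QScan true) (mi := MoveS) (ma := MoveS)
        (mr := MoveS) (mw := MoveR); try congruence.
    - apply in_QIn. apply nth_error_Some. congruence.
    - apply (in_compact _ (QScan true)).
    - simpl. rewrite Hc. reflexivity. }
  destruct out as [|b out].
  - destruct Hs as (q & Hq & Hn & Hb & Hl).
    exists (1 + ((q - 1) + 1)), q, (fun i => if i =? q then None else f i).
    split; [simpl; lia|]. split; [|easy].
    eapply reach_trans; [exact HR1|]. eapply reach_trans.
    { apply scan_moves. intros. apply Hn; lia. }
    replace (1 + (q - 1)) with q by lia.
    eapply step_machine with (q' := QAcc) (w := None) (mi := MoveS) (ma := MoveS)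
      (mr := MoveS) (mw := MoveS); try congruence.
    + apply (in_compact _ (QScan true)).
    + apply (in_compact _ QAcc).
    + simpl. rewrite Hb. reflexivity.
  - destruct (fetch Z true hi ha hr f 1 1 b (flagged out ++ [false]) true)
      as (T & q & g & HT & Hq & HR & Hg1 & Hg2 & Hg3); auto.
    { intros; lia. }
    set (g' := fun i => if i =? 0 then Some b else g i).
    destruct (compact_loop Z hi ha hr out [b] 1 g') as (T' & p' & f' & HT' & HR' & Hf').
    { discriminate. }
    { auto. }
    { intros k Hk. unfold g'. destruct k; [auto|lia]. }
    { apply sparse_down with (S q); [lia| |].
      - intros. unfold g'. destruct (Nat.eqb_spec k 0); [lia|]. apply Hg2; lia.
      - eapply sparse_ext; [|exact Hg3]. intros. unfold g'.
        destruct (Nat.eqb_spec k 0); [lia|auto]. }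
    exists (1 + (T + (1 + T'))), p', f'. split; [simpl length; nia|]. split; [|auto].
    eapply reach_trans; [exact HR1|]. eapply reach_trans; [exact HR|].
    eapply reach_trans; [|exact HR'].
    eapply step_machine with (q' := QScan false) (w := Some b) (mi := MoveS) (ma := MoveS)
        (mr := MoveS) (mw := MoveR); try congruence.
    + apply (in_compact _ (QCarry true b)).
    + apply (in_compact _ (QScan false)).
    + simpl. rewrite Hg1, H0 by lia. reflexivity.
Qed.

Lemma sparse_tapeof s o : 3 <= o < nreg ->
  (forall i, 3 <= i -> i <> o -> s i = []) ->
  sparse (nreg * (length (s o) + 1)) (tapeof s) 1 (rev (s o)).
Proof.
  intros Ho He. assert (Hg := nreg_gt).
  assert (Hnone : forall p, 1 <= p -> p mod nreg <> o -> tapeof s p = None).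
  { intros p Hp Hm. unfold tapeof. destruct (Nat.eqb_spec (p mod nreg) 0).
    - destruct (Nat.eqb_spec (p / nreg) 0); auto.
      assert (H := Nat.div_mod_eq p nreg). nia.
    - destruct (Nat.ltb_spec (p mod nreg) 3); auto. rewrite He; auto.
      simpl. now destruct (p / nreg). }
  assert (Hmod : forall p j, nreg * j + o < p < nreg * (S j) + o -> p mod nreg <> o).
  { intros p j Hp E. assert (H := Nat.div_mod_eq p nreg). rewrite E in H.
    destruct (Nat.le_gt_cases (p / nreg) j); nia. }
  assert (G : forall l j, skipn j (rev (s o)) = l -> j + length l = length (s o) ->
     forall p, 1 <= p -> p <= nreg * j + o -> (forall k, p <= k < nreg * j + o -> k mod nreg <> o) ->
     sparse (nreg * (length (s o) + 1)) (tapeof s) p l).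
  { induction l as [|b l IH]; intros j Hj Hlen p Hp1 Hp2 Hp3; simpl.
    - intros q Hq. destruct (Nat.eq_dec (q mod nreg) o) as [E|E]; [|apply Hnone; auto; lia].
      assert (H := Nat.div_mod_eq q nreg). rewrite E in H. rewrite H, tapeof_at by auto.
      apply nth_error_None. rewrite length_rev. simpl in Hlen.
      destruct (Nat.lt_ge_cases (q / nreg) j) as [Hlt|]; [|lia].
      exfalso. apply (Hp3 q); auto. split; auto. rewrite H.
      assert (Hm : nreg * S (q / nreg) <= nreg * j) by (apply Nat.mul_le_mono_l; lia).
      rewrite Nat.mul_succ_r in Hm. lia.
    - exists (nreg * j + o). simpl in Hlen. split; [nia|]. split; [|split].
      + intros. apply Hnone; [lia|]. apply Hp3; auto.
      + rewrite tapeof_at by auto. rewrite <- hd_error_skipn, Hj. auto.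
      + apply IH with (S j); try lia.
        * replace (S j) with (1 + j) by lia. rewrite <- skipn_skipn, Hj. reflexivity.
        * intros. apply Hmod with j. lia. }
  apply G with 0; auto; try lia.
  - simpl. rewrite length_rev. auto.
  - intros k Hk E. assert (H := Nat.Div0.mod_le k nreg). rewrite E in H. lia.
Qed.
End Compact.

Definition init_store (x a r : list bool) : store :=
  fun i => match i with 0 => x | 1 => a | 2 => r | _ => [] end.

Lemma exec_length c s t s' : exec c s t s' -> forall i, length (s' i) <= length (s i) + t.
Proof.
  induction 1; intros i.
  - lia.
  - unfold upd. destruct (Nat.eqb_spec i r); subst; simpl; lia.
  - specialize (IHexec i). unfold upd in IHexec.
    destruct (Nat.eqb_spec i r); subst; [|lia]. destruct (s r); simpl in *; lia.
  - specialize (IHexec1 i). specialize (IHexec2 i). lia.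
  - lia.
  - specialize (IHexec1 i). specialize (IHexec2 i). unfold upd in IHexec1.
    destruct (Nat.eqb_spec i r); subst; [|lia]. rewrite H0. simpl. lia.
Qed.

Lemma reach_start code x a r :
  0 < length code ->
  reach code x a r 1 init_config (cfg code (QIn 0) 0 0 0 0 (tapeof (init_store x a r))).
Proof.
  intros Hl. assert (Hg := nreg_gt).
  replace (tapeof (init_store x a r)) with
    (fun i => if i =? 0 then Some true else (fun _ : nat => @None bool) i).
  - change init_config with (cfg code QStart 0 0 0 0 (fun _ => None)).
    eapply step_machine with (q' := QIn 0) (w := Some true) (mi := MoveS) (ma := MoveS)
        (mr := MoveS) (mw := MoveS); try congruence.
    + apply (in_compact _ QStart).
    + now apply in_QIn.
    + reflexivity.
  - apply functional_extensionality; intro p. unfold tapeof.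
    destruct (Nat.eqb_spec (p mod nreg) 0) as [E|E].
    + assert (H := Nat.div_mod_eq p nreg).
      destruct (Nat.eqb_spec p 0), (Nat.eqb_spec (p / nreg) 0); auto; try nia.
    + destruct (Nat.eqb_spec p 0).
      * subst. rewrite Nat.Div0.mod_0_l in E. lia.
      * destruct (Nat.ltb_spec (p mod nreg) 3); auto.
        destruct (p mod nreg) as [|[|[|]]]; try lia. simpl. now destruct (p / nreg).
Qed.

Lemma reach_halted code x a r c T q hi ha hr hw f : reach code x a r T c (cfg code q hi ha hr hw f) ->
  q = QAcc \/ q = QRej -> forall t, T <= t -> reach code x a r t c (cfg code q hi ha hr hw f).
Proof.
  intros HR Hq t Ht. unfold reach in *. replace t with ((t - T) + T) by lia.
  rewrite Nat.iter_add, HR. induction (t - T); auto. simpl. rewrite IHn.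
  unfold step at 1. destruct Hq; subst; reflexivity.
Qed.

Definition time_of (t : nat) : nat := 10 * nreg * (t + 4) * (t + 4).

Definition decider_code (c : cmd) (o : nat) : list instr :=
  let n := csize c in comp c 0 n ++ [IPop o (n + 1) (n + 1) (n + 2); IHalt false; IHalt true].

Theorem decider_correct c o x a r t s' t' :
  3 <= o < nreg -> exec c (init_store x a r) t s' -> time_of t <= t' ->
  halts_within (machine (decider_code c o)) x a r t' /\
  (accepts_b (machine (decider_code c o)) x a r t' = true <-> hd_error (s' o) = Some true).
Proof.
  intros Ho He Ht. assert (Hg := nreg_gt). set (code := decider_code c o).
  set (n := csize c).
  assert (Hlen : length code = n + 3).
  { unfold code, decider_code. rewrite length_app, comp_length. simpl. auto. }
  assert (Hn : forall k, nth_error code (n + k) =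
     nth_error [IPop o (n + 1) (n + 1) (n + 2); IHalt false; IHalt true] k).
  { intros. unfold code, decider_code. rewrite nth_error_app2; rewrite comp_length; fold n.
    - f_equal. lia.
    - lia. }
  assert (HF : frun code 0 (init_store x a r) (t + 1)
     (sel (hd_error (s' o)) (n + 1) (n + 1) (n + 2)) (upd s' o (tl (s' o)))).
  { eapply frun_trans.
    - eapply comp_correct; [exact He|].
      exists [], [IPop o (n + 1) (n + 1) (n + 2); IHalt false; IHalt true]. split; reflexivity.
    - specialize (Hn 0). rewrite Nat.add_0_r in Hn.
      eapply frun_pop; [exact Hn|lia|constructor]. }
  destruct (frun_correct code x a r _ _ _ _ _ HF 0 0 0 0) as (hi & ha & hr & T & HT & Hs & HR).
  { destruct (hd_error (s' o)) as [[|]|]; simpl; lia. }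
  { repeat split. }
  { intros i Hi. destruct i as [|[|[|]]]; simpl; lia. }
  set (q := if hd_error (s' o) then sel (hd_error (s' o)) QRej QRej QAcc else QRej).
  assert (HF2 : reach code x a r (1 + (T + 1)) init_config
    (cfg code q hi ha hr 0 (tapeof (upd s' o (tl (s' o)))))).
  { eapply reach_trans; [apply reach_start; lia|]. eapply reach_trans; [exact HR|].
    eapply step_same with (q' := q) (mi := MoveS) (ma := MoveS)
        (mr := MoveS) (mw := MoveS); try congruence.
    - apply in_QIn. destruct (hd_error (s' o)) as [[|]|]; simpl; lia.
    - unfold q. destruct (hd_error (s' o)) as [[|]|]; simpl; 
      [apply (in_compact _ QAcc)|apply (in_compact _ QRej)|apply (in_compact _ QRej)].
    - unfold q, delta. 
      destruct (hd_error (s' o)) as [[|]|]; simpl sel; rewrite Hn; reflexivity. }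
  apply reach_halted with (t := t') in HF2.
  - unfold reach in HF2. unfold halts_within, accepts_b, run. rewrite HF2. unfold q.
    destruct (hd_error (s' o)) as [[|]|]; split; try reflexivity; split; try easy.
  - unfold q. destruct (hd_error (s' o)) as [[|]|]; auto.
  - unfold time_of in Ht. nia.
Qed.

Definition transducer_code (c : cmd) : list instr := comp c 0 (csize c) ++ [ICompact].

Lemma read_out_nth f : forall out i k, length out <= k ->
  (forall j, f (i + j) = nth_error out j) -> read_out f i k = out.
Proof.
  induction out as [|b out IH]; intros i k Hk H.
  - destruct k; auto. simpl. specialize (H 0). rewrite Nat.add_0_r in H. rewrite H. auto.
  - destruct k; simpl in Hk; [lia|]. simpl.
    assert (H0 := H 0). rewrite Nat.add_0_r in H0. rewrite H0. simpl. f_equal.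
    apply IH; [lia|]. intros j. replace (S i + j) with (i + S j) by lia. apply H.
Qed.

Theorem transducer_correct c o out x a r t s' t' :
  3 <= o < nreg -> exec c (init_store x a r) t s' ->
  (forall i, 3 <= i -> i <> o -> s' i = []) -> rev (s' o) = flagged out ++ [false] ->
  time_of t <= t' ->
  halts_within (machine (transducer_code c)) x a r t' /\
  (out <> [] -> output (machine (transducer_code c)) x a r t' = out).
Proof.
  intros Ho He Hempty Hout Ht. assert (Hg := nreg_gt). set (code := transducer_code c).
  set (n := csize c).
  assert (Hlen : length code = n + 1).
  { unfold code, transducer_code. rewrite length_app, comp_length. auto. }
  assert (Hn : nth_error code n = Some ICompact).
  { unfold code, transducer_code. rewrite nth_error_app2; rewrite comp_length; fold n; auto.
    now rewrite Nat.sub_diag. }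
  assert (HF : frun code 0 (init_store x a r) t n s').
  { eapply comp_correct; [exact He|]. exists [], [ICompact]. split; reflexivity. }
  destruct (frun_correct code x a r _ _ _ _ _ HF 0 0 0 0) as (hi & ha & hr & T & HT & Hs & HR).
  { lia. }
  { repeat split. }
  { intros i Hi. destruct i as [|[|[|]]]; simpl; lia. }
  assert (Hsp := sparse_tapeof s' o Ho Hempty). rewrite Hout in Hsp.
  assert (Hol : length (s' o) <= t).
  { assert (H := exec_length _ _ _ _ He o).
    destruct o as [|[|[|]]]; simpl in H; lia. }
  assert (Hol2 : 2 * length out + 1 = length (s' o)).
  { assert (H := length_rev (s' o)). rewrite Hout, length_app in H. simpl in H.
    assert (H2 : length (flagged out) = 2 * length out).
    { clear. unfold flagged. induction out; simpl in *; lia. }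
    lia. }
  destruct (compact_correct code x a r (nreg * (length (s' o) + 1)) hi ha hr n (tapeof s') out Hn)
    as (T' & p' & f' & HT' & HR' & Hf').
  { assert (H := tapeof_home s' 0). rewrite Nat.mul_0_r in H. auto. }
  { exact Hsp. }
  assert (HF2 : reach code x a r (1 + (T + T')) init_config (cfg code QAcc hi ha hr p' f')).
  { eapply reach_trans; [apply reach_start; lia|]. eapply reach_trans; eauto. }
  assert (HTb : 1 + (T + T') <= t').
  { eapply Nat.le_trans; [|exact Ht]. unfold time_of.
    assert ((length out + 1) * (3 * (nreg * (length (s' o) + 1)) + 6) <=
            (t + 1) * (3 * (nreg * (t + 1)) + 6)).
    { apply Nat.mul_le_mono; nia. }
    nia. }
  apply reach_halted with (t := t') in HF2; auto.
  unfold reach in HF2. unfold halts_within, output, run. rewrite HF2. split; [reflexivity|].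
  intros Hne. apply read_out_nth; [|intro j; apply Hf'; auto].
  unfold time_of in Ht. nia.
Qed.

Transparent nreg.

(** * Basic routines *)

Definition runs (c : cmd) (s : store) (B : nat) (s' : store) : Prop :=
  exists t, t <= B /\ exec c s t s'.

Lemma upd_same s r v : upd s r v r = v.
Proof. unfold upd. now rewrite Nat.eqb_refl. Qed.

Lemma upd_other s r v i : i <> r -> upd s r v i = s i.
Proof. unfold upd. intros. destruct (Nat.eqb_spec i r); congruence. Qed.

Lemma upd_upd s r v w : upd (upd s r v) r w = upd s r w.
Proof.
  apply functional_extensionality; intro z; unfold upd. now destruct (z =? r).
Qed.

Lemma upd_id s r v : s r = v -> upd s r v = s.
Proof.
  intros; apply functional_extensionality; intro z; unfold upd.
  destruct (Nat.eqb_spec z r); congruence.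
Qed.

Ltac lookup := repeat first [rewrite upd_same | rewrite upd_other by lia].
Ltac store_ext :=
  apply functional_extensionality; let z := fresh "z" in intro z; unfold upd;
  repeat match goal with
    |- context [Nat.eqb ?u ?k] => destruct (Nat.eqb_spec u k); try lia
  end; subst; try congruence; auto.

Lemma runs_weaken c s B s1 B' s2 : runs c s B s1 -> B <= B' -> s1 = s2 -> runs c s B' s2.
Proof. intros (t & Ht & He) HB <-. exists t. split; [lia|auto]. Qed.

Lemma runs_skip s : runs Skip s 1 s.
Proof. exists 1. split; auto. constructor. Qed.

Lemma runs_push r b s : 3 <= r < nreg -> runs (Push r b) s 1 (upd s r (b :: s r)).
Proof. exists 1. split; auto. now constructor. Qed.

Lemma runs_seq c1 c2 s B1 s1 B2 s2 :
  runs c1 s B1 s1 -> runs c2 s1 B2 s2 -> runs (Seq c1 c2) s (B1 + B2) s2.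
Proof.
  intros (t1 & H1 & E1) (t2 & H2 & E2). exists (t1 + t2). split; [lia|].
  econstructor; eauto.
Qed.

Lemma runs_pop r c0 cF cT s B s' : r < nreg ->
  runs (sel (hd_error (s r)) c0 cF cT) (upd s r (tl (s r))) B s' ->
  runs (Pop r c0 cF cT) s (S B) s'.
Proof. intros Hr (t & Ht & E). exists (S t). split; [lia|]. now constructor. Qed.

Lemma runs_while_end r cF cT (s : store) : r < nreg -> s r = [] -> runs (While r cF cT) s 1 s.
Proof. exists 1. split; auto. now constructor. Qed.

Lemma runs_while_step r cF cT (s : store) b l B1 s1 B2 s2 : r < nreg -> s r = b :: l ->
  runs (if b then cT else cF) (upd s r l) B1 s1 ->
  runs (While r cF cT) s1 B2 s2 -> runs (While r cF cT) s (S (B1 + B2)) s2.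
Proof.
  intros Hr Hs (t1 & H1 & E1) (t2 & H2 & E2). exists (S (t1 + t2)). split; [lia|].
  econstructor; eauto.
Qed.

Lemma runs_for_step r c (s : store) b l B1 s1 B2 s2 : r < nreg -> s r = b :: l ->
  runs c (upd s r l) B1 s1 -> runs (While r c c) s1 B2 s2 ->
  runs (While r c c) s (S (B1 + B2)) s2.
Proof. intros. eapply runs_while_step; eauto. now destruct b. Qed.

Lemma runs_length c s B s' i : runs c s B s' -> length (s' i) <= length (s i) + B.
Proof. intros (t & Ht & E). apply exec_length with (i := i) in E. lia. Qed.

Definition clear (a : nat) : cmd := While a Skip Skip.

Lemma clear_runs a s : a < nreg -> runs (clear a) s (2 * length (s a) + 1) (upd s a []).
Proof.
  intros Ha. remember (s a) as l eqn:E. revert s E.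
  induction l as [|b l IH]; intros s E.
  - eapply runs_weaken; [apply runs_while_end; auto|simpl; lia|].
    symmetry. now apply upd_id.
  - eapply runs_weaken.
    + eapply runs_while_step with (s1 := upd s a l); eauto.
      * destruct b; apply runs_skip.
      * apply IH. now rewrite upd_same.
    + simpl; lia.
    + apply upd_upd.
Qed.

Definition mov (a b : nat) : cmd := While a (Push b false) (Push b true).

Lemma mov_runs a b s : a <> b -> a < nreg -> 3 <= b < nreg ->
  runs (mov a b) s (2 * length (s a) + 1) (upd (upd s a []) b (rev (s a) ++ s b)).
Proof.
  intros Hab Ha Hb. remember (s a) as l eqn:E. revert s E.
  induction l as [|v l IH]; intros s E.
  - eapply runs_weaken; [apply runs_while_end; auto|simpl; lia|]. store_ext.
  - eapply runs_weaken.
    + eapply runs_while_step with (s1 := upd (upd s a l) b (v :: s b)) (B1 := 1); eauto.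
      * replace (s b) with (upd s a l b) by (lookup; auto).
        destruct v; apply runs_push; auto.
      * apply IH. now lookup.
    + simpl; lia.
    + simpl. rewrite <- app_assoc. store_ext.
Qed.

Definition dup (a b c : nat) : cmd :=
  While a (Seq (Push b false) (Push c false)) (Seq (Push b true) (Push c true)).

Lemma dup_runs a b c s : a <> b -> a <> c -> b <> c -> a < nreg -> 3 <= b < nreg -> 3 <= c < nreg ->
  runs (dup a b c) s (3 * length (s a) + 1)
    (upd (upd (upd s a []) b (rev (s a) ++ s b)) c (rev (s a) ++ s c)).
Proof.
  intros Hab Hac Hbc Ha Hb Hc. remember (s a) as l eqn:E. revert s E.
  induction l as [|v l IH]; intros s E.
  - eapply runs_weaken; [apply runs_while_end; auto|simpl; lia|]. store_ext.
  - eapply runs_weaken.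
    + eapply runs_while_step with (s1 := upd (upd (upd s a l) b (v :: s b)) c (v :: s c)) (B1 := 2);
        eauto.
      * destruct v; eapply runs_weaken; try (eapply runs_seq; apply runs_push; auto); auto; lookup; auto.
      * apply IH. now lookup.
    + simpl; lia.
    + simpl. rewrite <- !app_assoc. store_ext.
Qed.

Definition copy (a b t : nat) : cmd := Seq (mov a t) (dup t a b).

Lemma copy_runs a b t s : a <> b -> a <> t -> b <> t ->
  3 <= a < nreg -> 3 <= b < nreg -> 3 <= t < nreg -> s t = [] ->
  runs (copy a b t) s (5 * length (s a) + 2) (upd s b (s a ++ s b)).
Proof.
  intros. eapply runs_weaken.
  - eapply runs_seq; [apply mov_runs|apply dup_runs]; auto; lia.
  - lookup. rewrite H5, app_nil_r, length_rev. lia.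
  - lookup. rewrite H5, app_nil_r, rev_involutive, app_nil_r. store_ext.
Qed.

(** * Simulation of a Turing machine by a stack program *)

Definition cell_code (o : option bool) : list bool :=
  match o with None => [false] | Some b => [true; b] end.
Definition cells_code (l : list (option bool)) : list bool := flat_map cell_code l.

Definition readsym (r : nat) (k : option bool -> cmd) : cmd :=
  Pop r (k None) (k None) (Pop r (k None) (k (Some false)) (k (Some true))).

Lemma readsym_runs r k s l B s' : r < nreg -> s r = cells_code l ->
  runs (k (hd None l)) (upd s r (cells_code (tl l))) B s' -> runs (readsym r k) s (B + 2) s'.
Proof.
  intros Hr Hs HR. eapply runs_weaken; [apply runs_pop; auto| |reflexivity]; rewrite ?Hs.
  - destruct l as [|[b|] l]; simpl in *.
    + eapply runs_weaken; [exact HR|apply Nat.le_succ_diag_r|auto].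
    + apply runs_pop; auto. rewrite upd_same, upd_upd. simpl. destruct b; exact HR.
    + eapply runs_weaken; [exact HR|apply Nat.le_succ_diag_r|auto].
  - lia.
Qed.

Definition pushsym (r : nat) (o : option bool) : cmd :=
  match o with None => Push r false | Some b => Seq (Push r b) (Push r true) end.

Lemma pushsym_runs r o s : 3 <= r < nreg ->
  runs (pushsym r o) s 2 (upd s r (cell_code o ++ s r)).
Proof.
  intros. destruct o as [b|]; simpl.
  - eapply runs_weaken; [eapply runs_seq; apply runs_push; auto|auto|]. rewrite upd_same. apply upd_upd.
  - eapply runs_weaken; [apply runs_push; auto|auto|auto].
Qed.

Definition act (L R : nat) (m : Move) (o : option bool) : cmd :=
  match m with
  | MoveS => pushsym R o
  | MoveR => pushsym L o
  | MoveL => Seq (pushsym R o)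
      (Pop L Skip (pushsym R None) (Pop L Skip (pushsym R (Some false)) (pushsym R (Some true))))
  end.

Definition mv (m : Move) (o : option bool) (l r : list (option bool)) :=
  match m with
  | MoveS => (l, o :: r)
  | MoveR => (o :: l, r)
  | MoveL => match l with [] => ([], o :: r) | a :: l => (l, a :: o :: r) end
  end.

Lemma act_runs L R m o s l r : L <> R -> 3 <= L < nreg -> 3 <= R < nreg ->
  s L = cells_code l -> s R = cells_code r ->
  runs (act L R m o) s 6 (upd (upd s L (cells_code (fst (mv m o l r)))) R (cells_code (snd (mv m o l r)))).
Proof.
  intros Hn HL HR El Er. destruct m; simpl.
  - eapply runs_weaken with (B := 2 + 4); [|auto|reflexivity].
    eapply runs_seq; [apply pushsym_runs; auto|]. rewrite Er.
    destruct l as [|[b|] l]; simpl.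
    + eapply runs_weaken; [apply runs_pop; [lia|]|..]; lookup; rewrite ?El; simpl.
      * apply runs_skip.
      * lia.
      * store_ext.
    + eapply runs_weaken; [apply runs_pop; [lia|]|..]; lookup; rewrite ?El; simpl.
      * apply runs_pop; [lia|]. lookup. simpl. destruct b; apply (pushsym_runs R (Some _)); auto.
      * lia.
      * lookup. store_ext.
    + eapply runs_weaken; [apply runs_pop; [lia|]|..]; lookup; rewrite ?El; simpl.
      * apply (pushsym_runs R None); auto.
      * lia.
      * lookup. store_ext.
  - eapply runs_weaken; [apply pushsym_runs; auto|lia|]. rewrite Er. store_ext.
  - eapply runs_weaken; [apply pushsym_runs; auto|lia|]. rewrite El. store_ext.
Qed.

Definition tape_rep (l r : list (option bool)) (p : nat) (f : nat -> option bool) : Prop :=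
  length l = p /\ forall i, f i = nth i (rev l ++ r) None.

Lemma tape_rep_hd l r p f : tape_rep l r p f -> f p = hd None r.
Proof.
  intros [<- H]. rewrite H, app_nth2; rewrite length_rev; auto.
  rewrite Nat.sub_diag. now destruct r.
Qed.

Lemma tape_rep_ext l r p f g : tape_rep l r p f -> (forall i, f i = g i) -> tape_rep l r p g.
Proof. intros [H1 H2] H. split; auto. intros. now rewrite <- H. Qed.

Lemma tape_rep_tl l r p f : tape_rep l r p f -> tape_rep l (hd None r :: tl r) p f.
Proof.
  destruct r; auto. intros [H1 H2]. split; auto. intros. rewrite H2. simpl.
  rewrite app_nil_r.
  destruct (Nat.lt_ge_cases i (length (rev l))).
  - now rewrite app_nth1.
  - rewrite app_nth2, nth_overflow by auto. destruct (i - length (rev l)) as [|[|]]; auto.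
Qed.

Lemma tape_rep_mv l r p f m o : tape_rep l r p f ->
  tape_rep (fst (mv m o l (tl r))) (snd (mv m o l (tl r))) (move m p)
       (fun i => if i =? p then o else f i).
Proof.
  intros H0. apply tape_rep_tl in H0. destruct H0 as [<- H].
  assert (G : tape_rep l (o :: tl r) (length l) (fun i => if i =? length l then o else f i)).
  { split; auto. intros i. rewrite H. destruct (Nat.eqb_spec i (length l)) as [->|Hi].
    - rewrite app_nth2; rewrite length_rev; auto. now rewrite Nat.sub_diag.
    - destruct (Nat.lt_ge_cases i (length l)).
      + rewrite !app_nth1; auto; rewrite length_rev; auto.
      + rewrite !app_nth2; rewrite length_rev; auto.
        destruct (i - length l) eqn:E; [lia|auto]. }
  destruct m; simpl.
  - destruct l as [|y l]; simpl; auto. destruct G as [_ G]. split; auto.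
    intros i. rewrite G. simpl. now rewrite <- app_assoc.
  - exact G.
  - destruct G as [_ G]. split; auto. intros i. rewrite G. simpl. now rewrite <- app_assoc.
Qed.

Notation rL1 := 20.
Notation rR1 := 21.
Notation rL2 := 22.
Notation rR2 := 23.
Notation rL3 := 24.
Notation rR3 := 25.
Notation rQ := 26.
Notation rCK := 27.
Notation rT2 := 28.

Fixpoint pushn (r n : nat) : cmd :=
  match n with 0 => Skip | S n => Seq (Push r true) (pushn r n) end.

Lemma repeat_app_cons {A} (x : A) n l : repeat x n ++ x :: l = x :: repeat x n ++ l.
Proof. induction n; simpl; congruence. Qed.

Lemma pushn_runs r n : 3 <= r < nreg -> forall s,
  runs (pushn r n) s (n + 1) (upd s r (repeat true n ++ s r)).
Proof.
  intros Hr. induction n; intros; simpl.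
  - eapply runs_weaken; [apply runs_skip|auto|]. now rewrite upd_id.
  - eapply runs_weaken; [eapply runs_seq; [apply runs_push; auto|apply IHn]|lia|].
    rewrite upd_upd, upd_same. f_equal. apply repeat_app_cons.
Qed.

Fixpoint disp (n : nat) (f : nat -> cmd) : cmd :=
  match n with
  | 0 => f 0
  | S n => Pop rQ (f 0) (disp n (fun k => f (S k))) (disp n (fun k => f (S k)))
  end.

Lemma rQ_lt : rQ < nreg. Proof. unfold nreg; lia. Qed.

Lemma disp_runs n : forall f s q B s', s rQ = repeat true q -> q <= n ->
  runs (f q) (upd s rQ []) B s' -> runs (disp n f) s (B + n) s'.
Proof.
  induction n; intros f s q B s' Hs Hq HR; simpl.
  - replace q with 0 in * by lia. rewrite upd_id in HR by auto.
    eapply runs_weaken; eauto. lia.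
  - eapply runs_weaken with (B := S (B + n)); [apply runs_pop; [apply rQ_lt|]|lia|reflexivity].
    rewrite Hs. destruct q; simpl.
    + eapply runs_weaken; eauto. lia.
    + apply IHn with (q := q); [now lookup|lia|]. now rewrite upd_upd.
Qed.

Section Simulation.
Variable M : TM.

Definition simstep : cmd :=
  disp (tm_nstates M + 2) (fun q =>
    if halted q then pushn rQ q else
    readsym rR1 (fun i => readsym rR2 (fun a => readsym rR3 (fun w =>
      match tm_delta M q i a None w with
      | (q', w', mi, ma, mr, mw) =>
          Seq (act rL1 rR1 mi i) (Seq (act rL2 rR2 ma a) (Seq (act rL3 rR3 mw w')
            (pushn rQ (q' mod (tm_nstates M + 3)))))
      end)))).

Variables x a : list bool.

Definition sim_rep (s : store) (c : Config) : Prop :=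
  exists l1 r1 l2 r2 l3 r3,
    (s rL1 = cells_code l1 /\ s rR1 = cells_code r1 /\ s rL2 = cells_code l2 /\ s rR2 = cells_code r2 /\
     s rL3 = cells_code l3 /\ s rR3 = cells_code r3) /\
    tape_rep l1 r1 (c_in c) (nth_error x) /\ tape_rep l2 r2 (c_adv c) (nth_error a) /\
    tape_rep l3 r3 (c_work c) (c_tape c) /\
    s rQ = repeat true (c_state c) /\ c_state c < tm_nstates M + 3.

Definition same_outside (lo hi : nat) (s s' : store) : Prop :=
  forall i, i < lo \/ hi < i -> s' i = s i.

Lemma simstep_runs s c : sim_rep s c ->
  exists s', runs simstep s (2 * tm_nstates M + 40) s' /\ sim_rep s' (step M x a [] c) /\
             same_outside rL1 rQ s s'.
Proof.
  intros (l1 & r1 & l2 & r2 & l3 & r3 & (E1 & E2 & E3 & E4 & E5 & E6) & T1 & T2 & T3 & EQ & Hq).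
  assert (Hn : nreg = 40) by reflexivity.
  destruct (halted (c_state c)) eqn:Hh.
  - exists s. split; [|split].
    + eapply runs_weaken with (B := (c_state c + 1) + (tm_nstates M + 2)); [|lia|reflexivity].
      eapply disp_runs; [exact EQ|lia|]. rewrite Hh.
      eapply runs_weaken; [apply pushn_runs; lia|lia|].
      rewrite upd_upd, upd_same, app_nil_r. now apply upd_id.
    + unfold step. rewrite Hh. exists l1, r1, l2, r2, l3, r3. auto 10.
    + intros i _; auto.
  - destruct (tm_delta M (c_state c) (hd None r1) (hd None r2) None (hd None r3))
      as [[[[[q' w'] mi] ma] mr] mw] eqn:Ed.
    set (n1 := mv mi (hd None r1) l1 (tl r1)). set (n2 := mv ma (hd None r2) l2 (tl r2)).
    set (n3 := mv mw w' l3 (tl r3)). set (q := q' mod (tm_nstates M + 3)).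
    assert (Hqlt : q < tm_nstates M + 3) by (apply Nat.mod_upper_bound; lia).
    exists (upd (upd (upd (upd (upd (upd (upd s rL1 (cells_code (fst n1))) rR1 (cells_code (snd n1)))
       rL2 (cells_code (fst n2))) rR2 (cells_code (snd n2))) rL3 (cells_code (fst n3))) rR3 (cells_code (snd n3)))
       rQ (repeat true q)).
    split; [|split].
    + eapply runs_weaken with (B := (((6 + (6 + (6 + (q + 1))) + 2) + 2) + 2) + (tm_nstates M + 2));
        [|lia|reflexivity].
      eapply disp_runs; [exact EQ|lia|]. rewrite Hh.
      eapply readsym_runs; [lia| |]. { lookup. exact E2. }
      eapply readsym_runs; [lia| |]. { lookup. exact E4. }
      eapply readsym_runs; [lia| |]. { lookup. exact E6. }
      rewrite Ed.
      eapply runs_seq; [apply act_runs; try lia; lookup; eauto|].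
      eapply runs_seq; [apply act_runs; try lia; lookup; eauto|].
      eapply runs_seq; [apply act_runs; try lia; lookup; eauto|].
      eapply runs_weaken; [apply pushn_runs; lia|lia|]. lookup. fold n1 n2 n3 q. rewrite app_nil_r. store_ext.
    + assert (Es : step M x a [] c = mkConfig q (move mi (c_in c)) (move ma (c_adv c))
                 (move mr (c_rnd c)) (move mw (c_work c))
                 (fun i => if i =? c_work c then w' else c_tape c i)).
      { unfold step. rewrite Hh, (tape_rep_hd _ _ _ _ T1), (tape_rep_hd _ _ _ _ T2), (tape_rep_hd _ _ _ _ T3).
        replace (nth_error [] (c_rnd c)) with (@None bool) by now destruct (c_rnd c).
        rewrite Ed. reflexivity. }
      rewrite Es. exists (fst n1), (snd n1), (fst n2), (snd n2), (fst n3), (snd n3).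
      split; [repeat split; now lookup|]. cbn [c_in c_adv c_work c_tape c_state].
      split; [|split; [|split; [|split]]].
      * eapply tape_rep_ext; [apply tape_rep_mv; exact T1|]. intros i. simpl.
        destruct (Nat.eqb_spec i (c_in c)); subst; auto. symmetry. now apply tape_rep_hd with (1 := T1).
      * eapply tape_rep_ext; [apply tape_rep_mv; exact T2|]. intros i. simpl.
        destruct (Nat.eqb_spec i (c_adv c)); subst; auto. symmetry. now apply tape_rep_hd with (1 := T2).
      * apply tape_rep_mv; exact T3.
      * now lookup.
      * auto.
    + intros i Hi. lookup. auto.
Qed.

Lemma iter_succ_r {A} (f : A -> A) n c : Nat.iter n f (f c) = Nat.iter (S n) f c.
Proof. induction n; simpl; [auto|]. now rewrite IHn. Qed.

Lemma simloop_runs : forall l s c, s rCK = l -> sim_rep s c ->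
  exists s', runs (While rCK simstep simstep) s (length l * (2 * tm_nstates M + 41) + 1) s' /\
    sim_rep s' (Nat.iter (length l) (step M x a []) c) /\ s' rCK = [] /\ same_outside rL1 rCK s s'.
Proof.
  assert (Hn : nreg = 40) by reflexivity.
  induction l as [|b l IH]; intros s c Hs Hr.
  - exists s. split; [apply runs_while_end; auto; lia|]. split; auto. split; auto. intros i _; auto.
  - destruct (simstep_runs (upd s rCK l) c) as (s1 & R1 & Hr1 & F1).
    { destruct Hr as (l1 & r1 & l2 & r2 & l3 & r3 & E & H).
      exists l1, r1, l2, r2, l3, r3. split; [|exact H]. lookup. auto. }
    destruct (IH s1 (step M x a [] c)) as (s2 & R2 & Hr2 & H2 & F2); auto.
    exists s2. split; [|split; [|split]]; auto.
    + eapply runs_weaken; [eapply runs_while_step; [lia|exact Hs| |exact R2]| |reflexivity].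
      * destruct b; exact R1.
      * simpl. lia.
    + simpl length. rewrite <- iter_succ_r. auto.
    + intros i Hi. rewrite F2, F1 by lia. lookup. auto.
Qed.
End Simulation.

(* A string held in a register is stored reversed (as popping it from a tape leaves it); moving it
   to a simulated tape restores the order. *)
Definition loadt (r R : nat) : cmd :=
  Seq (While r (Seq (Push rT2 false) (pushsym R (Some false)))
               (Seq (Push rT2 true) (pushsym R (Some true)))) (mov rT2 r).

Lemma loadt_runs r R s : 3 <= r < nreg -> 3 <= R < nreg -> r <> R -> r <> rT2 -> R <> rT2 ->
  s rT2 = [] -> s R = [] ->
  runs (loadt r R) s (6 * length (s r) + 2) (upd s R (cells_code (map Some (rev (s r))))).
Proof.
  assert (Hn : nreg = 40) by reflexivity. intros.
  assert (G : forall l s, s r = l ->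
     runs (While r (Seq (Push rT2 false) (pushsym R (Some false)))
               (Seq (Push rT2 true) (pushsym R (Some true)))) s (4 * length l + 1)
       (upd (upd (upd s r []) rT2 (rev l ++ s rT2)) R (cells_code (map Some (rev l)) ++ s R))).
  { clear s H4 H5. induction l as [|b l IH]; intros s Hs.
    - eapply runs_weaken; [apply runs_while_end; auto; lia|simpl; lia|]. simpl. store_ext.
    - eapply runs_weaken.
      + eapply runs_while_step with (B1 := 3)
          (s1 := upd (upd (upd s r l) rT2 (b :: s rT2)) R (true :: b :: s R)); eauto; [lia| |].
        * destruct b; (eapply runs_weaken with (B := 1 + 2);
            [eapply runs_seq; [apply runs_push; lia|apply (pushsym_runs R (Some _)); auto]|lia|];
            lookup; reflexivity).
        * apply IH. now lookup.
      + simpl. lia.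
      + lookup. simpl. rewrite map_app. unfold cells_code. rewrite flat_map_app, <- !app_assoc. simpl.
        store_ext. }
  eapply runs_weaken; [eapply runs_seq; [apply G; reflexivity|apply mov_runs; lia]| |].
  - lookup. rewrite H4, app_nil_r, length_rev. lia.
  - lookup. rewrite H4, H5, !app_nil_r, rev_involutive. store_ext.
Qed.

(* The simulation is clocked by the length of register [rc]: a machine that only has to halt when its
   advice is [alpha] is run here on arbitrary advice. *)
Definition EVAL (M : TM) (rx rw rc ro : nat) : cmd :=
  Seq (loadt rx rR1) (Seq (loadt rw rR2) (Seq (copy rc rCK rT2)
  (Seq (While rCK (simstep M) (simstep M))
  (Seq (disp (tm_nstates M + 2) (fun q => Push ro (q =? 1)))
  (Seq (clear rL1) (Seq (clear rR1) (Seq (clear rL2) (Seq (clear rR2)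
  (Seq (clear rL3) (clear rR3)))))))))).

Definition user (r : nat) : Prop := 3 <= r < rL1.

Definition eval_cost (M : TM) : nat := 100 * (2 * tm_nstates M + 41).

Lemma EVAL_runs M rx rw rc ro s x w :
  user rx -> user rw -> user rc -> user ro ->
  (forall i, rL1 <= i <= rT2 -> s i = []) -> s rx = rev x -> s rw = rev w ->
  runs (EVAL M rx rw rc ro) s (eval_cost M * (length x + length w + length (s rc) + 1))
    (upd s ro (accepts_b M x w [] (length (s rc)) :: s ro)).
Proof.
  unfold user. intros Hx Hw Hc Ho He Ex Ew. assert (Hn : nreg = 40) by reflexivity.
  set (T := length (s rc)).
  set (s0 := upd (upd (upd s rR1 (cells_code (map Some x))) rR2 (cells_code (map Some w))) rCK (s rc)).
  assert (R0 : sim_rep M x w s0 init_config).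
  { exists [], (map Some x), [], (map Some w), [], []. unfold s0.
    split; [repeat split; lookup; auto; apply He; lia|].
    assert (G : forall y : list bool, tape_rep [] (map Some y) 0 (nth_error y)).
    { intro y. split; auto. simpl. induction y; intros [|i]; simpl; auto. }
    split; [apply G|]. split; [apply G|]. split; [|split].
    - split; auto. intros [|i]; reflexivity.
    - lookup. apply He; lia.
    - simpl. lia. }
  destruct (simloop_runs M x w (s rc) s0 init_config) as (s1 & R1 & Hr1 & Hck & F1); auto.
  fold T in R1, Hr1. fold (run M x w [] T) in Hr1.
  destruct Hr1 as (l1 & r1 & l2 & r2 & l3 & r3 & _ & _ & _ & _ & EQ & Hq).
  set (q := c_state (run M x w [] T)) in *.
  assert (HL : forall i, rL1 <= i <= rR3 ->
     length (s1 i) <= 2 * length x + 2 * length w + T * (2 * tm_nstates M + 41) + 1).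
  { intros i Hi. assert (H := runs_length _ _ _ _ i R1).
    assert (Hen : forall y : list bool, length (cells_code (map Some y)) = 2 * length y).
    { induction y; simpl; lia. }
    assert (length (s0 i) <= 2 * length x + 2 * length w).
    { unfold s0, upd. destruct (Nat.eqb_spec i rCK); [lia|].
      destruct (Nat.eqb_spec i rR2); [rewrite Hen; lia|].
      destruct (Nat.eqb_spec i rR1); [rewrite Hen; lia|]. rewrite He by lia. simpl. lia. }
    lia. }
  set (B := 2 * length x + 2 * length w + T * (2 * tm_nstates M + 41) + 1) in *.
  eapply runs_weaken.
  - unfold EVAL.
    eapply runs_seq. { apply loadt_runs; try lia; apply He; lia. }
    eapply runs_seq. { apply loadt_runs; try lia; lookup; apply He; lia. }
    eapply runs_seq. { apply copy_runs; try lia; lookup; apply He; lia. }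
    eapply runs_seq.
    { lookup. rewrite Ex, Ew, !rev_involutive, (He rCK), app_nil_r by lia. fold s0. exact R1. }
    eapply runs_seq. { eapply disp_runs; [exact EQ|lia|]. apply runs_push; lia. }
    eapply runs_seq. { apply clear_runs; lia. }
    eapply runs_seq. { apply clear_runs; lia. }
    eapply runs_seq. { apply clear_runs; lia. }
    eapply runs_seq. { apply clear_runs; lia. }
    eapply runs_seq. { apply clear_runs; lia. }
    apply clear_runs; lia.
  - lookup. fold T. rewrite Ex, Ew, !length_rev.
    assert (H1 := HL rL1 ltac:(lia)). assert (H2 := HL rR1 ltac:(lia)).
    assert (H3 := HL rL2 ltac:(lia)). assert (H4 := HL rR2 ltac:(lia)).
    assert (H5 := HL rL3 ltac:(lia)). assert (H6 := HL rR3 ltac:(lia)).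
    unfold eval_cost. unfold B in *. clear - H1 H2 H3 H4 H5 H6. nia.
  - assert (Hs1 : forall z, z < rL1 \/ rQ < z -> s1 z = s z).
    { intros z Hz. destruct (Nat.eq_dec z rCK) as [->|Hz'].
      - rewrite He by lia. exact Hck.
      - rewrite F1 by lia. unfold s0. now lookup. }
    apply functional_extensionality; intro z. unfold accepts_b, upd. fold q.
    destruct (Nat.eqb_spec z ro) as [->|Hzo];
      repeat match goal with
        |- context [Nat.eqb ?u ?k] =>
          lazymatch u with q => fail | _ => destruct (Nat.eqb_spec u k); try lia end
      end; subst; rewrite ?He by lia; auto; rewrite Hs1 by lia; auto.
Qed.

(** * Checking examples, enumerating strings, computing powers *)

Notation rX := 3.
Notation rW := 4.
Notation rN := 5.
Notation rM := 6.
Notation rCLK := 7.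
Notation rPAIRS := 8.
Notation rCNT := 9.
Notation rSRC := 10.
Notation rV := 11.
Notation rGO := 12.
Notation rIDX := 13.
Notation rOUT := 14.
Notation rCP := 15.
Notation rY := 16.
Notation rE := 17.
Notation rCLKA := 18.
Notation rBAD := 19.
Notation rCK2 := 29.
Notation rTMP := 30.
Notation rEXPO := 31.
Notation rEXPO2 := 32.
Notation rBASE := 33.

Lemma nreg_val : nreg = 40.
Proof. reflexivity. Qed.

Ltac know_nreg := try (assert (Hnreg := nreg_val)).

Definition takeblk (src ln dst : nat) : cmd :=
  let b := Pop src Skip (Push dst false) (Push dst true) in
  Seq (copy ln rCK2 rTMP) (While rCK2 b b).

Lemma takeblk_runs src ln dst s u rest :
  src < rL1 -> 3 <= ln < rL1 -> 3 <= dst < rL1 -> src <> ln -> src <> dst -> ln <> dst ->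
  s rCK2 = [] -> s rTMP = [] -> s src = u ++ rest -> length u = length (s ln) ->
  runs (takeblk src ln dst) s (8 * length u + 3) (upd (upd s src rest) dst (rev u ++ s dst)).
Proof.
  know_nreg. intros Hs Hl Hd H1 H2 H3 E1 E2 E3 E4.
  assert (G : forall u c s, s rCK2 = c -> s src = u ++ rest -> length u = length c ->
    runs (While rCK2 (Pop src Skip (Push dst false) (Push dst true))
                     (Pop src Skip (Push dst false) (Push dst true))) s (3 * length u + 1)
         (upd (upd (upd s src rest) dst (rev u ++ s dst)) rCK2 [])).
  { clear s u E1 E2 E3 E4.
    induction u as [|b u IH]; intros [|b' c] s Ec Es El; try discriminate.
    - eapply runs_weaken; [apply runs_while_end; auto; lia|simpl; lia|]. simpl in *. store_ext.
    - eapply runs_weaken.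
      + eapply runs_while_step with (B1 := 2)
          (s1 := upd (upd (upd s rCK2 c) src (u ++ rest)) dst (b :: s dst)); [lia|exact Ec| |].
        * assert (R : runs (Pop src Skip (Push dst false) (Push dst true)) (upd s rCK2 c) 2
            (upd (upd (upd s rCK2 c) src (u ++ rest)) dst (b :: s dst))).
          { apply runs_pop; [lia|]. lookup. rewrite Es. simpl.
            destruct b; (eapply runs_weaken; [apply runs_push; lia|lia|]; lookup; reflexivity). }
          destruct b'; exact R.
        * apply (IH c); lookup; auto.
      + simpl. lia.
      + lookup. simpl. rewrite <- app_assoc. store_ext. }
  eapply runs_weaken.
  - eapply runs_seq; [apply copy_runs; auto; lia|].
    apply (G u (s ln)); lookup; auto. rewrite E1, app_nil_r. reflexivity.
  - lia.
  - lookup. store_ext.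
Qed.

Definition CHECK_body (M : TM) (b : bool) : cmd :=
  Seq (takeblk rCP rN rY) (Seq (EVAL M rY rW rCLK rE) (Seq (clear rY)
    (Pop rE Skip (if b then Push rBAD true else Skip) (if b then Skip else Push rBAD true)))).

Definition CHECK (M : TM) : cmd :=
  Seq (copy rPAIRS rCP rTMP) (While rCP (CHECK_body M false) (CHECK_body M true)).

Definition pairs_code (ps : list (list bool * bool)) : list bool :=
  flat_map (fun p => snd p :: fst p) ps.

Definition bads (ev : list bool -> bool) (ps : list (list bool * bool)) (base : list bool) :=
  fold_left (fun base p => (if eqb (ev (fst p)) (snd p) then [] else [true]) ++ base) ps base.

Lemma bads_nil ev ps : forall base,
  bads ev ps base = [] <-> base = [] /\ forall p, In p ps -> ev (fst p) = snd p.
Proof.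
  induction ps as [|p ps IH]; intros base; simpl.
  - unfold bads. simpl. tauto.
  - change (bads ev ps ((if eqb (ev (fst p)) (snd p) then [] else [true]) ++ base) = [] <->
            base = [] /\ (forall q, p = q \/ In q ps -> ev (fst q) = snd q)).
    rewrite IH. destruct (eqb (ev (fst p)) (snd p)) eqn:E; simpl.
    + apply eqb_prop in E. split; intros [H1 H2]; split; auto.
      intros q [<-|Hq]; auto.
    + apply eqb_false_iff in E. split; intros [H1 H2]; [discriminate|].
      exfalso. auto.
Qed.

Lemma bads_length ev ps : forall base, length (bads ev ps base) <= length ps + length base.
Proof.
  induction ps as [|p ps IH]; intros base; simpl; auto.
  unfold bads in *. simpl. eapply Nat.le_trans; [apply IH|]. rewrite length_app.
  destruct (eqb _ _); simpl; lia.
Qed.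

Definition scratch (s : store) : Prop :=
  (forall i, rL1 <= i <= rTMP -> s i = []) /\ s rY = [] /\ s rE = [] /\ s rCP = [].

Definition check_cost (M : TM) : nat := 60 + 4 * eval_cost M.

Lemma CHECK_runs M s ps w U : scratch s -> s rPAIRS = pairs_code ps -> s rW = rev w ->
  (forall p, In p ps -> length (fst p) = length (s rN)) ->
  length (pairs_code ps) <= U -> length (s rN) <= U -> length w <= U -> length (s rCLK) <= U -> 1 <= U ->
  runs (CHECK M) s (check_cost M * (U * U))
    (upd s rBAD (bads (fun x => accepts_b M x w [] (length (s rCLK))) ps (s rBAD))).
Proof.
  know_nreg. intros (S1 & S2 & S3 & S4) Ep Ew Hps Up Un Uw Uc U1.
  remember (length (s rN)) as nn eqn:Enn. remember (length (s rCLK)) as tc eqn:Etc0.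
  set (ev := fun x => accepts_b M x w [] tc).
  set (B1 := 20 * U + 10 + eval_cost M * (3 * U + 1)).
  assert (G : forall ps s, (forall p, In p ps -> length (fst p) = nn) ->
     (forall i, rL1 <= i <= rTMP -> s i = []) -> s rY = [] -> s rE = [] ->
     s rCP = pairs_code ps -> s rW = rev w -> length (s rN) = nn -> length (s rCLK) = tc ->
     runs (While rCP (CHECK_body M false) (CHECK_body M true)) s (length ps * (B1 + 1) + 1)
       (upd (upd s rBAD (bads ev ps (s rBAD))) rCP [])).
  { clear s ps S1 S2 S3 S4 Ep Ew Hps Up Enn Etc0.
    induction ps as [|[x b] ps IH]; intros s Hps S1 S2 S3 Ec Ew En Etc.
    - eapply runs_weaken; [apply runs_while_end; auto; lia|simpl; lia|]. simpl. store_ext.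
    - simpl in Ec.
      assert (Hx : length x = nn) by (apply (Hps (x, b)); simpl; auto).
      set (s1 := upd (upd s rCP (pairs_code ps)) rBAD ((if eqb (ev x) b then [] else [true]) ++ s rBAD)).
      eapply runs_weaken.
      + eapply runs_while_step with (B1 := B1) (s1 := s1); [lia|exact Ec| |].
        * assert (R : runs (CHECK_body M b) (upd s rCP (x ++ pairs_code ps)) B1 s1).
          { unfold CHECK_body. eapply runs_weaken.
            - eapply runs_seq.
              { apply takeblk_runs with (u := x) (rest := pairs_code ps); try lia; lookup; auto; try lia;
                apply S1; lia. }
              eapply runs_seq.
              { apply EVAL_runs with (x := x) (w := w); unfold user; try lia.
                - intros i Hi. lookup. apply S1; lia.
                - lookup. rewrite S2. apply app_nil_r.
                - lookup. auto. }
              eapply runs_seq; [apply clear_runs; lia|].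
              apply runs_pop; [lia|]. lookup. cbn [sel hd_error tl].
              instantiate (2 := 1).
              instantiate (1 := s1).
              unfold s1. rewrite Etc. fold (ev x).
              destruct (ev x), b; cbn [eqb app];
                (eapply runs_weaken; [first [apply runs_skip | apply runs_push; lia]|lia|]; lookup;
                 rewrite S3; store_ext).
            - lookup. rewrite S2, app_nil_r, length_rev, Hx, Etc. unfold B1.
              assert (length w <= U) by auto. nia.
            - reflexivity. }
          destruct b; exact R.
        * apply IH.
          -- intros p Hp. apply Hps. simpl; auto.
          -- intros i Hi. unfold s1. lookup. apply S1; lia.
          -- unfold s1. lookup. auto.
          -- unfold s1. lookup. auto.
          -- unfold s1. lookup. auto.
          -- unfold s1. lookup. auto.
          -- unfold s1. lookup. auto.
          -- unfold s1. lookup. auto.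
      + simpl. lia.
      + unfold s1. lookup. unfold bads. simpl. store_ext. }
  assert (Hlen : length ps <= length (pairs_code ps)).
  { clear. induction ps as [|[x b] ps IH]; simpl; [auto|]. rewrite length_app. lia. }
  eapply runs_weaken.
  - eapply runs_seq; [apply copy_runs; try lia; apply S1; lia|].
    apply (G ps); lookup; auto.
    + intros i Hi. lookup. apply S1; lia.
    + rewrite Ep, S4. apply app_nil_r.
  - rewrite Ep. unfold B1, check_cost. 
    assert (length ps * (20 * U + 10 + eval_cost M * (3 * U + 1) + 1) <=
            U * (20 * U + 10 + eval_cost M * (3 * U + 1) + 1)) by (apply Nat.mul_le_mono_r; lia).
    nia.
  - lookup. store_ext.
Qed.

Definition dec (V GO : nat) : cmd :=
  Seq (While V (Push rTMP true) (Seq (Push rTMP false) (Seq (Push GO true) (mov V rTMP))))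
      (mov rTMP V).

Fixpoint pred_bits (l : list bool) : bool * list bool :=
  match l with
  | [] => (false, [])
  | true :: l => (true, false :: l)
  | false :: l => let '(g, l') := pred_bits l in (g, true :: l')
  end.

Lemma pred_bits_length l : length (snd (pred_bits l)) = length l.
Proof.
  induction l as [|[|] l IH]; simpl; auto. destruct (pred_bits l); simpl in *. lia.
Qed.

Definition flag (b : bool) : list bool := if b then [true] else [].

Lemma dec_runs V GO s : 3 <= V < rL1 -> 3 <= GO < rL1 -> V <> GO -> s rTMP = [] ->
  runs (dec V GO) s (6 * length (s V) + 6)
    (upd (upd s V (snd (pred_bits (s V)))) GO (flag (fst (pred_bits (s V))) ++ s GO)).
Proof.
  know_nreg. intros HV HG Hn E.
  assert (G : forall l s, s V = l ->
    runs (While V (Push rTMP true) (Seq (Push rTMP false) (Seq (Push GO true) (mov V rTMP)))) s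
      (3 * length l + 4)
      (upd (upd (upd s V []) GO (flag (fst (pred_bits l)) ++ s GO))
           rTMP (rev (snd (pred_bits l)) ++ s rTMP))).
  { clear s E. induction l as [|[|] l IH]; intros s Es.
    - eapply runs_weaken; [apply runs_while_end; auto; lia|simpl; lia|]. simpl. store_ext.
    - eapply runs_weaken.
      + eapply runs_while_step; [lia|exact Es| |].
        * eapply runs_seq; [apply runs_push; lia|]. eapply runs_seq; [apply runs_push; lia|].
          apply mov_runs; lia.
        * apply runs_while_end; [lia|]. now lookup.
      + lookup. simpl. lia.
      + lookup. simpl. rewrite <- app_assoc. store_ext.
    - eapply runs_weaken.
      + eapply runs_while_step; [lia|exact Es|apply runs_push; lia|]. apply IH. now lookup.
      + simpl. lia.
      + lookup. simpl. destruct (pred_bits l) as [g l']. simpl. rewrite <- app_assoc. store_ext. }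
  eapply runs_weaken.
  - eapply runs_seq; [apply G; reflexivity|apply mov_runs; lia].
  - lookup. rewrite E, app_nil_r, length_rev, pred_bits_length. lia.
  - lookup. rewrite E, !app_nil_r, rev_involutive. store_ext.
Qed.

Fixpoint bits (m v : nat) : list bool :=
  match m with 0 => [] | S m => Nat.odd v :: bits m (Nat.div2 v) end.

Lemma bits_length m : forall v, length (bits m v) = m.
Proof. induction m; intros; simpl; auto. Qed.

Lemma pred_bits_S m : forall v, S v < 2 ^ m -> pred_bits (bits m (S v)) = (true, bits m v).
Proof.
  induction m; intros v Hv; [simpl in Hv; lia|].
  assert (H2 : 2 ^ S m = 2 * 2 ^ m) by reflexivity.
  cbn [bits]. rewrite Nat.odd_succ.
  destruct (Nat.even v) eqn:Ev.
  - apply Nat.even_spec in Ev as [k ->]. cbn [pred_bits].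
    rewrite Nat.div2_succ_double, Nat.div2_double, Nat.odd_mul. reflexivity.
  - assert (Ho : Nat.odd v = true) by (unfold Nat.odd; rewrite Ev; auto).
    apply Nat.odd_spec in Ho as [k ->]. cbn [pred_bits].
    replace (S (2 * k + 1)) with (2 * S k) by lia. rewrite Nat.div2_double, IHm by lia.
    replace (2 * k + 1) with (S (2 * k)) by lia.
    rewrite Nat.div2_succ_double, Nat.odd_succ, Nat.even_mul. reflexivity.
Qed.

Lemma pred_bits_0 m : pred_bits (bits m 0) = (false, repeat true m).
Proof. induction m; simpl; auto. now rewrite IHm. Qed.

Lemma bits_ones m : bits m (2 ^ m - 1) = repeat true m.
Proof.
  induction m; auto. assert (H := Nat.pow_nonzero 2 m).
  replace (2 ^ S m - 1) with (S (2 * (2 ^ m - 1))) by (simpl; lia).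
  cbn [bits repeat]. now rewrite Nat.div2_succ_double, IHm, Nat.odd_succ, Nat.even_mul.
Qed.

(* Appends to [rSRC] the strings of value [v, v - 1, ..., 0], where [v] is the number in [rV], and
   lengthens the counter [rCNT] by one for each of them. *)
Definition ENUM_body : cmd :=
  Seq (Push rCNT true) (Seq (dup rV rTMP rSRC) (Seq (mov rTMP rV) (dec rV rGO))).
Definition ENUM : cmd := Seq (Push rGO true) (While rGO ENUM_body ENUM_body).

Lemma ENUM_runs s m v : s rV = bits m v -> v < 2 ^ m -> s rGO = [] -> s rTMP = [] ->
  runs ENUM s (S v * (11 * m + 20) + 2)
    (upd (upd (upd s rV (repeat true m))
       rSRC (concat (map (fun i => rev (bits m i)) (seq 0 (S v))) ++ s rSRC))
       rCNT (repeat true (S v) ++ s rCNT)).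
Proof.
  know_nreg. intros EV Hv EG ET.
  assert (B : forall s l, length l = m -> s rV = l -> s rTMP = [] -> s rGO = [] ->
    runs ENUM_body s (11 * m + 10)
     (upd (upd (upd (upd s rV (snd (pred_bits l))) rSRC (rev l ++ s rSRC)) rCNT (true :: s rCNT))
          rGO (flag (fst (pred_bits l))))).
  { clear. intros s l Hl EV ET EG. know_nreg.
    unfold ENUM_body. eapply runs_weaken.
    - eapply runs_seq; [apply runs_push; lia|]. eapply runs_seq; [apply dup_runs; lia|].
      eapply runs_seq; [apply mov_runs; lia|]. apply dec_runs; try lia. now lookup.
    - lookup. rewrite EV, ET, !app_nil_r, !length_rev. lia.
    - lookup. rewrite EV, ET, EG, !app_nil_r, rev_involutive. store_ext. }
  assert (G : forall v s, v < 2 ^ m -> s rV = bits m v -> s rGO = [true] -> s rTMP = [] ->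
    runs (While rGO ENUM_body ENUM_body) s (S v * (11 * m + 20) + 1)
    (upd (upd (upd (upd s rV (repeat true m))
       rSRC (concat (map (fun i => rev (bits m i)) (seq 0 (S v))) ++ s rSRC))
       rCNT (repeat true (S v) ++ s rCNT)) rGO [])).
  { clear v s EV Hv EG ET. induction v as [|v IH]; intros s Hv EV EG ET.
    - eapply runs_weaken.
      + eapply runs_while_step; [lia|exact EG|apply (B _ (bits m 0)); lookup; auto; apply bits_length|].
        rewrite pred_bits_0. simpl. apply runs_while_end; [lia|now lookup].
      + lia.
      + lookup. simpl. rewrite app_nil_r. store_ext.
    - eapply runs_weaken.
      + eapply runs_while_step; [lia|exact EG|apply (B _ (bits m (S v))); lookup; auto; apply bits_length|].
        rewrite pred_bits_S by auto. simpl. apply IH; [lia| | |]; now lookup.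
      + nia.
      + lookup. rewrite (seq_S (S v)), map_app, concat_app. simpl map.
        simpl concat at 3. rewrite app_nil_r, <- app_assoc, repeat_app_cons.
        change (repeat true (S (S v))) with (true :: repeat true (S v)). store_ext. }
  eapply runs_weaken.
  - eapply runs_seq; [apply runs_push; lia|]. apply (G v); lookup; auto. now rewrite EG.
  - lia.
  - lookup. store_ext.
Qed.

Definition MUL (P b : nat) : cmd :=
  let a := copy b P rCK2 in Seq (mov P rTMP) (While rTMP a a).
Definition POWER (P b e : nat) : cmd :=
  Seq (Push P true) (While e (MUL P b) (MUL P b)).

Lemma rev_repeat_true n : rev (repeat true n) = repeat true n.
Proof.
  induction n; simpl; auto. rewrite IHn.
  clear. induction n; simpl; congruence.
Qed.

Lemma MUL_runs P b s p q : 3 <= P < nreg -> 3 <= b < nreg -> P <> b ->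
  P <> rTMP -> b <> rTMP -> P <> rCK2 -> b <> rCK2 ->
  s rTMP = [] -> s rCK2 = [] -> s b = repeat true q -> s P = repeat true p ->
  runs (MUL P b) s (p * (5 * q + 5) + 2) (upd s P (repeat true (p * q))).
Proof.
  know_nreg. intros.
  assert (G : forall l s, s rTMP = l -> s rCK2 = [] -> s b = repeat true q ->
    runs (While rTMP (copy b P rCK2) (copy b P rCK2)) s (length l * (5 * q + 3) + 1)
     (upd (upd s P (repeat true (length l * q) ++ s P)) rTMP [])).
  { clear s H6 H7 H8 H9. induction l as [|v l IH]; intros s Es Ec Eb.
    - eapply runs_weaken; [apply runs_while_end; auto; lia|simpl; lia|]. simpl. store_ext.
    - eapply runs_weaken.
      + eapply runs_for_step with (B1 := 5 * q + 2); [lia|exact Es| |].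
        * assert (R : runs (copy b P rCK2) (upd s rTMP l) (5 * q + 2)
              (upd (upd s rTMP l) P (repeat true q ++ s P))).
          { eapply runs_weaken; [apply copy_runs; try lia; lookup; auto| |]; lookup; rewrite Eb; auto.
            rewrite repeat_length. lia. }
          exact R.
        * apply IH; lookup; auto.
      + simpl. lia.
      + lookup. simpl length. simpl mult. rewrite Nat.add_comm, repeat_app, <- app_assoc. store_ext. }
  eapply runs_weaken.
  - eapply runs_seq; [apply mov_runs; lia|]. apply (G (repeat true p)); lookup; auto.
    rewrite H6, H9, app_nil_r. apply rev_repeat_true.
  - rewrite H9, !repeat_length. lia.
  - lookup. rewrite repeat_length, app_nil_r. store_ext.
Qed.

Lemma POWER_runs P b e s q z : 3 <= P < nreg -> 3 <= b < nreg -> 3 <= e < nreg -> P <> b ->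
  P <> rTMP -> b <> rTMP -> P <> rCK2 -> b <> rCK2 -> e <> P -> e <> b -> e <> rTMP -> e <> rCK2 ->
  s rTMP = [] -> s rCK2 = [] -> s b = repeat true q -> s P = [] -> length (s e) = z ->
  runs (POWER P b e) s (z * (S q ^ z * (5 * q + 5) + 3) + 2)
    (upd (upd s e []) P (repeat true (q ^ z))).
Proof.
  know_nreg. intros.
  set (C := S q ^ z * (5 * q + 5) + 2).
  assert (G : forall l i s, s e = l -> length l + i = z -> s P = repeat true (q ^ i) ->
     s rTMP = [] -> s rCK2 = [] -> s b = repeat true q ->
     runs (While e (MUL P b) (MUL P b)) s (length l * (C + 1) + 1)
       (upd (upd s e []) P (repeat true (q ^ z)))).
  { clear s H11 H12 H13 H14 H15. induction l as [|v l IH]; intros i s Ee Ei EP ET EC Eb.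
    - eapply runs_weaken; [apply runs_while_end; auto; lia|simpl; lia|].
      simpl in Ei. subst i. store_ext.
    - simpl in Ei. eapply runs_weaken.
      + eapply runs_for_step with (B1 := C); [lia|exact Ee| |].
        * assert (R : runs (MUL P b) (upd s e l) C (upd (upd s e l) P (repeat true (q ^ S i)))).
          { eapply runs_weaken; [apply (MUL_runs P b _ (q ^ i) q); try lia; lookup; auto| |].
            - unfold C. apply Nat.add_le_mono_r, Nat.mul_le_mono_r.
              transitivity (S q ^ i); [apply Nat.pow_le_mono_l; lia|].
              apply Nat.pow_le_mono_r; lia.
            - now rewrite Nat.pow_succ_r', Nat.mul_comm. }
          exact R.
        * apply (IH (S i)); lookup; auto. lia.
      + simpl. lia.
      + lookup. store_ext. }
  eapply runs_weaken.
  - eapply runs_seq; [apply runs_push; lia|]. apply (G (s e) 0); lookup; auto.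
    + lia.
    + rewrite H14. reflexivity.
  - unfold C. rewrite H15. lia.
  - store_ext.
Qed.

(** * The randomized machine *)

(* [rN] must hold [n + 1] in unary here, since [poly_bound k n] is built on [S n ^ k]. *)
Definition POLY (r k : nat) : cmd :=
  Seq (pushn rEXPO k) (Seq (POWER r rN rEXPO) (pushn r k)).

Lemma POLY_runs r k s n : user r -> r <> rN -> s rTMP = [] -> s rCK2 = [] -> s rEXPO = [] ->
  s rN = repeat true (S n) -> s r = [] ->
  runs (POLY r k) s (k * ((n + 2) ^ k * (5 * n + 10) + 5) + 4)
    (upd s r (repeat true (poly_bound k n))).
Proof.
  know_nreg. unfold user. intros. eapply runs_weaken.
  - eapply runs_seq; [apply pushn_runs; lia|].
    eapply runs_seq; [eapply (POWER_runs r rN rEXPO _ (S n) k); try lia; lookup; auto|].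
    + rewrite H3, app_nil_r. apply repeat_length.
    + apply pushn_runs; lia.
  - replace (S (S n)) with (n + 2) by lia. nia.
  - lookup. rewrite <- repeat_app. unfold poly_bound. store_ext.
Qed.

Definition READ : cmd :=
  While 0 (Seq (Push rX false) (Push rN true)) (Seq (Push rX true) (Push rN true)).

Lemma READ_runs : forall x s, s 0 = x ->
  runs READ s (3 * length x + 1)
    (upd (upd (upd s 0 []) rX (rev x ++ s rX)) rN (repeat true (length x) ++ s rN)).
Proof.
  know_nreg. induction x as [|b x IH]; intros s E.
  - eapply runs_weaken; [apply runs_while_end; auto; lia|simpl; lia|]. simpl. store_ext.
  - eapply runs_weaken.
    + eapply runs_while_step with (B1 := 2)
        (s1 := upd (upd (upd s 0 x) rX (b :: s rX)) rN (true :: s rN)); [lia|exact E| |].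
      * destruct b; (eapply runs_weaken; [eapply runs_seq; apply runs_push; lia|lia|];
          lookup; reflexivity).
      * apply IH. now lookup.
    + simpl. lia.
    + lookup. simpl. rewrite <- app_assoc, repeat_app_cons. store_ext.
Qed.

Definition BPP_prep (d k kk : nat) : cmd :=
  Seq READ (Seq (pushn rEXPO d) (Seq (POWER rM rN rEXPO) (Seq (Push rN true)
  (Seq (POLY rCLK k) (Seq (POLY rCNT kk) (Seq (Pop rN Skip Skip Skip)
  (Seq (mov 1 rTMP) (mov rTMP rPAIRS)))))))).

Definition BPP_state (x g r : list bool) (d k kk : nat) : store :=
  let n := length x in
  upd (upd (upd (upd (upd (upd (upd (fun _ => []) 2 r) rX (rev x)) rN (repeat true n))
    rM (repeat true (n ^ d))) rCLK (repeat true (poly_bound k n)))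
    rCNT (repeat true (poly_bound kk n))) rPAIRS g.

Lemma BPP_prep_runs x g r d k kk U :
  length x + 2 <= U -> (length x + 1) ^ d <= U -> (length x + 2) ^ k <= U ->
  (length x + 2) ^ kk <= U -> length g <= U ->
  runs (BPP_prep d k kk) (init_store x g r) (20 * (d + k + kk + 4) * (U * U))
    (BPP_state x g r d k kk).
Proof.
  know_nreg. intros HU Hd Hk Hkk Hg. set (n := length x) in *. eapply runs_weaken.
  - eapply runs_seq; [apply READ_runs; reflexivity|]. cbn [init_store]. fold n.
    eapply runs_seq; [apply pushn_runs; lia|].
    eapply runs_seq; [eapply (POWER_runs rM rN rEXPO _ n d); try lia; lookup; auto|].
    { cbn [init_store]. apply app_nil_r. }
    { cbn [init_store]. rewrite app_nil_r. apply repeat_length. }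
    eapply runs_seq; [apply runs_push; lia|].
    eapply runs_seq; [apply (POLY_runs rCLK k _ n); unfold user; try lia; lookup; auto|].
    { cbn [init_store]. rewrite app_nil_r. auto. }
    eapply runs_seq; [apply (POLY_runs rCNT kk _ n); unfold user; try lia; lookup; auto|].
    { cbn [init_store]. rewrite app_nil_r. auto. }
    eapply runs_seq. 
    { apply runs_pop; [lia|]. lookup. cbn [hd_error sel tl]. apply runs_skip. }
    eapply runs_seq; [apply mov_runs; lia|apply mov_runs; lia].
  - lookup. cbn [init_store]. rewrite app_nil_r, length_rev. fold n.
    replace (S n) with (n + 1) by lia.
    assert ((n + 1) ^ d * (5 * n + 5) <= U * (5 * U)) by (apply Nat.mul_le_mono; lia).
    assert ((n + 2) ^ k * (5 * n + 10) <= U * (5 * U)) by (apply Nat.mul_le_mono; lia).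
    assert ((n + 2) ^ kk * (5 * n + 10) <= U * (5 * U)) by (apply Nat.mul_le_mono; lia).
    assert (U * 1 <= U * U) by (apply Nat.mul_le_mono_l; lia).
    set (a1 := (n + 1) ^ d * (5 * n + 5)) in *. set (a2 := (n + 2) ^ k * (5 * n + 10)) in *.
    set (a3 := (n + 2) ^ kk * (5 * n + 10)) in *. set (UU := U * U) in *.
    assert (d * (a1 + 3) <= d * (9 * UU)) by (apply Nat.mul_le_mono_l; lia).
    assert (k * (a2 + 5) <= k * (11 * UU)) by (apply Nat.mul_le_mono_l; lia).
    assert (kk * (a3 + 5) <= kk * (11 * UU)) by (apply Nat.mul_le_mono_l; lia).
    assert (d * 1 <= d * UU) by (apply Nat.mul_le_mono_l; lia).
    nia.
  - lookup. cbn [init_store]. rewrite !app_nil_r, rev_involutive. unfold BPP_state. fold n.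
    apply functional_extensionality; intro z. unfold upd.
    repeat match goal with
      |- context [Nat.eqb ?u ?k] => destruct (Nat.eqb_spec u k); try lia
    end; auto; destruct z as [|[|[|]]]; try lia; reflexivity.
Qed.

(* Clearing [rCNT] after the first consistent sample ends the surrounding loop. *)
Definition BPP_body (M : TM) : cmd :=
  Seq (takeblk 2 rM rW) (Seq (CHECK M)
    (Pop rBAD (Seq (EVAL M rX rW rCLK rOUT) (clear rCNT))
       (Seq (clear rBAD) (clear rW)) (Seq (clear rBAD) (clear rW)))).

Fixpoint first_hit {A} (test : list bool -> bool) (val : list bool -> A) (m K : nat)
    (r : list bool) : option A :=
  match K with
  | 0 => None
  | S K => if test (firstn m r) then Some (val (firstn m r))
           else first_hit test val m K (skipn m r)
  end.

Definition consistent (ev : list bool -> bool) (ps : list (list bool * bool)) : bool :=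
  forallb (fun p => eqb (ev (fst p)) (snd p)) ps.

Lemma bads_consistent ev ps :
  bads ev ps [] = [] <-> consistent ev ps = true.
Proof.
  rewrite bads_nil. unfold consistent. rewrite forallb_forall. split.
  - intros [_ H] p Hp. apply eqb_true_iff. auto.
  - intros H. split; auto. intros p Hp. apply eqb_prop. auto.
Qed.

Definition trial_cost (M : TM) : nat := check_cost M + 4 * eval_cost M + 40.

Lemma BPP_loop_runs M x ps m p U :
  (forall q, In q ps -> length (fst q) = length x) ->
  length (pairs_code ps) <= U -> length x <= U -> m <= U -> p <= U -> 1 <= U ->
  forall cnt s r, scratch s -> length cnt <= U -> s rCNT = cnt -> length cnt * m <= length r ->
  s 2 = r -> s rX = rev x -> length (s rN) = length x -> length (s rM) = m ->
  length (s rCLK) = p -> s rPAIRS = pairs_code ps -> s rW = [] -> s rBAD = [] -> s rOUT = [] ->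
  exists s', runs (While rCNT (BPP_body M) (BPP_body M)) s
       (length cnt * (trial_cost M * (U * U)) + 1) s' /\
    s' rOUT = match first_hit (fun w => consistent (fun y => accepts_b M y w [] p) ps)
                       (fun w => accepts_b M x w [] p) m (length cnt) r
              with Some b => [b] | None => [] end.
Proof.
  know_nreg. intros Hps Ue Ux Um Up U1. induction cnt as [|c cnt IH];
    intros s r Hs Ucnt Ecnt Hr Er EX EN EM EC EP EW EB EO.
  - exists s. split; [apply runs_while_end; auto; lia|]. simpl. auto.
  - simpl in Hr, Ucnt.
    assert (Hs0 := Hs). destruct Hs0 as (S1 & S2 & S3 & S4).
    set (w := firstn m r).
    assert (Hw : length w = m) by (unfold w; rewrite length_firstn; lia).
    assert (Hps2 : length ps <= U).
    { eapply Nat.le_trans; [|exact Ue]. clear. induction ps as [|[y b] ps IH]; simpl; [auto|].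
      rewrite length_app. lia. }
    set (s1 := upd (upd (upd s rCNT cnt) 2 (skipn m r)) rW (rev w)).
    assert (R1 : runs (takeblk 2 rM rW) (upd s rCNT cnt) (8 * U + 3) s1).
    { eapply runs_weaken; [apply takeblk_runs with (u := w) (rest := skipn m r); try lia; lookup|..].
      - apply S1; lia.
      - apply S1; lia.
      - rewrite Er. unfold w. now rewrite firstn_skipn.
      - lia.
      - lia.
      - lookup. rewrite EW, app_nil_r. reflexivity. }
    set (bd := bads (fun y => accepts_b M y w [] p) ps []).
    assert (Hbd : length bd <= U).
    { eapply Nat.le_trans; [apply bads_length|]. simpl. lia. }
    assert (R2 : runs (CHECK M) s1 (check_cost M * (U * U)) (upd s1 rBAD bd)).
    { eapply runs_weaken; [apply (CHECK_runs M s1 ps w U)|auto|]; unfold s1; lookup; auto; try lia.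
      - repeat split; lookup; auto. intros i Hi. lookup. apply S1; lia.
      - intros q Hq. lookup. rewrite EN. auto.
      - rewrite EB, EC. reflexivity. }
    assert (UU : U * 1 <= U * U) by (apply Nat.mul_le_mono_l; lia).
    simpl first_hit. fold w.
    destruct (consistent (fun y => accepts_b M y w [] p) ps) eqn:Econ.
    + exists (upd (upd (upd s1 rBAD []) rOUT [accepts_b M x w [] p]) rCNT []).
      apply bads_consistent in Econ. fold bd in Econ. split; [|now lookup].
      eapply runs_weaken.
      * eapply runs_for_step; [lia|exact Ecnt| |apply runs_while_end with (r := rCNT); [lia|]].
        { eapply runs_seq; [exact R1|]. eapply runs_seq; [exact R2|].
          apply runs_pop; [lia|]. lookup. rewrite Econ. cbn [hd_error sel tl].
          eapply runs_seq; [apply EVAL_runs with (x := x) (w := w); unfold user; try lia;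
            unfold s1; lookup; auto|apply clear_runs; lia].
          intros i Hi. lookup. apply S1; lia. }
        now lookup.
      * unfold s1; lookup. rewrite EC. unfold trial_cost. rewrite Hw. simpl length.
        clearbody bd. clear IH R1 R2. nia.
      * unfold s1; lookup. rewrite EO, EC. store_ext.
    + assert (Hne : bd <> []).
      { intro E. apply bads_consistent in E. congruence. }
      destruct (IH (upd (upd s1 rBAD []) rW []) (skipn m r)) as (s' & R' & O').
      { repeat split; unfold s1; lookup; auto. intros i Hi; lookup. apply S1; lia. }
      { lia. }
      { unfold s1. now lookup. }
      { rewrite length_skipn. lia. }
      all: try (unfold s1; lookup; auto; fail).
      exists s'. split; [|exact O'].
      eapply runs_weaken; [eapply runs_for_step; [lia|exact Ecnt| |exact R']| |reflexivity].
      * eapply runs_seq; [exact R1|]. eapply runs_seq; [exact R2|].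
        assert (RF : runs (Seq (clear rBAD) (clear rW)) (upd s1 rBAD (tl bd)) (4 * U + 2)
           (upd (upd s1 rBAD []) rW [])).
        { eapply runs_weaken; [eapply runs_seq; apply clear_runs; lia| |].
          - lookup. unfold s1; lookup. rewrite length_rev, Hw. destruct bd; simpl in *; lia.
          - store_ext. }
        apply runs_pop; [lia|]. rewrite upd_same, upd_upd.
        destruct bd as [|[|] bd]; [congruence|exact RF|exact RF].
      * unfold trial_cost. simpl length. clear IH R1 R2 R'. nia.
Qed.

Definition BPP_cmd (M : TM) (d k kk : nat) : cmd :=
  Seq (BPP_prep d k kk) (While rCNT (BPP_body M) (BPP_body M)).

Definition BPP_cost (M : TM) (d k kk : nat) : nat := 20 * (d + k + kk + 4) + trial_cost M + 1.

Theorem BPP_runs M d k kk x ps r U :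
  (forall q, In q ps -> length (fst q) = length x) ->
  length x + 2 <= U -> (length x + 1) ^ d <= U -> (length x + 2) ^ k + k <= U ->
  (length x + 2) ^ kk + kk <= U -> length (pairs_code ps) <= U ->
  poly_bound kk (length x) * length x ^ d <= length r ->
  exists s', runs (BPP_cmd M d k kk) (init_store x (pairs_code ps) r) (BPP_cost M d k kk * (U * U * U)) s' /\
    s' rOUT = match first_hit
         (fun w => consistent (fun y => accepts_b M y w [] (poly_bound k (length x))) ps)
         (fun w => accepts_b M x w [] (poly_bound k (length x)))
         (length x ^ d) (poly_bound kk (length x)) r
       with Some b => [b] | None => [] end.
Proof.
  intros Hps U0 Ud Uk Ukk Ue Hr. set (n := length x) in *.
  assert (Hmono : forall e, S n ^ e <= (n + 2) ^ e) by (intro; apply Nat.pow_le_mono_l; lia).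
  assert (Hd2 : n ^ d <= (n + 1) ^ d) by (apply Nat.pow_le_mono_l; lia).
  destruct (BPP_loop_runs M x ps (n ^ d) (poly_bound k n) U) with
    (cnt := repeat true (poly_bound kk n)) (s := BPP_state x (pairs_code ps) r d k kk) (r := r)
    as (s' & R & O); auto; try lia.
  all: unfold BPP_state; fold n; rewrite ?repeat_length; lookup; auto; rewrite ?repeat_length; auto.
  - unfold poly_bound. specialize (Hmono k). lia.
  - repeat split; lookup; auto. intros i Hi. now lookup.
  - unfold poly_bound. specialize (Hmono kk). lia.
  - rewrite repeat_length in O. exists s'. split; auto.
    eapply runs_weaken; [eapply runs_seq; [apply BPP_prep_runs with (U := U); fold n; lia|exact R]|
       |reflexivity].
    rewrite repeat_length. assert (Hkk : poly_bound kk n <= U).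
    { unfold poly_bound. specialize (Hmono kk). lia. }
    unfold BPP_cost.
    assert (poly_bound kk n * (trial_cost M * (U * U)) <= U * (trial_cost M * (U * U)))
      by (apply Nat.mul_le_mono_r; auto).
    assert (U * U * 1 <= U * U * U) by (apply Nat.mul_le_mono_l; lia).
    assert (U * 1 <= U * U) by (apply Nat.mul_le_mono_l; lia).
    set (UU := U * U) in *. set (U3 := UU * U) in *.
    assert (20 * (d + k + kk + 4) * UU <= 20 * (d + k + kk + 4) * U3)
      by (apply Nat.mul_le_mono_l; lia).
    assert (U * (trial_cost M * UU) = trial_cost M * U3) by (unfold U3; ring).
    lia.
Qed.

(** * The exponential-time machine *)

(* [v] is delimited by flags: it will hold [n] in binary, and [idx] an index. *)
Definition parse_adv (v idx : list bool) : list bool := flagged v ++ false :: idx.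

Definition PARSE : cmd :=
  While 1 (mov 1 rIDX) (Pop 1 Skip (Push rV false) (Push rV true)).

Lemma PARSE_runs idx : forall v s, s 1 = parse_adv v idx ->
  runs PARSE s (3 * length v + 2 * length idx + 3)
    (upd (upd (upd s 1 []) rV (rev v ++ s rV)) rIDX (rev idx ++ s rIDX)).
Proof.
  know_nreg. induction v as [|b v IH]; intros s E.
  - eapply runs_weaken.
    + eapply runs_while_step; [lia|exact E|apply mov_runs; lia|].
      apply runs_while_end; [lia|now lookup].
    + lookup. simpl. lia.
    + lookup. simpl. store_ext.
  - eapply runs_weaken.
    + eapply runs_while_step with (s1 := upd (upd s 1 (parse_adv v idx)) rV (b :: s rV)) (B1 := 2);
        [lia|exact E| |].
      * apply runs_pop; [lia|]. lookup. cbn [hd_error sel tl app flagged flat_map].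
        eapply runs_weaken with (B := 1) (s1 := upd (upd s 1 (parse_adv v idx)) rV (b :: s rV));
          [|lia|reflexivity].
        replace (s rV) with (upd s 1 (parse_adv v idx) rV) by now lookup.
        rewrite upd_upd. destruct b; apply runs_push; lia.
      * apply IH. now lookup.
    + simpl. lia.
    + lookup. simpl. rewrite <- app_assoc. store_ext.
Qed.

Definition READ_LENGTH : cmd := While 0 (Push rM true) (Push rM true).

Lemma READM_runs : forall x s, s 0 = x ->
  runs READ_LENGTH s (2 * length x + 1) (upd (upd s 0 []) rM (repeat true (length x) ++ s rM)).
Proof.
  know_nreg. induction x as [|b x IH]; intros s E.
  - eapply runs_weaken; [apply runs_while_end; auto; lia|simpl; lia|]. simpl. store_ext.
  - eapply runs_weaken.
    + eapply runs_for_step; [lia|exact E|apply runs_push; lia|]. apply IH. now lookup.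
    + simpl. lia.
    + lookup. simpl. rewrite repeat_app_cons. store_ext.
Qed.

Definition strings_of (n : nat) : list (list bool) :=
  map (fun i => rev (bits n i)) (seq 0 (2 ^ n)).

Lemma concat_length_const {A} (l : list (list A)) m :
  (forall u, In u l -> length u = m) -> length (concat l) = length l * m.
Proof.
  induction l; simpl; intros H; auto. rewrite length_app, IHl by auto. rewrite H by auto. auto.
Qed.

Definition EXP_prep1 : cmd :=
  Seq READ_LENGTH (Seq PARSE (Seq ENUM (Seq (clear rSRC) (Seq (clear rV)
  (Seq (mov rCNT rN) (Pop rN Skip Skip Skip)))))).

Definition input_state (m n : nat) (idx : list bool) : store :=
  upd (upd (upd (fun _ => []) rM (repeat true m)) rIDX idx) rN (repeat true n).

Lemma EXP_prep1_runs x l n idx U : n < 2 ^ l ->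
  length x <= U -> n + 2 <= U -> l <= U -> length idx <= U ->
  runs EXP_prep1 (init_store x (parse_adv (rev (bits l n)) idx) []) (100 * (U * U))
    (input_state (length x) n (rev idx)).
Proof.
  know_nreg. intros Hn Ux Un Ul Ui. eapply runs_weaken.
  - eapply runs_seq; [apply READM_runs; reflexivity|]. cbn [init_store].
    eapply runs_seq; [apply PARSE_runs; lookup; reflexivity|]. lookup. cbn [init_store].
    rewrite rev_involutive, !app_nil_r.
    eapply runs_seq; [apply (ENUM_runs _ l n); lookup; auto|]. lookup. cbn [init_store].
    eapply runs_seq; [apply clear_runs; lia|].
    eapply runs_seq; [apply clear_runs; lia|].
    eapply runs_seq; [apply mov_runs; lia|].
    apply runs_pop; [lia|]. lookup. cbn [init_store]. rewrite !app_nil_r, rev_repeat_true.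
    cbn [hd_error sel repeat]. apply runs_skip.
  - lookup. rewrite !app_nil_r, !length_rev, bits_length, !repeat_length.
    rewrite (concat_length_const _ l).
    2:{ intros u Hu. apply in_map_iff in Hu as (i & <- & _). now rewrite length_rev, bits_length. }
    rewrite length_map, length_seq. 
    assert (S n * (11 * l + 20) <= U * (11 * U + 20)) by (apply Nat.mul_le_mono; lia).
    assert (S n * l <= U * U) by (apply Nat.mul_le_mono; lia).
    assert (U * 2 <= U * U) by (apply Nat.mul_le_mono_l; lia). cbn [init_store]. lia.
  - unfold input_state. lookup. apply functional_extensionality; intro z. unfold upd.
    repeat match goal with
      |- context [Nat.eqb ?u ?k] => destruct (Nat.eqb_spec u k); try lia
    end; auto; destruct z as [|[|[|]]]; try lia; reflexivity.
Qed.

Definition EXP_prep2 (k kA : nat) : cmd :=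
  Seq (Push rN true) (Seq (POLY rCLK k) (Seq (pushn rEXPO kA) (Seq (POWER rEXPO2 rN rEXPO)
  (Seq (Pop rN Skip Skip Skip) (Seq (pushn rBASE 2) (Seq (POWER rCLKA rBASE rEXPO2)
  (Seq (pushn rCLKA kA) (clear rBASE)))))))).

Definition clock_state (m n : nat) (idx : list bool) (k kA : nat) : store :=
  upd (upd (input_state m n idx) rCLK (repeat true (poly_bound k n))) rCLKA (repeat true (exp_bound kA n)).

Lemma EXP_prep2_runs m n idx k kA U :
  n + 2 <= U -> (n + 2) ^ k <= U -> (n + 2) ^ kA <= U -> 3 ^ (S n ^ kA) <= U ->
  runs (EXP_prep2 k kA) (input_state m n idx) (20 * (k + kA + 4) * (U * U)) (clock_state m n idx k kA).
Proof.
  know_nreg. intros Un Uk UkA Uz. set (z := S n ^ kA) in *. eapply runs_weaken.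
  - eapply runs_seq; [apply runs_push; lia|].
    eapply runs_seq; [apply (POLY_runs rCLK k _ n); unfold user; try lia; reflexivity|].
    eapply runs_seq; [apply pushn_runs; lia|].
    eapply runs_seq.
    { apply (POWER_runs rEXPO2 rN rEXPO _ (S n) kA); try lia; lookup; auto.
      unfold input_state. lookup. rewrite app_nil_r. apply repeat_length. }
    eapply runs_seq.
    { apply runs_pop; [lia|]. lookup. unfold input_state; lookup. cbn [hd_error sel tl]. apply runs_skip. }
    eapply runs_seq; [apply pushn_runs; lia|].
    eapply runs_seq.
    { apply (POWER_runs rCLKA rBASE rEXPO2 _ 2 z); try lia; lookup; auto. apply repeat_length. }
    eapply runs_seq; [apply pushn_runs; lia|]. apply clear_runs; lia.
  - lookup. rewrite app_nil_r, repeat_length. replace (S (S n)) with (n + 2) by lia.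
    assert ((n + 2) ^ k * (5 * n + 10) <= U * (5 * U)) by (apply Nat.mul_le_mono; lia).
    assert ((n + 2) ^ kA * (5 * S n + 5) <= U * (5 * U)) by (apply Nat.mul_le_mono; lia).
    assert (z <= U).
    { etransitivity; [|exact UkA]. apply Nat.pow_le_mono_l; lia. }
    assert (z * (3 ^ z * (5 * 2 + 5) + 3) <= U * (U * 15 + 3)) by (apply Nat.mul_le_mono; lia).
    assert (U * 2 <= U * U) by (apply Nat.mul_le_mono_l; lia).
    set (a1 := (n + 2) ^ k * (5 * n + 10)) in *. set (a2 := (n + 2) ^ kA * (5 * S n + 5)) in *.
    set (UU := U * U) in *.
    assert (k * (a1 + 5) <= k * (11 * UU)) by (apply Nat.mul_le_mono_l; lia).
    assert (kA * (a2 + 3) <= kA * (11 * UU)) by (apply Nat.mul_le_mono_l; lia).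
    assert (k * 1 <= k * UU) by (apply Nat.mul_le_mono_l; lia).
    assert (kA * 1 <= kA * UU) by (apply Nat.mul_le_mono_l; lia).
    nia.
  - lookup. rewrite <- repeat_app. fold (exp_bound kA n). unfold clock_state, input_state. store_ext.
Qed.

Definition PAIR_body (MA : TM) : cmd :=
  Seq (takeblk rSRC rN rY) (Seq (dup rY rTMP rPAIRS) (Seq (mov rTMP rY)
  (Seq (EVAL MA rY rW rCLKA rPAIRS) (clear rY)))).

Definition EXP_pairs (MA : TM) : cmd :=
  Seq (copy rN rV rTMP) (Seq ENUM (Seq (clear rV) (While rCNT (PAIR_body MA) (PAIR_body MA)))).

Lemma PAIR_loop_runs MA n T U : n <= U -> T <= U -> 1 <= U ->
  forall xs s, (forall y, In y xs -> length y = n) -> scratch s -> s rW = [] ->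
  length (s rN) = n -> length (s rCLKA) = T -> length (s rCNT) = length xs -> s rSRC = concat xs ->
  runs (While rCNT (PAIR_body MA) (PAIR_body MA)) s (length xs * ((eval_cost MA * 3 + 30) * U) + 1)
    (upd (upd (upd s rCNT []) rSRC [])
       rPAIRS (pairs_code (rev (map (fun y => (y, accepts_b MA y [] [] T)) xs)) ++ s rPAIRS)).
Proof.
  know_nreg. intros Un UT U1. induction xs as [|y xs IH]; intros s Hxs Hs EW EN EC Ecnt Esrc.
  - destruct (s rCNT) eqn:E; [|discriminate].
    eapply runs_weaken; [apply runs_while_end; auto; lia|simpl; lia|].
    simpl in *. store_ext.
  - destruct (s rCNT) as [|c cnt] eqn:E; [discriminate|]. simpl in Ecnt, Esrc.
    destruct Hs as (S1 & S2 & S3 & S4).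
    assert (Hy : length y = n) by (apply Hxs; simpl; auto).
    set (s1 := upd (upd (upd s rCNT cnt) rSRC (concat xs))
                 rPAIRS (accepts_b MA y [] [] T :: y ++ s rPAIRS)).
    eapply runs_weaken.
    + eapply runs_for_step with (s1 := s1) (B1 := (eval_cost MA * 3 + 29) * U); [lia|exact E| |].
      * unfold PAIR_body. eapply runs_weaken.
        { eapply runs_seq; [apply takeblk_runs with (u := y) (rest := concat xs); try lia; lookup; auto;
            try lia; apply S1; lia|].
          eapply runs_seq; [apply dup_runs; lia|].
          eapply runs_seq; [apply mov_runs; lia|].
          eapply runs_seq; [apply EVAL_runs with (x := y) (w := []); unfold user; try lia; lookup; auto|].
          - intros i Hi. lookup. destruct (Nat.eq_dec i rTMP); [lia|]. lookup. apply S1; lia.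
          - rewrite (S1 rTMP), !app_nil_r by lia. rewrite S2, app_nil_r, rev_involutive. auto.
          - apply clear_runs; lia. }
        { lookup. rewrite S2, (S1 rTMP), !app_nil_r, !length_rev, Hy, EC by lia.
          simpl length. clear IH. nia. }
        { unfold s1. lookup. rewrite S2, (S1 rTMP), !app_nil_r, !rev_involutive, EC by lia.
          store_ext. symmetry. apply S1; lia. }
      * apply IH; unfold s1; lookup; auto.
        { intros z Hz. apply Hxs. simpl; auto. }
        repeat split; lookup; auto. intros i Hi. lookup. apply S1; lia.
    + simpl length. nia.
    + unfold s1. lookup. simpl. unfold pairs_code. rewrite flat_map_app. simpl.
      rewrite <- app_assoc. simpl. rewrite app_nil_r. store_ext.
Qed.

Lemma strings_of_length n y : In y (strings_of n) -> length y = n.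
Proof. intros H. apply in_map_iff in H as (i & <- & _). now rewrite length_rev, bits_length. Qed.

Definition pairs_of (MA : TM) (n T : nat) : list (list bool * bool) :=
  rev (map (fun y => (y, accepts_b MA y [] [] T)) (strings_of n)).

Lemma EXP_pairs_runs MA m n idx k kA U :
  2 ^ n * (n + 1) <= U -> n + 1 <= U -> exp_bound kA n <= U ->
  runs (EXP_pairs MA) (clock_state m n idx k kA) ((eval_cost MA * 3 + 100) * (U * U))
    (upd (clock_state m n idx k kA) rPAIRS (pairs_code (pairs_of MA n (exp_bound kA n)))).
Proof.
  know_nreg. intros U0 U1 U2.
  assert (H0 := Nat.pow_nonzero 2 n). assert (H2 : 2 ^ n <= U) by nia.
  assert (E2 : S (2 ^ n - 1) = 2 ^ n) by lia.
  eapply runs_weaken.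
  - eapply runs_seq; [apply copy_runs; try lia; reflexivity|].
    eapply runs_seq.
    { apply (ENUM_runs _ n (2 ^ n - 1)); try lia; try reflexivity.
      lookup. rewrite bits_ones. unfold clock_state, input_state; lookup. apply app_nil_r. }
    rewrite E2. fold (strings_of n).
    eapply runs_seq; [apply clear_runs; lia|].
    apply (PAIR_loop_runs MA n (exp_bound kA n) U) with (xs := strings_of n); try lia.
    + apply strings_of_length.
    + repeat split; unfold clock_state, input_state; lookup; auto. intros i Hi. now lookup.
    + reflexivity.
    + unfold clock_state, input_state; lookup. apply repeat_length.
    + unfold clock_state, input_state; lookup. apply repeat_length.
    + unfold clock_state, input_state; lookup. rewrite app_nil_r, repeat_length. unfold strings_of.
      now rewrite length_map, length_seq.
    + unfold clock_state, input_state; lookup. apply app_nil_r.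
  - unfold clock_state, input_state; lookup. rewrite !repeat_length. unfold strings_of. rewrite length_map, length_seq.
    assert (2 ^ n * (11 * n + 20) <= 31 * U) by nia.
    assert (2 ^ n * ((eval_cost MA * 3 + 30) * U) <= U * ((eval_cost MA * 3 + 30) * U))
      by (apply Nat.mul_le_mono_r; auto).
    assert (U * 1 <= U * U) by (apply Nat.mul_le_mono_l; lia). nia.
  - unfold clock_state, input_state; lookup. rewrite !app_nil_r. unfold pairs_of. store_ext.
Qed.

Definition EMIT : cmd :=
  Seq (mov rW rTMP) (While rTMP (Seq (Push rOUT true) (Push rOUT false))
                               (Seq (Push rOUT true) (Push rOUT true))).

Lemma EMIT_runs s w : s rW = rev w -> s rTMP = [] ->
  runs EMIT s (5 * length w + 2) (upd (upd s rW []) rOUT (rev (flagged w) ++ s rOUT)).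
Proof.
  know_nreg. intros EW ET.
  assert (G : forall l s, s rTMP = l -> runs (While rTMP (Seq (Push rOUT true) (Push rOUT false))
     (Seq (Push rOUT true) (Push rOUT true))) s (3 * length l + 1)
     (upd (upd s rTMP []) rOUT (rev (flagged l) ++ s rOUT))).
  { clear. know_nreg. induction l as [|b l IH]; intros s E.
    - eapply runs_weaken; [apply runs_while_end; auto; lia|simpl; lia|]. simpl. store_ext.
    - eapply runs_weaken.
      + eapply runs_while_step with (B1 := 2) (s1 := upd (upd s rTMP l) rOUT (b :: true :: s rOUT));
          [lia|exact E| |].
        * destruct b; (eapply runs_weaken; [eapply runs_seq; apply runs_push; lia|lia|];
          lookup; rewrite upd_upd; reflexivity).
        * apply IH. now lookup.
      + simpl. lia.
      + lookup. simpl. rewrite <- !app_assoc. simpl. store_ext. }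
  eapply runs_weaken.
  - eapply runs_seq; [apply mov_runs; lia|apply G; reflexivity].
  - lookup. rewrite EW, ET, app_nil_r, !length_rev. lia.
  - lookup. rewrite EW, ET, app_nil_r, rev_involutive. store_ext.
Qed.

Definition EXP_body (M : TM) : cmd :=
  Seq (takeblk rSRC rM rW) (Seq (CHECK M)
    (Pop rBAD
      (Seq (dec rIDX rGO) (Pop rGO (Seq EMIT (clear rCNT)) (clear rW) (clear rW)))
      (Seq (clear rBAD) (clear rW)) (Seq (clear rBAD) (clear rW)))).

Fixpoint pick (test : list bool -> bool) (idx : list bool) (ws : list (list bool))
    : option (list bool) :=
  match ws with
  | [] => None
  | w :: ws =>
      if test w then
        (if fst (pred_bits idx) then pick test (snd (pred_bits idx)) ws else Some w)
      else pick test idx ws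
  end.

Lemma pick_nth test L : forall ws i, i < 2 ^ L ->
  pick test (bits L i) ws = nth_error (filter test ws) i.
Proof.
  induction ws as [|w ws IH]; intros i Hi; simpl.
  - now destruct i.
  - destruct (test w); auto. destruct i as [|i].
    + now rewrite pred_bits_0.
    + rewrite pred_bits_S by auto. simpl. apply IH. lia.
Qed.

Lemma EXP_loop_runs M ps n m p U :
  (forall q, In q ps -> length (fst q) = n) ->
  length (pairs_code ps) <= U -> n <= U -> m <= U -> p <= U -> 1 <= U ->
  forall ws s, (forall w, In w ws -> length w = m) -> length ws <= U ->
  scratch s -> length (s rCNT) = length ws -> s rSRC = concat ws ->
  length (s rN) = n -> length (s rM) = m -> length (s rIDX) <= U ->
  length (s rCLK) = p -> s rPAIRS = pairs_code ps -> s rW = [] -> s rBAD = [] -> s rOUT = [] ->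
  s rGO = [] ->
  exists s', runs (While rCNT (EXP_body M) (EXP_body M)) s
       (length ws * ((check_cost M + 60) * (U * U)) + 1) s' /\
    s' rOUT = rev (flagged
      (match pick (fun w => consistent (fun y => accepts_b M y w [] p) ps) (s rIDX) ws
       with Some w => w | None => [] end)).
Proof.
  know_nreg. intros Hps Ue Ux Um Up U1. induction ws as [|w ws IH];
    intros s Hws Ucnt Hs Ecnt Esrc EN EM Eidx EC EP EW EB EO EG;
    (destruct (s rCNT) as [|c cnt] eqn:E; try discriminate).
  - exists s. split; [apply runs_while_end; auto; lia|]. simpl. auto.
  - simpl in Ucnt, Ecnt, Esrc.
    assert (Hs0 := Hs). destruct Hs0 as (S1 & S2 & S3 & S4).
    assert (Hw : length w = m) by (apply Hws; simpl; auto).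
    assert (Hps2 : length ps <= U).
    { eapply Nat.le_trans; [|exact Ue]. clear. induction ps as [|[y b] ps IH]; simpl; [auto|].
      rewrite length_app. lia. }
    set (s1 := upd (upd (upd s rCNT cnt) rSRC (concat ws)) rW (rev w)).
    assert (R1 : runs (takeblk rSRC rM rW) (upd s rCNT cnt) (8 * U + 3) s1).
    { eapply runs_weaken; [apply takeblk_runs with (u := w) (rest := concat ws); try lia; lookup|..].
      - apply S1; lia.
      - apply S1; lia.
      - auto.
      - lia.
      - lia.
      - lookup. rewrite EW, app_nil_r. reflexivity. }
    set (bd := bads (fun y => accepts_b M y w [] p) ps []).
    assert (Hbd : length bd <= U).
    { eapply Nat.le_trans; [apply bads_length|]. simpl. lia. }
    assert (R2 : runs (CHECK M) s1 (check_cost M * (U * U)) (upd s1 rBAD bd)).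
    { eapply runs_weaken; [apply (CHECK_runs M s1 ps w U)|auto|]; unfold s1; lookup; auto; try lia.
      - repeat split; lookup; auto. intros i Hi. lookup. apply S1; lia.
      - intros q Hq. lookup. rewrite EN. auto.
      - rewrite EB, EC. reflexivity. }
    assert (UU : U * 1 <= U * U) by (apply Nat.mul_le_mono_l; lia).
    assert (Ucnt2 : length cnt <= U) by lia.
    simpl pick.
    destruct (consistent (fun y => accepts_b M y w [] p) ps) eqn:Econ.
    + apply bads_consistent in Econ. fold bd in Econ.
      assert (R3 : runs (dec rIDX rGO) (upd s1 rBAD []) (6 * U + 6)
        (upd (upd (upd s1 rBAD []) rIDX (snd (pred_bits (s rIDX)))) rGO (flag (fst (pred_bits (s rIDX)))))).
      { eapply runs_weaken; [apply dec_runs; try lia; unfold s1; lookup; apply S1; lia|..];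
          unfold s1; lookup.
        - lia.
        - rewrite EG, app_nil_r. auto. }
      destruct (fst (pred_bits (s rIDX))) eqn:Ef.
      * destruct (IH (upd (upd (upd s1 rBAD []) rIDX (snd (pred_bits (s rIDX)))) rW []))
          as (s' & R' & O').
        all: try (unfold s1; lookup; auto; fail).
        { intros z Hz. apply Hws. simpl; auto. }
        { lia. }
        { repeat split; unfold s1; lookup; auto. intros i Hi; lookup. apply S1; lia. }
        { lookup. rewrite pred_bits_length. auto. }
        exists s'. split; [|unfold s1 in O'; revert O'; lookup; auto].
        eapply runs_weaken; [eapply runs_for_step; [lia|exact E| |exact R']| |reflexivity].
        { eapply runs_seq; [exact R1|]. eapply runs_seq; [exact R2|].
          apply runs_pop; [lia|]. rewrite upd_same, upd_upd, Econ. cbn [hd_error sel tl].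
          eapply runs_seq; [exact R3|]. apply runs_pop; [lia|]. lookup. cbn [flag hd_error sel tl].
          eapply runs_weaken; [apply clear_runs; lia|reflexivity|]. unfold s1. 
          rewrite <- EG at 2. store_ext. }
        { lookup. unfold s1; lookup. rewrite length_rev, Hw. simpl length. clear IH R1 R2 R'. nia. }
      * eexists. split.
        { eapply runs_weaken; [eapply runs_for_step; [lia|exact E| |
             apply runs_while_end with (r := rCNT); [lia|]]| |reflexivity].
          - eapply runs_seq; [exact R1|]. eapply runs_seq; [exact R2|].
            apply runs_pop; [lia|]. rewrite upd_same, upd_upd, Econ. cbn [hd_error sel tl].
            eapply runs_seq; [exact R3|]. apply runs_pop; [lia|]. lookup. cbn [flag hd_error sel tl].
            eapply runs_seq; [apply EMIT_runs with (w := w); unfold s1; lookup; auto; apply S1; lia|].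
            apply clear_runs; lia.
          - now lookup.
          - lookup. unfold s1; lookup. rewrite Hw. simpl length. clear IH R1 R2 R3. nia. }
        { lookup. unfold s1; lookup. rewrite EO, app_nil_r. auto. }
    + assert (Hne : bd <> []).
      { intro E'. apply bads_consistent in E'. congruence. }
      destruct (IH (upd (upd s1 rBAD []) rW [])) as (s' & R' & O').
      all: try (unfold s1; lookup; auto; fail).
      { intros z Hz. apply Hws. simpl; auto. }
      { lia. }
      { repeat split; unfold s1; lookup; auto. intros i Hi; lookup. apply S1; lia. }
      exists s'. split; [|unfold s1 in O'; revert O'; lookup; auto].
      eapply runs_weaken; [eapply runs_for_step; [lia|exact E| |exact R']| |reflexivity].
      * eapply runs_seq; [exact R1|]. eapply runs_seq; [exact R2|].
        assert (RF : runs (Seq (clear rBAD) (clear rW)) (upd s1 rBAD (tl bd)) (4 * U + 2)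
           (upd (upd s1 rBAD []) rW [])).
        { eapply runs_weaken; [eapply runs_seq; apply clear_runs; lia| |].
          - lookup. unfold s1; lookup. rewrite length_rev, Hw. destruct bd; simpl in *; lia.
          - store_ext. }
        apply runs_pop; [lia|]. rewrite upd_same, upd_upd.
        destruct bd as [|[|] bd]; [congruence|exact RF|exact RF].
      * simpl length. clear IH R1 R2 R'. nia.
Qed.

Definition clear_all (l : list nat) : cmd := fold_right (fun r c => Seq (clear r) c) Skip l.

Lemma clear_all_runs Z : forall l s, (forall r, In r l -> r < nreg) ->
  (forall r, In r l -> length (s r) <= Z) ->
  exists s', runs (clear_all l) s (length l * (2 * Z + 1) + 1) s' /\
    (forall r, In r l -> s' r = []) /\ (forall r, ~ In r l -> s' r = s r).
Proof.
  induction l as [|a l IH]; intros s Hl Hz.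
  - exists s. split; [apply runs_skip|]. simpl. split; [tauto|auto].
  - destruct (IH (upd s a [])) as (s' & R & H1 & H2).
    + intros. apply Hl. simpl; auto.
    + intros r Hr. unfold upd. destruct (Nat.eqb_spec r a); simpl; [lia|]. apply Hz. simpl; auto.
    + exists s'. split; [|split].
      * eapply runs_weaken; [eapply runs_seq; [apply clear_runs; apply Hl; simpl; auto|exact R]|..];
          auto. specialize (Hz a (or_introl eq_refl)). simpl length. lia.
      * intros r [<-|Hr]; auto. destruct (in_dec Nat.eq_dec a l) as [Hi|Hi]; auto.
        rewrite H2 by auto. apply upd_same.
      * intros r Hr. simpl in Hr. rewrite H2 by tauto. apply upd_other. intro; subst; tauto.
Qed.

Lemma exec_high c s t s' : exec c s t s' -> forall i, nreg <= i -> s' i = s i.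
Proof.
  induction 1; intros i Hi; auto.
  - apply upd_other. lia.
  - rewrite IHexec by auto. apply upd_other. lia.
  - rewrite IHexec2, IHexec1; auto.
  - rewrite IHexec2, IHexec1 by auto. apply upd_other. lia.
Qed.

Definition EXP_main (M MA : TM) (k kA : nat) : cmd :=
  Seq EXP_prep1 (Seq (EXP_prep2 k kA) (Seq (EXP_pairs MA)
  (Seq (Seq (copy rM rV rTMP) (Seq ENUM (clear rV)))
  (Seq (While rCNT (EXP_body M) (EXP_body M)) (Push rOUT false))))).

Definition EXP_cmd (M MA : TM) (k kA : nat) : cmd :=
  Seq (EXP_main M MA k kA) (clear_all (seq 3 11 ++ seq 15 25)).

Definition EXP_cost (M MA : TM) (k kA : nat) : nat :=
  100 * (20 * (k + kA + 4) + eval_cost MA * 3 + check_cost M + 400).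

Theorem EXP_runs M MA k kA x l n idx U :
  n < 2 ^ l -> l <= U -> length idx <= U -> n + 2 <= U ->
  (n + 2) ^ k + k <= U -> (n + 2) ^ kA <= U -> 3 ^ (S n ^ kA) + kA <= U ->
  2 ^ n * (n + 1) <= U -> 2 ^ length x * (length x + 1) <= U ->
  exists s', runs (EXP_cmd M MA k kA) (init_store x (parse_adv (rev (bits l n)) idx) [])
      (EXP_cost M MA k kA * (U * U * U)) s' /\
    (forall i, 3 <= i -> i <> rOUT -> s' i = []) /\
    rev (s' rOUT) = flagged
      (match pick (fun w => consistent (fun y => accepts_b M y w [] (poly_bound k n))
                              (pairs_of MA n (exp_bound kA n)))
               (rev idx) (strings_of (length x))
       with Some w => w | None => [] end) ++ [false].
Proof.
  know_nreg. intros Hn Ul Ui Un Uk UkA Uz U2n U2m. set (m := length x) in *.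
  assert (Hm0 := Nat.pow_nonzero 2 m). assert (Hn0 := Nat.pow_nonzero 2 n).
  assert (Um : m + 1 <= U) by nia. assert (U2m' : 2 ^ m <= U) by nia.
  assert (Ue : exp_bound kA n <= U).
  { unfold exp_bound. assert (2 ^ (S n ^ kA) <= 3 ^ (S n ^ kA)) by (apply Nat.pow_le_mono_l; lia).
    lia. }
  assert (Up : poly_bound k n <= U).
  { unfold poly_bound. assert (S n ^ k <= (n + 2) ^ k) by (apply Nat.pow_le_mono_l; lia). lia. }
  assert (Epairs : forall q, In q (pairs_of MA n (exp_bound kA n)) -> length (fst q) = n).
  { intros q Hq. apply in_rev, in_map_iff in Hq as (y & <- & Hy). now apply strings_of_length. }
  assert (Lpairs : length (pairs_code (pairs_of MA n (exp_bound kA n))) <= U).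
  { etransitivity; [|exact U2n]. unfold pairs_code. rewrite flat_map_concat_map.
    rewrite (concat_length_const _ (n + 1)).
    - rewrite length_map. unfold pairs_of, strings_of.
      rewrite length_rev, !length_map, length_seq. auto.
    - intros u Hu. apply in_map_iff in Hu as (q & <- & Hq). simpl. rewrite Epairs; auto. lia. }
  set (ps := pairs_of MA n (exp_bound kA n)) in *.
  assert (E2 : S (2 ^ m - 1) = 2 ^ m) by lia.
  set (s3 := upd (clock_state m n (rev idx) k kA) rPAIRS (pairs_code ps)).
  set (s4 := upd (upd (upd s3 rV []) rSRC (concat (strings_of m))) rCNT (repeat true (2 ^ m))).
  assert (UU1 : U * 1 <= U * U) by (apply Nat.mul_le_mono_l; lia).
  assert (UU2 : U * U * 1 <= U * U * U) by (apply Nat.mul_le_mono_l; lia).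
  assert (R4 : runs (Seq (copy rM rV rTMP) (Seq ENUM (clear rV))) s3 (100 * (U * U)) s4).
  { eapply runs_weaken.
    - eapply runs_seq; [apply copy_runs; try lia; reflexivity|].
      eapply runs_seq; [|apply clear_runs; lia].
      apply (ENUM_runs _ m (2 ^ m - 1)); try lia; try reflexivity.
      lookup. rewrite bits_ones. unfold s3, clock_state, input_state; lookup. apply app_nil_r.
    - rewrite E2. unfold s3, clock_state, input_state; lookup. rewrite !repeat_length.
      assert (2 ^ m * (11 * m + 20) <= 31 * U) by nia. lia.
    - rewrite E2. fold (strings_of m). unfold s4, s3, clock_state, input_state; lookup. rewrite !app_nil_r. store_ext. }
  destruct (EXP_loop_runs M ps n m (poly_bound k n) U Epairs Lpairs) with
    (ws := strings_of m) (s := s4) as (s5 & R5 & O5); try lia.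
  all: try (unfold s4, s3, clock_state, input_state; lookup; rewrite ?repeat_length; auto; fail).
  { apply strings_of_length. }
  { unfold strings_of. now rewrite length_map, length_seq. }
  { repeat split. intros i Hi. unfold s4, s3, clock_state, input_state. lookup. auto. }
  { unfold s4; lookup. unfold strings_of. now rewrite repeat_length, length_map, length_seq. }
  { unfold s4, s3, clock_state, input_state; lookup. rewrite length_rev. auto. }
  replace (s4 rIDX) with (rev idx) in O5 by reflexivity.
  unfold strings_of in R5 at 1. rewrite length_map, length_seq in R5.
  set (K := 20 * (k + kA + 4) + eval_cost MA * 3 + check_cost M + 400).
  assert (R6 : runs (EXP_main M MA k kA) (init_store x (parse_adv (rev (bits l n)) idx) [])
      (K * (U * U * U)) (upd s5 rOUT (false :: s5 rOUT))).
  { eapply runs_weaken.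
    - eapply runs_seq; [apply EXP_prep1_runs with (U := U); fold m; auto; lia|]. fold m.
      eapply runs_seq; [apply EXP_prep2_runs with (U := U); lia|].
      eapply runs_seq; [apply EXP_pairs_runs with (U := U); lia|].
      eapply runs_seq; [exact R4|]. eapply runs_seq; [exact R5|]. apply runs_push; lia.
    - assert (2 ^ m * ((check_cost M + 60) * (U * U)) <= U * ((check_cost M + 60) * (U * U)))
        by (apply Nat.mul_le_mono_r; auto).
      unfold K. set (UU := U * U) in *. set (U3 := UU * U) in *.
      assert (U * ((check_cost M + 60) * UU) = (check_cost M + 60) * U3) by (unfold U3; ring).
      assert (HU3 : forall c, c * UU <= c * U3) by (intro; apply Nat.mul_le_mono_l; lia).
      assert (Ha := HU3 (20 * (k + kA + 4))). assert (Hb := HU3 (eval_cost MA * 3 + 100)).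
      lia.
    - reflexivity. }
  destruct (clear_all_runs (K * (U * U * U)) (seq 3 11 ++ seq 15 25)
     (upd s5 rOUT (false :: s5 rOUT))) as (s' & R7 & C1 & C2).
  { intros r Hr. apply in_app_iff in Hr as [Hr|Hr]; apply in_seq in Hr; lia. }
  { intros r Hr. assert (H := runs_length _ _ _ _ r R6).
    replace (length (init_store x (parse_adv (rev (bits l n)) idx) [] r)) with 0 in H; [lia|].
    apply in_app_iff in Hr as [Hr|Hr]; apply in_seq in Hr; destruct r as [|[|[|]]]; simpl; lia. }
  assert (R : runs (EXP_cmd M MA k kA) (init_store x (parse_adv (rev (bits l n)) idx) [])
      (EXP_cost M MA k kA * (U * U * U)) s').
  { eapply runs_weaken; [eapply runs_seq; [exact R6|exact R7]| |reflexivity].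
    unfold EXP_cost. fold K. rewrite length_app, !length_seq.
    assert (1 <= K * (U * U * U)) by (unfold K; nia). lia. }
  exists s'. split; [exact R|]. split.
  - intros i Hi1 Hi2. destruct (Nat.lt_ge_cases i nreg).
    + apply C1. apply in_app_iff. rewrite !in_seq. lia.
    + destruct R as (t & _ & He). rewrite (exec_high _ _ _ _ He i) by auto.
      destruct i as [|[|[|]]]; simpl; auto; lia.
  - rewrite C2 by (rewrite in_app_iff, !in_seq; lia). lookup. simpl. rewrite O5, rev_involutive.
    reflexivity.
Qed.

(** * Counting *)

Lemma all_strings_length m : length (all_strings m) = 2 ^ m.
Proof. induction m; simpl; auto. rewrite length_app, !length_map. lia. Qed.

Lemma in_all_strings m : forall w, In w (all_strings m) <-> length w = m.
Proof.
  induction m; intros w; simpl.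
  - destruct w; simpl; split; intros H; auto; [destruct H; [discriminate|tauto]|discriminate].
  - rewrite in_app_iff, !in_map_iff. split.
    + intros [(u & <- & H)|(u & <- & H)]; apply IHm in H; simpl; lia.
    + destruct w as [|[|] w]; simpl; intros H; [discriminate| |];
        injection H as H; apply IHm in H; [right|left]; eauto.
Qed.

Lemma all_strings_NoDup m : NoDup (all_strings m).
Proof.
  induction m; simpl; [repeat constructor; simpl; tauto|].
  apply NoDup_app.
  - apply FinFun.Injective_map_NoDup; auto. intros u v H. now injection H.
  - apply FinFun.Injective_map_NoDup; auto. intros u v H. now injection H.
  - intros w H1 H2. apply in_map_iff in H1 as (u & <- & _), H2 as (v & H2 & _). discriminate.
Qed.

Lemma bits_surj : forall w, exists i, i < 2 ^ length w /\ bits (length w) i = w.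
Proof.
  induction w as [|b w (i & Hi & E)]; [exists 0; simpl; auto|].
  exists (if b then S (2 * i) else 2 * i). simpl length.
  rewrite Nat.pow_succ_r'. split; [destruct b; lia|].
  cbn [bits]. destruct b.
  - rewrite Nat.div2_succ_double, Nat.odd_succ, Nat.even_mul, E. reflexivity.
  - rewrite Nat.div2_double, Nat.odd_mul, E. reflexivity.
Qed.

Lemma strings_of_all m w : length w = m -> In w (strings_of m).
Proof.
  intros H. destruct (bits_surj (rev w)) as (i & Hi & E). rewrite length_rev, H in *.
  apply in_map_iff. exists i. rewrite E, rev_involutive, in_seq. split; auto. lia.
Qed.

Lemma strings_of_NoDup m : NoDup (strings_of m).
Proof.
  apply NoDup_incl_NoDup with (all_strings m).
  - apply all_strings_NoDup.
  - unfold strings_of. rewrite length_map, length_seq, all_strings_length. auto.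
  - intros w Hw. apply strings_of_all. now apply in_all_strings.
Qed.

Lemma filter_length_mono {A} (P Q : A -> bool) l :
  (forall u, In u l -> P u = true -> Q u = true) ->
  length (filter P l) <= length (filter Q l).
Proof.
  induction l as [|a l IH]; simpl; intros H; auto.
  assert (IH' := IH (fun u Hu => H u (or_intror Hu))).
  destruct (P a) eqn:E.
  - rewrite (H a); auto. simpl. lia.
  - destruct (Q a); simpl; lia.
Qed.

Lemma filter_filter {A} (P Q : A -> bool) l :
  filter Q (filter P l) = filter (fun u => P u && Q u) l.
Proof.
  induction l as [|a l IH]; simpl; auto.
  destruct (P a); simpl; [destruct (Q a)|]; rewrite IH; auto.
Qed.

Lemma strings_of_count P m :
  length (filter P (strings_of m)) = length (filter P (all_strings m)).
Proof.
  apply Nat.le_antisymm; apply NoDup_incl_length; try apply NoDup_filter;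
    try apply strings_of_NoDup; try apply all_strings_NoDup;
    intros w Hw; apply filter_In in Hw as [H1 H2]; apply filter_In; split; auto.
  - apply in_all_strings. now apply strings_of_length.
  - apply strings_of_all. now apply in_all_strings.
Qed.

Lemma filter_map_length {A B} (P : B -> bool) (f : A -> B) l :
  length (filter P (map f l)) = length (filter (fun u => P (f u)) l).
Proof. induction l; simpl; auto. destruct (P (f a)); simpl; auto. Qed.

Lemma count_split m t : forall P,
  length (filter P (all_strings (m + t))) =
  list_sum (map (fun u => length (filter (fun v => P (u ++ v)) (all_strings t))) (all_strings m)).
Proof.
  induction m; intros P; simpl.
  - auto.
  - rewrite filter_app, length_app, !filter_map_length, map_app, list_sum_app, !map_map, !IHm.
    auto.
Qed.

Lemma sum_cases {A} (T V : A -> bool) a c l :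
  list_sum (map (fun u => if T u then (if V u then a else 0) else c) l) =
  a * length (filter (fun u => T u && V u) l) + c * length (filter (fun u => negb (T u)) l).
Proof.
  induction l as [|u l IH]; simpl; [lia|]. rewrite IH.
  destruct (T u), (V u); simpl; lia.
Qed.

Lemma filter_negb_length {A} (T : A -> bool) l :
  length (filter T l) + length (filter (fun u => negb (T u)) l) = length l.
Proof. induction l as [|u l IH]; simpl; auto. destruct (T u); simpl; lia. Qed.

Lemma filter_const {A} (b : bool) (l : list A) :
  length (filter (fun _ => b) l) = if b then length l else 0.
Proof. induction l; destruct b; simpl; auto. Qed.

Definition hits (test val : list bool -> bool) (m K : nat) (b : bool) (r : list bool) : bool :=
  match first_hit test val m K r with Some v => eqb v b | None => false end.

Lemma hits_count test val m K b rest : 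
  let g := length (filter test (all_strings m)) in
  let h := length (filter (fun w => negb (test w)) (all_strings m)) in
  3 * g <= 4 * length (filter (fun w => test w && eqb (val w) b) (all_strings m)) ->
  3 * 2 ^ (K * m + rest) <=
  4 * length (filter (hits test val m K b) (all_strings (K * m + rest))) + 3 * h ^ K * 2 ^ rest.
Proof.
  intros g h Hs. set (s := length (filter (fun w => test w && eqb (val w) b) (all_strings m))) in *.
  assert (Hgh : g + h = 2 ^ m) by (unfold g, h; now rewrite filter_negb_length, all_strings_length).
  induction K as [|K IH].
  - simpl. lia.
  - replace (S K * m + rest) with (m + (K * m + rest)) by (simpl; lia).
    set (t := K * m + rest) in *. rewrite count_split.
    set (q := length (filter (hits test val m K b) (all_strings t))) in *.
    replace (list_sum _) with (2 ^ t * s + q * h).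
    2:{ unfold s, h. rewrite <- sum_cases. f_equal. apply map_ext_in. intros u Hu.
        apply in_all_strings in Hu.
        assert (E : forall v, hits test val m (S K) b (u ++ v) =
           if test u then eqb (val u) b else hits test val m K b v).
        { intros v. unfold hits. simpl.
          rewrite firstn_app, skipn_app, Hu, Nat.sub_diag, <- Hu, firstn_all, skipn_all.
          simpl. rewrite app_nil_r. destruct (test u); auto. }
        destruct (test u).
        - erewrite filter_ext by exact E. rewrite filter_const, all_strings_length.
          now destruct (eqb (val u) b).
        - erewrite filter_ext by exact E. reflexivity. }
    rewrite Nat.pow_add_r, Nat.pow_succ_r'. rewrite <- Hgh.
    assert (H1 : h * (3 * 2 ^ t) <= h * (4 * q + 3 * h ^ K * 2 ^ rest)) by (apply Nat.mul_le_mono_l; auto).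
    assert (H2 : (3 * g) * 2 ^ t <= (4 * s) * 2 ^ t) by (apply Nat.mul_le_mono_r; auto).
    nia.
Qed.

Lemma bernoulli g h K : h ^ K * (g + h + K * g) <= (g + h) ^ S K.
Proof.
  induction K; simpl; [lia|]. simpl in IHK.
  assert (H : h * (h ^ K * (g + h + K * g)) <= h * ((g + h) * (g + h) ^ K))
    by (apply Nat.mul_le_mono_l; auto).
  assert (H2 : h ^ K * h * (g + h + (g + K * g)) <= h ^ K * (g + h) * (g + h + K * g)).
  { rewrite <- !Nat.mul_assoc. apply Nat.mul_le_mono_l. nia. }
  assert (H3 : (g + h) * (h ^ K * (g + h + K * g)) <= (g + h) * ((g + h) * (g + h) ^ K))
    by (apply Nat.mul_le_mono_l; auto).
  nia.
Qed.

(* [(h / (g + h)) ^ K <= 1 / (1 + K g / (g + h)) <= 1 / 9], and [3/4 * 8/9 = 2/3]. *)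
Theorem rejection_sampling test val m K b rest :
  let g := length (filter test (all_strings m)) in
  3 * g <= 4 * length (filter (fun w => test w && eqb (val w) b) (all_strings m)) ->
  8 * 2 ^ m <= K * g ->
  2 * 2 ^ (K * m + rest) <=
  3 * length (filter (hits test val m K b) (all_strings (K * m + rest))).
Proof.
  intros g Hs HK. set (h := length (filter (fun w => negb (test w)) (all_strings m))).
  assert (Hgh : g + h = 2 ^ m) by (unfold g, h; now rewrite filter_negb_length, all_strings_length).
  assert (H := hits_count test val m K b rest Hs). fold h in H.
  assert (HB := bernoulli g h K). rewrite Hgh, Nat.pow_succ_r' in HB.
  assert (H0 := Nat.pow_nonzero 2 m).
  assert (H9 : 9 * h ^ K <= (2 ^ m) ^ K).
  { apply Nat.mul_le_mono_pos_l with (p := 2 ^ m); [lia|].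
    eapply Nat.le_trans; [|exact HB].
    replace (2 ^ m * (9 * h ^ K)) with (h ^ K * (2 ^ m + 8 * 2 ^ m)) by ring.
    apply Nat.mul_le_mono_l. lia. }
  assert (E : 2 ^ (K * m + rest) = (2 ^ m) ^ K * 2 ^ rest).
  { rewrite Nat.pow_add_r, <- Nat.pow_mul_r. f_equal. f_equal. lia. }
  assert (H10 : 9 * h ^ K * 2 ^ rest <= (2 ^ m) ^ K * 2 ^ rest) by (apply Nat.mul_le_mono_r; auto).
  rewrite E in H |- *. rewrite <- Nat.mul_assoc in H, H10. lia.
Qed.

Definition labelled (f : list bool -> bool) (n : nat) (ps : list (list bool * bool)) : Prop :=
  forall q, In q ps -> length (fst q) = n /\ snd q = f (fst q).

Lemma labelled_consistent (ev : list bool -> list bool -> bool) f n ps ps' w : labelled f n ps ->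
  (forall y, length y = n -> In (y, f y) ps') ->
  consistent (fun y => ev y w) ps' = true -> consistent (fun y => ev y w) ps = true.
Proof.
  unfold consistent. rewrite !forallb_forall. intros Hl Hall H [y b] Hq.
  destruct (Hl _ Hq) as [H1 H2]. simpl in *. subst b. apply (H (y, f y)). auto.
Qed.

(* Each example added to the list that a quarter of the surviving strings get wrong shrinks the set
   of survivors by a factor 3/4, so the greedy list stops within a logarithmic number of steps. *)
Lemma greedy (ev : list bool -> list bool -> bool) f n m :
  exists ps, labelled f n ps /\
    let G := filter (fun w => consistent (fun y => ev y w) ps) (all_strings m) in
    (forall y, length y = n ->
       3 * length G <= 4 * length (filter (fun w => eqb (ev y w) (f y)) G)) /\
    length G * 4 ^ length ps <= 3 ^ length ps * 2 ^ m.
Proof.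
  assert (IH : forall N ps,
    let G ps := filter (fun w => consistent (fun y => ev y w) ps) (all_strings m) in
    length (G ps) < N -> labelled f n ps ->
    length (G ps) * 4 ^ length ps <= 3 ^ length ps * 2 ^ m ->
    exists ps, labelled f n ps /\
      (forall y, length y = n ->
         3 * length (G ps) <= 4 * length (filter (fun w => eqb (ev y w) (f y)) (G ps))) /\
      length (G ps) * 4 ^ length ps <= 3 ^ length ps * 2 ^ m).
  { induction N as [|N IH]; intros ps G HN Hl Hb; [lia|].
    destruct (forallb (fun y => 3 * length (G ps) <=?
        4 * length (filter (fun w => eqb (ev y w) (f y)) (G ps))) (all_strings n)) eqn:E.
    - exists ps. split; auto. split; auto. intros y Hy. rewrite forallb_forall in E.
      apply Nat.leb_le. apply E. now apply in_all_strings.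
    - assert (Hex : exists y, In y (all_strings n) /\
          ~ 3 * length (G ps) <= 4 * length (filter (fun w => eqb (ev y w) (f y)) (G ps))).
      { apply not_true_iff_false in E. revert E. rewrite forallb_forall. generalize (all_strings n).
        clear. induction l as [|y l IH]; intros H; [exfalso; apply H; simpl; tauto|].
        destruct (le_dec (3 * length (G ps)) (4 * length (filter (fun w => eqb (ev y w) (f y)) (G ps)))).
        - destruct IH as (z & H1 & H2).
          + intros Hl. apply H. intros z [<-|Hz]; auto. now apply Nat.leb_le.
          + exists z. simpl. auto.
        - exists y. simpl. auto. }
      destruct Hex as (y & Hy & Hlt). apply in_all_strings in Hy.
      assert (EG : G ((y, f y) :: ps) = filter (fun w => eqb (ev y w) (f y)) (G ps)).
      { unfold G. rewrite filter_filter. apply filter_ext. intros w. simpl. apply andb_comm. }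
      apply (IH ((y, f y) :: ps)).
      + change (length (G ((y, f y) :: ps)) < N). rewrite EG. lia.
      + intros q [<-|Hq]; simpl; auto.
      + change (length (G ((y, f y) :: ps)) * 4 ^ length ((y, f y) :: ps) <=
                3 ^ length ((y, f y) :: ps) * 2 ^ m).
        rewrite EG. simpl length. rewrite !Nat.pow_succ_r'.
        set (a := length (filter (fun w => eqb (ev y w) (f y)) (G ps))) in *.
        assert (4 * a * 4 ^ length ps <= 3 * length (G ps) * 4 ^ length ps)
          by (apply Nat.mul_le_mono_r; lia).
        lia. }
  apply (IH (S (length (filter (fun w => consistent (fun y => ev y w) []) (all_strings m)))) []).
  - auto.
  - intros q [].
  - simpl. rewrite filter_const, all_strings_length. lia.
Qed.

Lemma pow_bound l D : 4 ^ l <= 3 ^ l * D -> l < 3 * Nat.log2 D + 3.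
Proof.
  (* [4 ^ 3 >= 2 * 3 ^ 3] *)
  intros H. set (j := S (Nat.log2 D)).
  assert (HD : D < 2 ^ j).
  { destruct D; [simpl; lia|]. apply Nat.log2_spec. lia. }
  assert (Hj : 2 ^ j * 3 ^ (3 * j) <= 4 ^ (3 * j)).
  { rewrite !Nat.pow_mul_r, <- Nat.pow_mul_l. apply Nat.pow_le_mono_l. simpl. lia. }
  destruct (Nat.lt_ge_cases l (3 * j)) as [|Hl]; [unfold j in *; lia|exfalso].
  replace l with (3 * j + (l - 3 * j)) in H by lia. rewrite !Nat.pow_add_r in H.
  set (e := l - 3 * j) in *.
  assert (H3 : 3 ^ e <= 4 ^ e) by (apply Nat.pow_le_mono_l; lia).
  assert (Hp : 0 < 3 ^ (3 * j)) by (apply Nat.neq_0_lt_0, Nat.pow_nonzero; lia).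
  assert (He : 0 < 3 ^ e) by (apply Nat.neq_0_lt_0, Nat.pow_nonzero; lia).
  assert (H4 : 2 ^ j * 3 ^ (3 * j) * 3 ^ e <= 4 ^ (3 * j) * 4 ^ e) by (apply Nat.mul_le_mono; auto).
  assert (H5 : 3 ^ (3 * j) * 3 ^ e * D < 3 ^ (3 * j) * 3 ^ e * 2 ^ j).
  { apply Nat.mul_lt_mono_pos_l; auto. apply Nat.mul_pos_pos; auto. }
  lia.
Qed.

(** * Growth rates *)

Definition polynomial (f : nat -> nat) : Prop := exists k, forall n, f n <= k * S n ^ k.

Lemma polynomial_le f g : polynomial g -> (forall n, f n <= g n) -> polynomial f.
Proof. intros (k & Hk) H. exists k. intros n. etransitivity; [apply H|apply Hk]. Qed.

Lemma polynomial_const c : polynomial (fun _ => c).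
Proof.
  exists c. intros n. assert (H := Nat.pow_nonzero (S n) c).
  rewrite <- (Nat.mul_1_r c) at 1. apply Nat.mul_le_mono_l. lia.
Qed.

Lemma polynomial_id : polynomial (fun n => n).
Proof. exists 1. intros n. simpl. lia. Qed.

Lemma pow_S_mono n a b : a <= b -> S n ^ a <= S n ^ b.
Proof. intros. apply Nat.pow_le_mono_r; lia. Qed.

Lemma polynomial_add f g : polynomial f -> polynomial g -> polynomial (fun n => f n + g n).
Proof.
  intros (a & Ha) (b & Hb). exists (a + b). intros n.
  rewrite Nat.mul_add_distr_r. apply Nat.add_le_mono.
  - etransitivity; [apply Ha|]. apply Nat.mul_le_mono_l, pow_S_mono. lia.
  - etransitivity; [apply Hb|]. apply Nat.mul_le_mono_l, pow_S_mono. lia.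
Qed.

Lemma polynomial_mul f g : polynomial f -> polynomial g -> polynomial (fun n => f n * g n).
Proof.
  intros (a & Ha) (b & Hb). exists (a * b + (a + b)). intros n.
  transitivity ((a * S n ^ a) * (b * S n ^ b)); [apply Nat.mul_le_mono; auto|].
  replace ((a * S n ^ a) * (b * S n ^ b)) with ((a * b) * S n ^ (a + b))
    by (rewrite Nat.pow_add_r; ring).
  apply Nat.mul_le_mono; [lia|]. apply pow_S_mono. lia.
Qed.

Lemma polynomial_pow f k : polynomial f -> polynomial (fun n => f n ^ k).
Proof.
  intros Hf. induction k; simpl; [apply polynomial_const|]. now apply polynomial_mul.
Qed.

Lemma polynomial_succ f : polynomial f -> polynomial (fun n => S (f n)).
Proof.
  intros. eapply polynomial_le; [apply polynomial_add; [exact H|apply (polynomial_const 1)]|].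
  intros. simpl. lia.
Qed.

Ltac poly := repeat first
  [ apply polynomial_const | apply polynomial_id | assumption | apply polynomial_add
  | apply polynomial_mul | apply polynomial_pow | apply polynomial_succ ].

Lemma scaled_power k n : 1 <= n -> k * S n ^ k <= S n ^ (2 * k).
Proof.
  intros Hn. replace (2 * k) with (k + k) by lia. rewrite Nat.pow_add_r.
  apply Nat.mul_le_mono_r. transitivity (2 ^ k).
  - apply Nat.lt_le_incl, Nat.pow_gt_lin_r. lia.
  - apply Nat.pow_le_mono_l. lia.
Qed.

Lemma polynomial_bound f : polynomial f -> exists k, forall n, f n <= poly_bound k n.
Proof.
  intros (k & Hk). exists (2 * k). intros n. etransitivity; [apply Hk|]. unfold poly_bound.
  destruct n as [|n].
  - rewrite Nat.pow_1_l. lia.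
  - assert (H := scaled_power k (S n)). lia.
Qed.

Lemma poly_bound_polynomial k : polynomial (poly_bound k).
Proof. unfold poly_bound. poly. Qed.

Definition exponential (f : nat -> nat) : Prop :=
  exists p, polynomial p /\ forall n, f n <= 2 ^ p n.

Lemma exponential_poly f : polynomial f -> exponential f.
Proof.
  intros H. exists f. split; auto. intros n. apply Nat.lt_le_incl, Nat.pow_gt_lin_r. lia.
Qed.

Lemma exponential_mul f g : exponential f -> exponential g -> exponential (fun n => f n * g n).
Proof.
  intros (p & Hp & H1) (q & Hq & H2). exists (fun n => p n + q n). split; [poly|].
  intros n. rewrite Nat.pow_add_r. apply Nat.mul_le_mono; auto.
Qed.

Lemma exponential_add f g : exponential f -> exponential g -> exponential (fun n => f n + g n).
Proof.
  intros (p & Hp & H1) (q & Hq & H2). exists (fun n => S (p n + q n)). split; [poly|].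
  intros n. specialize (H1 n). specialize (H2 n). rewrite Nat.pow_succ_r', Nat.pow_add_r.
  assert (Ha := Nat.pow_nonzero 2 (p n)). assert (Hb := Nat.pow_nonzero 2 (q n)). nia.
Qed.

Lemma exponential_pow2 p : polynomial p -> exponential (fun n => 2 ^ p n).
Proof. intros. exists p. auto. Qed.

Lemma exponential_le f g : exponential g -> (forall n, f n <= g n) -> exponential f.
Proof. intros (p & Hp & H) Hf. exists p. split; auto. intros n. etransitivity; eauto. Qed.

Lemma exponential_bound f : exponential f -> exists k, forall n, f n <= exp_bound k n.
Proof.
  intros (p & (k & Hk) & H). exists (2 * k + 2 ^ k). intros n.
  etransitivity; [apply H|]. unfold exp_bound. destruct n as [|n].
  - specialize (Hk 0). rewrite Nat.pow_1_l in Hk.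
    assert (2 ^ p 0 <= 2 ^ k) by (apply Nat.pow_le_mono_r; lia). lia.
  - assert (2 ^ p (S n) <= 2 ^ (S (S n) ^ (2 * k + 2 ^ k))); [|lia].
    apply Nat.pow_le_mono_r; [lia|]. etransitivity; [apply Hk|].
    etransitivity; [apply scaled_power; lia|]. apply pow_S_mono. lia.
Qed.

Lemma time_of_mono a b : a <= b -> time_of a <= time_of b.
Proof. intros. unfold time_of. apply Nat.mul_le_mono; [apply Nat.mul_le_mono_l|]; lia. Qed.

Lemma linear_lt_pow2 N : exists J, forall j, J <= j -> N * (j + 1) + 1 <= 2 ^ j.
Proof.
  exists (2 * N + 4). intros j Hj. replace j with ((2 * N + 4) + (j - (2 * N + 4))) by lia.
  induction (j - (2 * N + 4)) as [|i IH].
  - rewrite Nat.add_0_r, Nat.pow_add_r, Nat.pow_mul_r.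
    change (2 ^ 2) with (2 * 2). rewrite Nat.pow_mul_l. change (2 ^ 4) with 16.
    assert (N < 2 ^ N) by (apply Nat.pow_gt_lin_r; lia). nia.
  - rewrite (Nat.add_succ_r (2 * N + 4) i), Nat.pow_succ_r'. lia.
Qed.

Lemma log2R_le m : 1 <= m -> (log2R (INR m) <= INR (Nat.log2 m + 1))%R.
Proof.
  intros Hm. unfold log2R. assert (H2 : (0 < ln 2)%R) by (rewrite <- ln_1; apply ln_increasing; lra).
  apply Rmult_le_reg_r with (ln 2); auto. unfold Rdiv. rewrite Rmult_assoc, Rinv_l, Rmult_1_r by lra.
  rewrite <- ln_pow by lra.
  destruct (Nat.log2_spec m) as [_ H]; [lia|].
  assert (H3 : (INR m < 2 ^ (Nat.log2 m + 1))%R).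
  { replace 2%R with (INR 2) by (simpl; lra).
    rewrite <- pow_INR. apply lt_INR. rewrite Nat.add_1_r. exact H. }
  left. apply ln_increasing; auto. apply lt_0_INR. lia.
Qed.

Lemma nat_choice {A} (P : nat -> A -> Prop) :
  (forall n, exists a, P n a) -> exists f, forall n, P n (f n).
Proof.
  intros H. exists (fun n => proj1_sig (constructive_indefinite_description _ (H n))).
  intros n. apply proj2_sig.
Qed.

(** * Density of good strings and the theorem *)

Section Main.
Variables (alpha : nat -> list bool) (c : R).
Hypothesis alpha_length : forall n, length (alpha n) = n.
Hypothesis c_pos : (0 < c)%R.
Hypothesis alpha_hard : ~ io_EXP_adv alpha (fun n => (INR n - c * log2R (INR n))%R).

Variables (M MA : TM) (d k kA : nat).
Hypothesis d_pos : 1 <= d.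

Definition label (n : nat) (x : list bool) : bool := accepts_b MA x [] [] (exp_bound kA n).
Definition eval (n : nat) (x w : list bool) : bool := accepts_b M x w [] (poly_bound k n).
Definition good (n : nat) (w : list bool) : bool :=
  consistent (fun y => eval n y w) (pairs_of MA n (exp_bound kA n)).

Hypothesis alpha_good : forall n, good n (alpha (n ^ d)) = true.

Definition ngood (n : nat) : nat := length (filter (good n) (strings_of (n ^ d))).

Lemma ngood_pos n : 1 <= ngood n.
Proof.
  unfold ngood. assert (H : In (alpha (n ^ d)) (filter (good n) (strings_of (n ^ d)))).
  { apply filter_In. split; auto. apply strings_of_all. apply alpha_length. }
  destruct (filter _ _); simpl in *; [tauto|lia].
Qed.

Lemma pow_d_inj a b : a ^ d = b ^ d -> a = b.
Proof.
  intros H. destruct (Nat.lt_trichotomy a b) as [L|[E|L]]; auto; exfalso;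
    apply (Nat.pow_lt_mono_l _ _ d) in L; lia.
Qed.

Lemma le_pow_d n : n <= n ^ d.
Proof.
  destruct n; [lia|]. rewrite <- (Nat.pow_1_r (S n)) at 1. apply pow_S_mono. auto.
Qed.

(* If the good strings were rare, [alpha m] would be determined by [n] and its index among them. *)
Lemma good_dense : exists e, forall n, 2 ^ (n ^ d) <= ngood n * poly_bound e n.
Proof.
  destruct (archimed c) as [Hup _]. set (N := Z.to_nat (up c)).
  assert (HN : (c <= INR N)%R).
  { unfold N. rewrite INR_IZR_INZ, Z2Nat.id; [lra|]. apply le_IZR. lra. }
  (* [m ^ c'] pays for the [m ^ c] of the hypothesis, the [2 log n + O(1)] bits that encode [n],
     and the rounding of the logarithms. *)
  set (c' := 5 + 2 * N).
  set (rare := fun n m => m = n ^ d /\ ngood n * 2 ^ (c' * Nat.log2 m) < 2 ^ m).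
  assert (Hadv : forall m, exists adv, exists l n idx,
     adv = parse_adv (rev (bits l n)) idx /\ n < 2 ^ l /\ n <= m /\ l <= m + 1 /\ length idx <= m /\
     (2 <= m -> length adv = 1 \/ length adv + N * (Nat.log2 m + 1) <= m) /\
     forall n', rare n' m -> n = n' /\ exists i L, idx = rev (bits L i) /\ i < 2 ^ L /\
        nth_error (filter (good n) (strings_of m)) i = Some (alpha m)).
  { intros m. destruct (classic (exists n, rare n m)) as [(n & Hm & Hr)|Hno].
    - set (F := filter (good n) (strings_of m)).
      assert (HF : length F = ngood n) by (unfold F, ngood; now rewrite Hm).
      assert (Hin : In (alpha m) F).
      { apply filter_In. split; [apply strings_of_all, alpha_length|rewrite Hm; auto]. }
      apply In_nth_error in Hin as (i & Hi).
      assert (Hil : i < length F) by (apply nth_error_Some; congruence).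
      set (L := Nat.log2_up (ngood n)).
      assert (HL : i < 2 ^ L).
      { eapply Nat.lt_le_trans; [exact Hil|]. rewrite HF. apply Nat.log2_log2_up_spec.
        apply ngood_pos. }
      assert (HLm : L + c' * Nat.log2 m <= m).
      { destruct (Nat.eq_dec (ngood n) 1) as [E1|E1].
        - unfold L. rewrite E1 in Hr |- *. simpl. rewrite Nat.mul_1_l in Hr.
          apply Nat.pow_lt_mono_r_iff in Hr; lia.
        - assert (Hp := ngood_pos n).
          destruct (Nat.log2_up_spec (ngood n)) as [H1 _]; [lia|]. fold L in H1.
          assert (H2 : 2 ^ (pred L + c' * Nat.log2 m) < 2 ^ m).
          { rewrite Nat.pow_add_r. eapply Nat.le_lt_trans; [|exact Hr].
            apply Nat.mul_le_mono_r. lia. }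
          apply Nat.pow_lt_mono_r_iff in H2; [|lia].
          assert (0 < L) by (apply Nat.log2_up_pos; lia). lia. }
      assert (Hnm : n <= m) by (rewrite Hm; apply le_pow_d).
      set (l := S (Nat.log2 n)).
      assert (Hl : l <= S (Nat.log2 m)) by (apply le_n_S, Nat.log2_le_mono; auto).
      exists (parse_adv (rev (bits l n)) (rev (bits L i))), l, n, (rev (bits L i)).
      split; [auto|]. split.
      { unfold l. destruct n; [simpl; lia|]. apply Nat.log2_spec. lia. }
      split; [auto|]. split.
      { assert (H := Nat.log2_le_lin m). lia. }
      rewrite length_rev, bits_length. split; [lia|]. split.
      { intros Hm2. right.
        assert (He : length (parse_adv (rev (bits l n)) (rev (bits L i))) = 2 * l + 1 + L).
        { assert (H : forall u, length (flagged u) = 2 * length u).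
          { unfold flagged. induction u; simpl in *; lia. }
          unfold parse_adv. rewrite length_app, H. cbn [length].
          rewrite !length_rev, !bits_length. lia. }
        rewrite He. assert (1 <= Nat.log2 m) by (apply (Nat.log2_le_mono 2 m); auto).
        unfold c' in HLm. nia. }
      intros n' [Hn' _]. split; [apply pow_d_inj; congruence|]. exists i, L. auto.
    - exists [false], 0, 0, []. repeat split; simpl; auto; try lia.
      + exfalso. eauto.
      + exfalso. eauto. }
  apply nat_choice in Hadv as (beta & Hbeta).
  set (U := fun m => (m + 3) + ((m + 2) ^ k + k) + (m + 2) ^ kA + (3 ^ (S m ^ kA) + kA) +
                     2 ^ m * (m + 1)).
  assert (HU : exponential U).
  { unfold U. repeat apply exponential_add; try (apply exponential_poly; poly; fail).
    - apply exponential_le with (fun m => 2 ^ (2 * S m ^ kA)).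
      + apply exponential_pow2. poly.
      + intros m. rewrite Nat.pow_mul_r. apply Nat.pow_le_mono_l. simpl. lia.
    - apply exponential_mul; [apply exponential_pow2|apply exponential_poly]; poly. }
  destruct (exponential_bound (fun m => time_of (EXP_cost M MA k kA * (U m * U m * U m)))) as (K & HK).
  { unfold time_of.
    repeat first [exact HU | apply exponential_poly; apply polynomial_const
                 | apply exponential_mul | apply exponential_add]. }
  set (TM1 := machine (transducer_code (EXP_cmd M MA k kA))).
  assert (Hrun : forall m, halts_within TM1 (zeros m) (beta m) [] (exp_bound K m) /\
     forall n, rare n m -> 1 <= m -> output TM1 (zeros m) (beta m) [] (exp_bound K m) = alpha m).
  { intros m. destruct (Hbeta m) as (l & n & idx & Eb & Hl1 & Hnm & Hl2 & Hidx & _ & Hr).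
    assert (Hz : length (zeros m) = m) by apply repeat_length.
    assert (P1 : (n + 2) ^ k <= (m + 2) ^ k) by (apply Nat.pow_le_mono_l; lia).
    assert (P2 : (n + 2) ^ kA <= (m + 2) ^ kA) by (apply Nat.pow_le_mono_l; lia).
    assert (P3 : 3 ^ (S n ^ kA) <= 3 ^ (S m ^ kA)).
    { apply Nat.pow_le_mono_r; [lia|]. apply Nat.pow_le_mono_l. lia. }
    assert (P4 : 2 ^ n * (n + 1) <= 2 ^ m * (m + 1)).
    { apply Nat.mul_le_mono; [apply Nat.pow_le_mono_r|]; lia. }
    destruct (EXP_runs M MA k kA (zeros m) l n idx (U m)) as (s' & (t & Ht & He) & Hempty & Hout);
      rewrite ?Hz; unfold U; try lia.
    rewrite <- Eb in He.
    match type of Hout with _ = flagged ?o ++ _ => set (out := o) in * end.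
    destruct (transducer_correct _ rOUT out _ _ _ _ _ (exp_bound K m) ltac:(know_nreg; lia) He Hempty Hout)
      as [Hh Ho].
    { etransitivity; [|apply HK]. apply time_of_mono. exact Ht. }
    split; [exact Hh|]. intros n' Hn' Hm1. destruct (Hr n' Hn') as (-> & i & L & -> & Hi & Hnth).
    assert (E : out = alpha m).
    { unfold out. rewrite rev_involutive, Hz.
      change (fun w => consistent _ _) with (good n'). rewrite pick_nth by auto. now rewrite Hnth. }
    rewrite E in Ho. apply Ho. intros E0. assert (H := alpha_length m). rewrite E0 in H.
    simpl in H. lia. }
  assert (HM0 : exists M0, forall m, M0 <= m -> forall n, rare n m -> m = 0).
  { apply NNPP. intros Hno. apply alpha_hard.
    destruct (linear_lt_pow2 N) as (J & HJ).
    exists TM1, K, beta, (2 + 2 ^ J). split; [apply Hrun|]. split.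
    - intros m Hm. destruct (Hbeta m) as (l & n & idx & _ & _ & _ & _ & _ & Hlen & _).
      assert (H1 : length (beta m) + N * (Nat.log2 m + 1) <= m).
      { destruct (Hlen ltac:(lia)) as [->|H]; auto.
        assert (HJ2 : J <= Nat.log2 m) by (apply Nat.log2_le_pow2; lia).
        specialize (HJ _ HJ2). destruct (Nat.log2_spec m) as [H1 _]; lia. }
      apply le_INR in H1. rewrite plus_INR, mult_INR in H1.
      assert (H2 : (c * log2R (INR m) <= INR N * INR (Nat.log2 m + 1))%R).
      { apply Rle_trans with (c * INR (Nat.log2 m + 1))%R.
        - apply Rmult_le_compat_l; [lra|]. apply log2R_le. lia.
        - apply Rmult_le_compat_r; [apply pos_INR|auto]. }
      lra.
    - intros M0. apply NNPP. intros Hno2. apply Hno. exists M0. intros m Hm n Hr.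
      destruct (Nat.eq_dec m 0); auto. exfalso. apply Hno2. exists m. split; auto.
      apply (proj2 (Hrun m) n Hr). lia. }
  destruct HM0 as (M0 & HM0).
  destruct (polynomial_bound (fun n => (n ^ d) ^ c' + 2 ^ M0)) as (e & He); [poly|].
  exists e. intros n. transitivity (ngood n * ((n ^ d) ^ c' + 2 ^ M0)).
  2:{ apply Nat.mul_le_mono_l, He. }
  assert (Hp := ngood_pos n). set (m := n ^ d) in *.
  assert (Hpos : 2 ^ M0 <> 0) by (apply Nat.pow_nonzero; lia).
  destruct (Nat.lt_ge_cases m M0) as [Hlt|Hge].
  - assert (2 ^ m <= 2 ^ M0) by (apply Nat.pow_le_mono_r; lia). nia.
  - destruct (Nat.eq_dec m 0) as [E0|E0]; [rewrite E0; simpl; nia|].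
    assert (Hnr : ~ rare n m) by (intros H; apply E0; eauto).
    assert (H1 : 2 ^ m <= ngood n * 2 ^ (c' * Nat.log2 m)).
    { apply Nat.le_ngt. intros H. apply Hnr. split; auto. }
    assert (H2 : 2 ^ (c' * Nat.log2 m) <= m ^ c').
    { rewrite Nat.mul_comm, Nat.pow_mul_r. apply Nat.pow_le_mono_l.
      apply Nat.log2_spec. lia. }
    etransitivity; [exact H1|]. apply Nat.mul_le_mono_l. lia.
Qed.

Lemma pairs_code_length n f ps : labelled f n ps -> length (pairs_code ps) = length ps * (n + 1).
Proof.
  intros H. unfold pairs_code. rewrite flat_map_concat_map, (concat_length_const _ (n + 1)).
  - now rewrite length_map.
  - intros u Hu. apply in_map_iff in Hu as (q & <- & Hq). simpl. destruct (H _ Hq) as [-> _]. lia.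
Qed.

Lemma good_consistent n ps w : labelled (label n) n ps -> good n w = true ->
  consistent (fun y => eval n y w) ps = true.
Proof.
  intros Hl Hg. eapply labelled_consistent; [exact Hl| |exact Hg].
  intros y Hy. unfold pairs_of. apply -> in_rev. apply in_map_iff. exists y.
  split; auto. now apply strings_of_all.
Qed.

Lemma log2_poly_bound e n : 2 <= n -> Nat.log2 (poly_bound e n) <= 3 * (e + 1) * Nat.log2 n.
Proof.
  intros Hn. assert (H1 : 1 <= Nat.log2 n) by (apply (Nat.log2_le_mono 2 n); auto).
  assert (H2 : poly_bound e n < 2 ^ ((e + 1) * (Nat.log2 n + 2))).
  { rewrite Nat.mul_comm, Nat.pow_mul_r.
    assert (H3 : n + 2 <= 2 ^ (Nat.log2 n + 2)).
    { destruct (Nat.log2_spec n) as [_ H]; [lia|]. rewrite Nat.pow_add_r. simpl in *. lia. }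
    eapply Nat.lt_le_trans; [|apply Nat.pow_le_mono_l; exact H3].
    unfold poly_bound. rewrite Nat.pow_add_r, Nat.pow_1_r.
    assert (S n ^ e <= (n + 2) ^ e) by (apply Nat.pow_le_mono_l; lia).
    assert (e < (n + 2) ^ e) by (apply Nat.pow_gt_lin_r; lia).
    rewrite Nat.mul_add_distr_l. lia. }
  destruct (Nat.eq_dec (poly_bound e n) 0) as [->|H0]; [apply Nat.le_0_l|].
  apply Nat.log2_lt_pow2 in H2; [|lia].
  assert ((e + 1) * 1 <= (e + 1) * Nat.log2 n) by (apply Nat.mul_le_mono_l; auto). lia.
Qed.

Theorem BPP_of_hard (A : language) :
  (forall x, A x <-> label (length x) x = true) -> In_BPP_nlogn A.
Proof.
  intros HA. destruct good_dense as (e & He).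
  assert (Hps : forall n, exists ps, labelled (label n) n ps /\
    length ps <= 3 * Nat.log2 (poly_bound e n) + 3 /\
    let G := filter (fun w => consistent (fun y => eval n y w) ps) (all_strings (n ^ d)) in
    2 ^ (n ^ d) <= length G * poly_bound e n /\
    forall y, length y = n ->
       3 * length G <= 4 * length (filter (fun w => eqb (eval n y w) (label n y)) G)).
  { intros n. destruct (greedy (eval n) (label n) n (n ^ d)) as (ps & Hl & Hq & Hc).
    set (G := filter (fun w => consistent (fun y => eval n y w) ps) (all_strings (n ^ d))) in *.
    assert (HG : 2 ^ (n ^ d) <= length G * poly_bound e n).
    { etransitivity; [apply He|]. apply Nat.mul_le_mono_r. unfold ngood.
      rewrite strings_of_count. apply filter_length_mono. intros w _. now apply good_consistent. }
    exists ps. split; [exact Hl|]. split; [|split; auto].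
    assert (H : length ps < 3 * Nat.log2 (poly_bound e n) + 3); [|lia].
    apply pow_bound. assert (H0 := Nat.pow_nonzero 2 (n ^ d)).
    apply Nat.mul_le_mono_pos_l with (p := length G).
    { destruct (length G); [simpl in HG; lia|lia]. }
    etransitivity; [exact Hc|].
    replace (length G * (3 ^ length ps * poly_bound e n))
      with (3 ^ length ps * (length G * poly_bound e n)) by ring.
    now apply Nat.mul_le_mono_l. }
  apply nat_choice in Hps as (ps & Hps2).
  assert (Hlen : forall n, length (pairs_code (ps n)) <= (3 * Nat.log2 (poly_bound e n) + 3) * (n + 1)).
  { intros n. destruct (Hps2 n) as (Hl & Hn & _). rewrite (pairs_code_length _ _ _ Hl).
    now apply Nat.mul_le_mono_r. }
  destruct (polynomial_bound (fun n => 8 * poly_bound e n)) as (kk & Hkk).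
  { assert (H := poly_bound_polynomial e). poly. }
  set (U := fun n => (n + 2) + (n + 1) ^ d + ((n + 2) ^ k + k) + ((n + 2) ^ kk + kk) +
                     (3 * poly_bound e n + 3) * (n + 1)).
  assert (HU : polynomial U).
  { assert (H := poly_bound_polynomial e). unfold U. poly. }
  destruct (polynomial_bound (fun n => time_of (BPP_cost M d k kk * (U n * U n * U n)) +
                                       poly_bound kk n * n ^ d)) as (kT & HkT).
  { assert (H := poly_bound_polynomial kk). unfold time_of. poly. }
  exists (machine (decider_code (BPP_cmd M d k kk) rOUT)), kT, (2 * (9 * (e + 1) + 3)), 2,
    (fun n => pairs_code (ps n)).
  split.
  { intros n Hn. assert (H1 := log2_poly_bound e n Hn).
    assert (H2 : 1 <= Nat.log2 n) by (apply (Nat.log2_le_mono 2 n); auto).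
    etransitivity; [apply Hlen|].
    transitivity ((9 * (e + 1) * Nat.log2 n + 3 * Nat.log2 n) * (2 * n)).
    - apply Nat.mul_le_mono; lia.
    - nia. }
  intros x. cbv zeta. set (n := length x). set (t := poly_bound kT n).
  destruct (Hps2 n) as (Hl & _ & Hd & Hq).
  specialize (HkT n). cbv beta in HkT. fold t in HkT.
  set (test := fun w => consistent (fun y => eval n y w) (ps n)) in *.
  assert (Hrun : forall r, length r = t ->
    halts_within (machine (decider_code (BPP_cmd M d k kk) rOUT)) x (pairs_code (ps n)) r t /\
    (accepts_b (machine (decider_code (BPP_cmd M d k kk) rOUT)) x (pairs_code (ps n)) r t = true <->
     first_hit test (eval n x) (n ^ d) (poly_bound kk n) r = Some true)).
  { intros r Hr. destruct (BPP_runs M d k kk x (ps n) r (U n)) as (s' & (t0 & Ht0 & He0) & Hout).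
    - intros q Hq'. apply (Hl q Hq').
    - fold n. unfold U. lia.
    - fold n. unfold U. lia.
    - fold n. unfold U. lia.
    - fold n. unfold U. lia.
    - etransitivity; [apply Hlen|]. unfold U.
      assert (H := Nat.log2_le_lin (poly_bound e n)).
      assert ((3 * Nat.log2 (poly_bound e n) + 3) * (n + 1) <= (3 * poly_bound e n + 3) * (n + 1))
        by (apply Nat.mul_le_mono_r; lia).
      lia.
    - fold n. lia.
    - destruct (decider_correct (BPP_cmd M d k kk) rOUT _ _ _ _ _ t ltac:(know_nreg; lia) He0) as [H1 H2].
      { assert (H := time_of_mono _ _ Ht0). lia. }
      split; auto. rewrite H2, Hout. fold n.
      change (first_hit (fun w => consistent _ _) _ (n ^ d) (poly_bound kk n) r) with
        (first_hit test (eval n x) (n ^ d) (poly_bound kk n) r).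
      destruct (first_hit test (eval n x) (n ^ d) (poly_bound kk n) r); simpl; [|easy].
      split; congruence. }
  split; [intros r Hr; apply (Hrun r Hr)|].
  assert (Hrej := rejection_sampling test (eval n x) (n ^ d) (poly_bound kk n) (label n x)
    (t - poly_bound kk n * n ^ d)).
  cbv zeta in Hrej. replace (poly_bound kk n * n ^ d + (t - poly_bound kk n * n ^ d)) with t in Hrej
    by lia.
  specialize (Hq x eq_refl). rewrite filter_filter in Hq. 
  specialize (Hrej Hq).
  assert (Hrej' : 2 * 2 ^ t <= 3 * length (filter (hits test (eval n x) (n ^ d) (poly_bound kk n)
     (label n x)) (all_strings t))).
  { apply Hrej. specialize (Hkk n). cbv beta in Hkk.
    set (G := length (filter test (all_strings (n ^ d)))) in *.
    transitivity ((8 * poly_bound e n) * G); [|now apply Nat.mul_le_mono_r].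
    change (filter _ (all_strings (n ^ d))) with (filter test (all_strings (n ^ d))) in Hd.
    fold G in Hd. lia. }
  clear Hrej. specialize (HA x). fold n in HA. split.
  - intros HAx. apply HA in HAx. rewrite HAx in Hrej'.
    eapply Nat.le_trans; [exact Hrej'|]. apply Nat.mul_le_mono_l, filter_length_mono.
    intros r Hr. apply in_all_strings in Hr. unfold hits.
    destruct (first_hit test (eval n x) (n ^ d) (poly_bound kk n) r) as [v|] eqn:E; [|easy].
    intros Hv. apply eqb_prop in Hv. subst v. apply (proj2 (Hrun r Hr)). auto.
  - intros HAx. assert (Hf : label n x = false).
    { destruct (label n x) eqn:E; auto. exfalso. apply HAx. now apply HA. }
    rewrite Hf in Hrej'.
    eapply Nat.le_trans; [exact Hrej'|]. apply Nat.mul_le_mono_l, filter_length_mono.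
    intros r Hr. apply in_all_strings in Hr. unfold hits.
    destruct (first_hit test (eval n x) (n ^ d) (poly_bound kk n) r) as [v|] eqn:E; [|easy].
    intros Hv. apply eqb_prop in Hv. subst v. apply negb_true_iff, not_true_iff_false.
    intros Ha. apply (proj2 (Hrun r Hr)) in Ha. congruence.
Qed.
End Main.

Theorem mainTheorem7 (alpha : nat -> list bool) (c : R) :
  (forall n, length (alpha n) = n) ->
  (0 < c)%R ->
  ~ io_EXP_adv alpha (fun n => (INR n - c * log2R (INR n))%R) ->
  forall A : language, In_EXP A ->
    (exists d, 1 <= d /\ In_P_adv_alpha alpha d A) ->
    In_BPP_nlogn A.
Proof.
  intros Hlen Hc Hhard A (MA & kA & HMA) (d & Hd & M & k & HM).
  apply (BPP_of_hard alpha c Hlen Hc Hhard M MA d k kA Hd).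
  - intros n. unfold good, consistent. apply forallb_forall. intros q Hq.
    unfold pairs_of in Hq. apply in_rev, in_map_iff in Hq as (y & <- & Hy).
    apply strings_of_length in Hy. subst n. simpl. apply eqb_true_iff.
    apply eq_true_iff_eq. unfold eval.
    rewrite (proj2 (HM y)), <- (proj2 (HMA y)). reflexivity.
  - intros x. unfold label. symmetry. apply HMA.
Qed.
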